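(* Let $X=(X_t^x)_{t\ge 0}$, $x\in H$, be the process with components $$X_t^{x,n}=e^{-\gamma_n t}x_n+\int_0^t e^{-\gamma_n(t-s)}\,dZ_s^n,\qquad n\in\mathbb N,\ t\ge 0,$$ and suppose that it takes values in $H$, i.e. that $$\sum_{n=1}^\infty \int_0^1\bigg(e^{-2\gamma_n s}\int_{\{|z|\le e^{\gamma_n s}\}}z^2\,\nu_n(dz)+\int_{\{|z|>e^{\gamma_n s}\}}\nu_n(dz)\bigg)\,ds<\infty .$$ Suppose that for every $n\ge 1$ the Lévy measure $\nu_n$ of $(Z_t^n)_{t\ge 0}$ satisfies $$\nu_n(dz)\ge |z|^{-1}f_n(z^{-2})\,dz,$$ where $f_n$ is a Bernstein function with $f_n(0)=0$ and $\lim_{r\to\infty}\frac{f_n(r)}{\log(1+r)}=\infty$. For $t>0$ put $$C_t:=\sqrt{2\sup_{k\ge 1}\bigg[\bigg(\int_0^\infty e^{-\frac{\cos 1}{2}t f_k(r)}\,dr\bigg)\wedge\bigg(e^{-\gamma_k t}\int_0^\infty e^{-\frac{(\cos 1)(1-e^{-2\gamma_k t})}{4\gamma_k}f_k(r)}\,dr\bigg)\bigg]}\in[0,\infty].$$ Then for any $t>0$ and $x,y\in H$, $$\|\nabla P_t\|_\infty\le C_t$$ and $$\|P_t(x,\cdot)-P_t(y,\cdot)\|_{\mathrm{Var}}\le 2C_t\|x-y\|.$$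
   Context: Setting. $H$ is a real separable Hilbert space with norm $\|\cdot\|$ and a fixed orthonormal basis $(e_n)_{n\ge1}$; $H$ is identified with $\ell^2$ via $x=\sum_n x_n e_n\leftrightarrow (x_n)$. $A$ is a self-adjoint operator on $H$ with $e_n\in D(A)$, $Ae_n=-\gamma_n e_n$, $\gamma_n>0$ for all $n\ge1$, and $\lim_{n\to\infty}\gamma_n=\infty$. Noise. $(Z_t^n)_{t\ge0}$, $n\ge1$, are independent real-valued pure jump Lévy processes on a common stochastic basis; $Z^n$ has Lévy measure $\nu_n$ on $\mathbb R\setminus\{0\}$ (with $\int(1\wedge z^2)\,\nu_n(dz)<\infty$), and pure jump means $$\mathbb E e^{ihZ_t^n}=e^{-t\psi_n(h)},\qquad \psi_n(h)=\int_{\mathbb R}\big(1-e^{ihz}+ihz\mathbf 1_{\{|z|\le1\}}\big)\,\nu_n(dz),\quad h\in\mathbb R.$$ The cylindrical Lévy process is $Z_t=\sum_n Z_t^n e_n$, and $X$ is the coordinatewise solution of $dX_t=AX_t\,dt+dZ_t$, $X_0=x\in H$, a priori taking values in $\mathbb R^{\mathbb N}$. $X$ takes values in $H$ if, for all $x\in H$ and $t\ge0$, almost surely $(X_t^{x,n})_n\in\ell^2$; this is equivalent to the summability condition displayed in the claim. In that case $X$ is a Markov process on $H$. Notation. $B_b(H)$ is the set of bounded Borel measurable real functions on $H$, $\|g\|_{H,\infty}=\sup_{x\in H}|g(x)|$, $P_tg(x)=\mathbb E\,g(X_t^x)$ is the transition semigroup, and $P_t(x,\cdot)$ is the law of $X_t^x$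 on $H$. The total variation norm is $\|\mu_1-\mu_2\|_{\mathrm{Var}}=\sup\{|\int g\,d\mu_1-\int g\,d\mu_2|: g\in B_b(H),\ \|g\|_{H,\infty}\le1\}$. The gradient norm is $$\|\nabla P_t\|_\infty=\sup\big\{|\nabla_zP_tg(x)|:\ \|z\|\le1,\ x\in H,\ g\in B_b(H),\ \|g\|_{H,\infty}\le1\big\},\qquad |\nabla_zP_tg(x)|=\limsup_{\varepsilon\to0}\frac1\varepsilon\big|P_tg(x+\varepsilon z)-P_tg(x)\big|.$$ A continuous function $f:[0,\infty)\to[0,\infty)$, infinitely differentiable on $(0,\infty)$, is a Bernstein function if $(-1)^kf^{(k)}(x)\le0$ for all $x>0$ and $k\ge1$. $a\wedge b=\min(a,b)$. *)

(* Defs.v *)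
From HB Require Import structures.
From mathcomp Require Import all_boot all_order all_algebra finmap complex.
From mathcomp Require Import all_classical all_reals all_analysis.

Set Implicit Arguments.
Unset Strict Implicit.
Unset Printing Implicit Defensive.

Import Order.TTheory GRing.Theory Num.Theory.
Import numFieldNormedType.Exports.

Local Open Scope classical_set_scope.
Local Open Scope ring_scope.

Definition inner_product (R : realType) (H : normedModType R)
    (dot : H -> H -> R) : Prop :=
  [/\ forall x y, dot x y = dot y x,
      forall (a : R) x y z, dot (a *: x + y) z = a * dot x z + dot y z &
      forall x, `|x| ^+ 2 = dot x x].

Definition orthonormal_basis (R : realType) (H : normedModType R)
    (dot : H -> H -> R) (e : nat -> H) : Prop :=
  (forall m n, dot (e m) (e n) = (m == n)%:R) /\
  (forall x, series (fun n => dot x (e n) *: e n) @ \oo --> x).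

(* A is only meaningful on its domain D; the last clause is the equality of   *)
(* the graphs of A and of its adjoint.                                        *)
Definition self_adjoint (R : realType) (H : normedModType R)
    (dot : H -> H -> R) (D : set H) (A : H -> H) : Prop :=
  [/\ dense D,
      D 0,
      forall (a : R) x y, D x -> D y ->
        D (a *: x + y) /\ A (a *: x + y) = a *: A x + A y &
      forall y w, (D y /\ A y = w) <->
        (forall x, D x -> dot (A x) y = dot x w)].

Definition borel (R : realType) (H : normedModType R) :=
  g_sigma_algebraType (@open H).

Definition mutually_independent d (T : measurableType d) (R : realType)
    (P : probability T R) (I : choiceType) (F : I -> set_system T) : Prop :=
  forall (J : {fset I}) (E : I -> set T),
    (forall i, i \in J -> F i (E i)) ->
    P (\bigcap_(i in [set` J]) E i) = (\prod_(i <- J) P (E i))%E.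

Definition sigma_of d (T : measurableType d) (R : realType)
    (I : Type) (D : set I) (X : I -> T -> R) : set_system T :=
  <<s \bigcup_(i in D) preimage_set_system [set: T] (X i) measurable >>.

Definition cadlag (R : realType) (f : R -> R) : Prop :=
  (forall t, 0 <= t -> f x @[x --> t^'+] --> f t) /\
  (forall t, 0 < t -> cvg (f x @[x --> t^'-])).

(* The time parameter ranges over R; only its nonnegative values matter.      *)
Definition levy_process d (T : measurableType d) (R : realType)
    (P : probability T R) (Z : R -> {RV P >-> R}) : Prop :=
  [/\ {ae P, forall w, Z 0 w = 0},
      forall t : nat -> R, 0 <= t 0%N -> (forall k, t k <= t k.+1) ->
        mutually_independent P (fun k : nat =>
          sigma_of [set k] (fun j w => Z (t j.+1) w - Z (t j) w)),
      forall s t (B : set R), 0 <= s -> 0 <= t -> measurable B ->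
        P [set w | B (Z (s + t) w - Z s w)] = P [set w | B (Z t w)],
      forall t eps, 0 <= t -> 0 < eps ->
        P [set w | eps < `|Z s w - Z t w|]
          @[s --> within `[0, +oo[ (nbhs t)] --> 0%E &
      {ae P, forall w, cadlag (fun t => Z t w)}].

Definition levy_measure (R : realType)
    (nu : {measure set (measurableTypeR R) -> \bar R}) : Prop :=
  nu [set 0] = 0%E /\ (\int[nu]_z (Num.min 1 (z ^+ 2))%:E < +oo)%E.

Definition cexp (R : realType) (z : R[i]) : R[i] :=
  Complex (expR (complex.Re z) * cos (complex.Im z))
          (expR (complex.Re z) * sin (complex.Im z)).

Definition char_fun d (T : measurableType d) (R : realType)
    (P : probability T R) (X : T -> R) (h : R) : R[i] :=
  Complex (\int[P]_w cos (h * X w)) (\int[P]_w sin (h * X w)).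

(* Real and imaginary parts of                                                *)
(*   \int (1 - e^{ihz} + i h z 1_{|z| <= 1}) nu(dz).                          *)
Definition levy_exponent (R : realType)
    (nu : {measure set (measurableTypeR R) -> \bar R}) (h : R) : R[i] :=
  Complex (\int[nu]_z (1 - cos (h * z)))
          (\int[nu]_z (h * z * (`|z| <= 1)%R%:R - sin (h * z))).

Definition pure_jump_levy_process d (T : measurableType d) (R : realType)
    (P : probability T R) (Z : R -> {RV P >-> R})
    (nu : {measure set (measurableTypeR R) -> \bar R}) : Prop :=
  [/\ levy_process Z, levy_measure nu &
      forall t h, 0 <= t ->
        char_fun P (Z t) h = cexp (- (Complex t 0 * levy_exponent nu h))].

Definition riemann_sum (R : realType) (a b : R) (s : seq R) (f z : R -> R) : R :=
  let tau := nth b (a :: s) in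
  \sum_(0 <= k < size s) f (tau k) * (z (tau k.+1) - z (tau k)).

Definition mesh_lt (R : realType) (a b : R) (s : seq R) (delta : R) : Prop :=
  let tau := nth b (a :: s) in
  forall k, (k < size s)%N -> tau k.+1 - tau k < delta.

(* Stochastic integral of a deterministic continuous integrand over [a, b]:   *)
(* the limit in probability of the left-point Riemann sums.                   *)
Definition is_stoch_integral d (T : measurableType d) (R : realType)
    (P : probability T R) (f : R -> R) (Z : R -> {RV P >-> R}) (a b : R)
    (Y : T -> R) : Prop :=
  forall eps eta : R, 0 < eps -> 0 < eta ->
  exists2 delta : R, 0 < delta &
    forall s, itv_partition a b s -> mesh_lt a b s delta ->
      (P [set w | (eps < `|riemann_sum a b s f (fun t => Z t w) - Y w|)%R]
         < eta%:E)%E.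

(* J n t stands for the integral of e^{-gamma_n (t-s)} dZ^n_s over [0, t].    *)
Definition ou_coord (R : realType) (T : Type) (H : normedModType R)
    (dot : H -> H -> R) (e : nat -> H) (gamma : nat -> R)
    (J : nat -> R -> T -> R) (t : R) (x : H) (w : T) (n : nat) : R :=
  expR (- (gamma n * t)) * dot x (e n) + J n t w.

(* Identification of l^2 with H; sequences outside l^2, which the process     *)
(* hits with probability zero when it takes values in H, are sent to 0.       *)
Definition of_coords (R : realType) (H : normedModType R) (e : nat -> H)
    (a : nat -> R) : H :=
  if `[< cvgn (series (fun n => a n ^+ 2)) >]
  then limn (series (fun n => a n *: e n)) else 0.

Definition ou_process (R : realType) (T : Type) (H : normedModType R)
    (dot : H -> H -> R) (e : nat -> H) (gamma : nat -> R)
    (J : nat -> R -> T -> R) (t : R) (x : H) (w : T) : H :=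
  of_coords e (ou_coord dot e gamma J t x w).

Definition summability_condition (R : realType) (gamma : nat -> R)
    (nu : nat -> {measure set (measurableTypeR R) -> \bar R}) : Prop :=
  (\sum_(0 <= n <oo)
     \int[lebesgue_measure]_(s in `[0%R, 1%R])
       ((expR (- (2 * gamma n * s)))%:E *
          (\int[nu n]_(z in [set z | `|z| <= expR (gamma n * s)]%R) (z ^+ 2)%:E)
        + nu n [set z | expR (gamma n * s) < `|z|]%R) < +oo)%E.

Definition sup_norm (R : realType) (H : normedModType R) (g : H -> R) : \bar R :=
  ereal_sup [set `|g x|%:E | x in [set: H]].

Definition bounded_borel (R : realType) (H : normedModType R) (g : H -> R) : Prop :=
  measurable_fun [set: borel H] (g : borel H -> R) /\ (sup_norm g < +oo)%E.

Definition semigroup d (T : measurableType d) (R : realType)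
    (P : probability T R) (H : normedModType R) (X : R -> H -> T -> H)
    (t : R) (g : H -> R) (x : H) : R :=
  \int[P]_w g (X t x w).

Definition transition_law d (T : measurableType d) (R : realType)
    (P : probability T R) (H : normedModType R) (X : R -> H -> T -> H)
    (t : R) (x : H) : set (borel H) -> \bar R :=
  pushforward P (X t x : T -> borel H).

Definition tv_norm (R : realType) (H : normedModType R)
    (mu1 mu2 : set (borel H) -> \bar R) : \bar R :=
  ereal_sup [set r | exists g : H -> R,
    [/\ bounded_borel g, (sup_norm g <= 1)%E &
        r = `|\int[mu1]_u (g u)%:E - \int[mu2]_u (g u)%:E|%E]].

Definition gradient (R : realType) (H : normedModType R) (F : H -> R)
    (z x : H) : \bar R :=
  limf_esup (fun eps : R => (eps^-1 * `|F (x + eps *: z) - F x|)%:E) 0^'.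

Definition gradient_norm (R : realType) (H : normedModType R)
    (Pt : (H -> R) -> H -> R) : \bar R :=
  ereal_sup [set r | exists (z x : H) (g : H -> R),
    [/\ `|z| <= 1, bounded_borel g, (sup_norm g <= 1)%E &
        r = gradient (Pt g) z x]].

(* Only the values of f on [0, +oo[ matter.                                   *)
Definition bernstein (R : realType) (f : R -> R) : Prop :=
  [/\ forall x, 0 <= x -> 0 <= f x,
      {within `[0, +oo[, continuous f},
      forall k x, 0 < x -> derivable (derive1n k f) x 1 &
      forall k x, (0 < k)%N -> 0 < x -> (-1) ^+ k * derive1n k f x <= 0].

Definition C_const (R : realType) (gamma : nat -> R) (f : nat -> R -> R)
    (t : R) : \bar R :=
  sqrte (2%:E * ereal_sup [set
    mine
      (\int[lebesgue_measure]_(r in `[0%R, +oo[)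
         (expR (- (cos 1 / 2 * t * f k r)))%:E)
      ((expR (- (gamma k * t)))%:E *
       \int[lebesgue_measure]_(r in `[0%R, +oo[)
         (expR (- (cos 1 * (1 - expR (- (2 * gamma k * t))) / (4 * gamma k)
                   * f k r)))%:E)
    | k in [set: nat]])%E.

(* Main.v *)
(* Write phi_n for the Fourier transform of the n-th stochastic integral J_n(t).
   Moving the initial condition by zeta translates J_n(t) by
   exp(- gamma_n t) zeta_n, so everything rests on how little a translation
   changes these laws.  The change is measured by the Hellinger affinity, in the
   dual form 2 rho <= E p + E q(. + a) over nonnegative trigonometric polynomials
   with p q >= 1: this form only involves phi_n, passes to limits and to
   products, and controls the total variation of product laws.

   The lower bound on nu_n contains a mixture of centred Gaussian jump measures,
   so each Riemann-sum approximation of phi_n has as a factor a mixture of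
   Gaussians of random variance S / 2, with E exp(- r S) controlled by f_n.  A
   Gaussian of variance S / 2 has affinity at least 1 - a^2 / (4 S) with its
   translate by a, and E(1 / S) is the integral of E exp(- r S) over r.
   Estimating f_n(w^2 r), for a weight w of the Riemann sum, by
   w >= exp(- gamma_n t) or by f_n(w^2 r) >= w^2 f_n(r) gives
   the two integrals in C_t.  Independence tensorizes the bound, Bessel's
   inequality sums it, and the estimate passes from trigonometric polynomials
   to Borel functions on H by approximation in L^1. *)
Require Import Defs.
From HB Require Import structures.
From mathcomp Require Import all_boot all_order all_algebra finmap complex.
From mathcomp Require Import all_classical all_reals all_analysis.
From mathcomp Require Import measurable_realfun ring lra.
Import Order.TTheory GRing.Theory Num.Theory.
Import numFieldNormedType.Exports.

Set Implicit Arguments.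
Unset Strict Implicit.
Unset Printing Implicit Defensive.

Local Open Scope classical_set_scope.
Local Open Scope ring_scope.

(** * Trigonometric polynomials and Hellinger affinity *)


(** Two finiteness constraints shape the argument. A Levy measure may have infinite mass near 0, so
    what remains of it after removing the Gaussian jumps is first cut to |z| > 1 / (n + 1), where it
    is a finite nonnegative measure, and the cut is removed on the side of Fourier transforms. The
    removed part must itself be finite, so it uses only 2 M + 1 dyadic scales; these control f_n on
    a bounded range of r only. This is why the integral of E exp(- r S) enters as a finite Riemann
    sum plus a tail term: M is chosen after the finitely many sample points, and the growth of f_n
    sends the tail to 0.

    Constants: the dyadic mixture loses a factor 3 against f_n, and [cos 1 / 2] is at most 1 / 3.
    With K the supremum in C_t, coordinate n has affinity at least 1 - zeta_n^2 K / 4; squaring and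
    multiplying over n leaves a deficit of at most K |zeta|^2 / 2, and total variation is at most 2
    sqrt(deficit) = sqrt(2 K) |zeta|. *)

Section complex_prelim.
Variable R : realType.
Implicit Types (z w : R[i]) (x y : R).

Lemma Re_mulc z w : complex.Re (z * w) =
  complex.Re z * complex.Re w - complex.Im z * complex.Im w.
Proof. by case: z w => [a b] [c d]. Qed.

Lemma Im_mulc z w : complex.Im (z * w) =
  complex.Re z * complex.Im w + complex.Im z * complex.Re w.
Proof. by case: z w => [a b] [c d]. Qed.

Lemma Re_addc z w : complex.Re (z + w) = complex.Re z + complex.Re w.
Proof. by case: z w => [a b] [c d]. Qed.

Lemma Im_addc z w : complex.Im (z + w) = complex.Im z + complex.Im w.
Proof. by case: z w => [a b] [c d]. Qed.

Lemma Re_oppc z : complex.Re (- z) = - complex.Re z.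
Proof. by case: z. Qed.

Lemma Im_oppc z : complex.Im (- z) = - complex.Im z.
Proof. by case: z. Qed.

Lemma eq_ReIm z w : complex.Re z = complex.Re w ->
  complex.Im z = complex.Im w -> z = w.
Proof. by case: z w => [a b] [c d] /= -> ->. Qed.

Definition rc x : R[i] := Complex x 0.

Lemma rcM x y : rc (x * y) = rc x * rc y.
Proof. by apply: eq_ReIm; rewrite ?Re_mulc ?Im_mulc/=; ring. Qed.

Lemma rcD x y : rc (x + y) = rc x + rc y.
Proof. by apply: eq_ReIm; rewrite ?Re_addc ?Im_addc/=; ring. Qed.

Lemma Re_rcM x z : complex.Re (rc x * z) = x * complex.Re z.
Proof. by rewrite Re_mulc/= mul0r subr0. Qed.

Lemma Im_rcM x z : complex.Im (rc x * z) = x * complex.Im z.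
Proof. by rewrite Im_mulc/= mul0r addr0. Qed.

Definition cis x : R[i] := Complex (cos x) (sin x).

Lemma cisD x y : cis (x + y) = cis x * cis y.
Proof. by apply: eq_ReIm; rewrite ?Re_mulc ?Im_mulc/= ?cosD ?sinD; ring. Qed.

Lemma cis0 : cis 0 = 1.
Proof. by rewrite /cis cos0 sin0. Qed.

Definition ccvg (u : nat -> R[i]) (l : R[i]) :=
  (complex.Re (u n) @[n --> \oo] --> complex.Re l) /\
  (complex.Im (u n) @[n --> \oo] --> complex.Im l).

Lemma ccvg_cst z : ccvg (fun=> z) z.
Proof. by split; exact: cvg_cst. Qed.

Lemma ccvgM u v z w : ccvg u z -> ccvg v w -> ccvg (fun n => u n * v n) (z * w).
Proof.
move=> [u1 u2] [v1 v2]; split.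
  rewrite Re_mulc; under eq_fun do rewrite Re_mulc.
  by apply: cvgB; apply: cvgM.
rewrite Im_mulc; under eq_fun do rewrite Im_mulc.
by apply: cvgD; apply: cvgM.
Qed.

Lemma ccvg_prod (I : Type) (s : seq I) (u : I -> nat -> R[i]) (z : I -> R[i]) :
  (forall i, ccvg (u i) (z i)) ->
  ccvg (fun n => \prod_(i <- s) u i n) (\prod_(i <- s) z i).
Proof.
move=> uz; elim: s => [|a s ih].
  rewrite big_nil; under [fun n => _]eq_fun do rewrite big_nil.
  exact: ccvg_cst.
rewrite big_cons; under [fun n => _]eq_fun do rewrite big_cons.
exact: ccvgM.
Qed.

Lemma ccvg_unique u z w : ccvg u z -> ccvg u w -> z = w.
Proof.
move=> [u1 u2] [v1 v2]; apply: eq_ReIm.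
  exact: (cvg_unique _ u1 v1).
exact: (cvg_unique _ u2 v2).
Qed.

End complex_prelim.

Section trigonometric_polynomials.
Variables (R : realType) (K : Type).
Implicit Types (p q : seq (R[i] * K)) (phi psi : K -> R[i]).

(** A list of pairs (coefficient, frequency) stands for a real trigonometric polynomial. When [phi]
    is the Fourier transform of a measure, this number is the integral of the polynomial. *)
Definition pairing phi p : R := \sum_(t <- p) complex.Re (t.1 * phi t.2).

(** Multiplying coefficients by [phi] averages the translates of the polynomial: if [phi] is the
    Fourier transform of mu, the result is x |-> \int p(x + y) mu(dy). *)
Definition twist phi p := [seq (t.1 * phi t.2, t.2) | t <- p].
Definition scale (a : R) p := [seq (rc a * t.1, t.2) | t <- p].

Lemma pairing_cat phi p q : pairing phi (p ++ q) = pairing phi p + pairing phi q.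
Proof. by rewrite /pairing big_cat. Qed.

Lemma pairing_scale phi a p : pairing phi (scale a p) = a * pairing phi p.
Proof.
rewrite /pairing big_map big_distrr/=; apply: eq_bigr => t _.
by rewrite -mulrA Re_rcM.
Qed.

Lemma pairing_twist phi psi p :
  pairing psi (twist phi p) = pairing (fun h => phi h * psi h) p.
Proof. by rewrite /pairing big_map; apply: eq_bigr => t _; rewrite mulrA. Qed.

Lemma eq_pairing phi psi p : phi =1 psi -> pairing phi p = pairing psi p.
Proof. by move=> e; apply: eq_bigr => t _; rewrite e. Qed.

Lemma pairingD phi psi p :
  pairing (fun h => phi h + psi h) p = pairing phi p + pairing psi p.
Proof.
by rewrite /pairing -big_split; apply: eq_bigr => t _; rewrite mulrDr Re_addc.
Qed.

Lemma pairingZ (a : R) phi p :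
  pairing (fun h => rc a * phi h) p = a * pairing phi p.
Proof.
rewrite /pairing big_distrr/=; apply: eq_bigr => t _.
by rewrite mulrCA Re_rcM.
Qed.

Lemma pairing_cvg (phi_ : nat -> K -> R[i]) phi p :
  (forall h, ccvg (fun n => phi_ n h) (phi h)) ->
  pairing (phi_ n) p @[n --> \oo] --> pairing phi p.
Proof.
move=> phiP; rewrite /pairing; elim: p => [|t p ih].
  rewrite big_nil; under eq_fun do rewrite big_nil.
  exact: cvg_cst.
rewrite big_cons; under eq_fun do rewrite big_cons.
apply: cvgD; last exact: ih.
by have [] := ccvgM (ccvg_cst t.1) (phiP t.2).
Qed.

End trigonometric_polynomials.

(** Optimization over [l]: large and small [l] force the signs of [a] and [b], and the minimizer of
    [l * a + b / l] gives the product inequality. *)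
Lemma quadratic_lower_bound (R : realType) (a b r : R) : 0 <= r ->
  (forall l, 0 < l -> 2 * r * l <= l ^+ 2 * a + b) ->
  [/\ 0 <= a, 0 <= b & r ^+ 2 <= a * b].
Proof.
move=> r0 key.
have half (x y : R) : (forall l, 0 < l -> 0 <= l ^+ 2 * x + y) -> 0 <= x.
  move=> H; rewrite leNgt; apply/negP => x0.
  have xN0 : 0 < - x by rewrite oppr_gt0.
  (* If [x < 0], this [l] is at least 1, so [l ^+ 2 * (- x) >= l * (- x) = - x + |y| > |y|], a
     contradiction. *)
  have l0 : 0 < 1 + `|y| / (- x) by rewrite ltr_pwDl// divr_ge0// ltW.
  have := H _ l0.
  have : `|y| = `|y| / (- x) * (- x) by rewrite divfK// gt_eqF.
  set w := `|y| / _.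
  have w0 : 0 <= w by rewrite divr_ge0// ltW.
  have := ler_norm y; nra.
have a0 : 0 <= a.
  apply: (half a b) => l l0; apply: le_trans (key _ l0).
  by rewrite !mulr_ge0// ltW.
have b0 : 0 <= b.
  apply: (half b a) => l l0.
  have li0 : 0 < l^-1 by rewrite invr_gt0.
  have -> : l ^+ 2 * b + a = l ^+ 2 * (l^-1 ^+ 2 * a + b) by field; rewrite gt_eqF.
  rewrite mulr_ge0 ?sqr_ge0//; apply: le_trans (key _ li0).
  by rewrite !mulr_ge0// ltW.
split => //.
have [->|rn0] := eqVneq r 0; first by rewrite expr0n mulr_ge0.
have rp : 0 < r by rewrite lt_neqAle eq_sym rn0.
have [a00|an0] := eqVneq a 0.
  (* With [a = 0] the hypothesis reads [2 * r * l <= b] for all [l]; this [l] already violates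
     it. *)
  have /(key _) : 0 < (b + 1) / r by rewrite divr_gt0// ltr_pwDr.
  rewrite a00 mulr0 add0r => H; exfalso; move: H.
  have -> : 2 * r * ((b + 1) / r) = 2 * (b + 1) by field.
  lra.
have ap : 0 < a by rewrite lt_neqAle eq_sym an0.
have /(key _) : 0 < r / a by rewrite divr_gt0.
rewrite -(ler_pM2r ap).
have -> : 2 * r * (r / a) * a = 2 * r ^+ 2 by field.
have -> : ((r / a) ^+ 2 * a + b) * a = r ^+ 2 + a * b by field.
lra.
Qed.

(** * Positive type and affinity in one dimension *)

Section line.
Variable R : realType.
Implicit Types (p q : seq (R[i] * R)) (phi psi : R -> R[i]).

Definition chr (x : R) (h : R) : R[i] := cis (h * x).

(** Evaluation at a point is pairing with the Fourier transform of the Dirac mass there, so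
    evaluation and integration obey the same algebra. *)
Definition ev p (x : R) : R := pairing (chr x) p.

Lemma ev_shift p x y : ev (twist (chr x) p) y = ev p (x + y).
Proof.
rewrite /ev pairing_twist; apply: eq_pairing => h.
by rewrite /chr mulrDr cisD.
Qed.

Lemma ev_twist phi p x :
  ev (twist phi p) x = pairing phi (twist (chr x) p).
Proof.
by rewrite /ev !pairing_twist; apply: eq_pairing => h; rewrite mulrC.
Qed.

Lemma ev_scale a p x : ev (scale a p) x = a * ev p x.
Proof. exact: pairing_scale. Qed.

Lemma ev_const (a : R) x : ev [:: (rc a, 0)] x = a.
Proof. by rewrite /ev /pairing big_seq1 Re_rcM /chr mul0r cis0 mulr1. Qed.

Lemma pairing_const phi (a : R) : phi 0 = 1 -> pairing phi [:: (rc a, 0)] = a.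
Proof. by move=> phi0; rewrite /pairing big_seq1 Re_rcM phi0 mulr1. Qed.

(* Equivalent, by Bochner's theorem, to being the Fourier transform of a
   finite measure. *)
Definition pos_type phi :=
  forall p, (forall x, 0 <= ev p x) -> 0 <= pairing phi p.

Lemma pos_type_chr x : pos_type (chr x).
Proof. by move=> p; apply. Qed.

Lemma eq_pos_type phi psi : phi =1 psi -> pos_type phi -> pos_type psi.
Proof. by move=> e P p /P; rewrite (eq_pairing _ e). Qed.

(** Convolution: [twist phi p] is nonnegative because its value at [x] is [phi] paired with a
    translate of [p]; [psi] is then paired with it. *)
Lemma pos_typeM phi psi : pos_type phi -> pos_type psi ->
  pos_type (fun h => phi h * psi h).
Proof.
move=> P Q p p0; rewrite -pairing_twist; apply: Q => x.
by rewrite ev_twist; apply: P => y; rewrite ev_shift.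
Qed.

Lemma pos_typeD phi psi : pos_type phi -> pos_type psi ->
  pos_type (fun h => phi h + psi h).
Proof. by move=> P Q p p0; rewrite pairingD addr_ge0// (P, Q). Qed.

Lemma pos_typeZ (a : R) phi : 0 <= a -> pos_type phi ->
  pos_type (fun h => rc a * phi h).
Proof. by move=> a0 P p p0; rewrite pairingZ mulr_ge0// P. Qed.

Lemma pos_type_cst (a : R) : 0 <= a -> pos_type (fun=> rc a).
Proof.
move=> a0; apply: (@eq_pos_type (fun h => rc a * chr 0 h)).
  by move=> h /=; rewrite /chr mulr0 [cis 0]cis0 mulr1.
by apply: pos_typeZ => //; exact: pos_type_chr.
Qed.

Lemma pos_typeX phi n : pos_type phi -> pos_type (fun h => phi h ^+ n).
Proof.
move=> P; elim: n => [|n ih]; first exact: (@pos_type_cst 1).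
apply: (@eq_pos_type (fun h => phi h * phi h ^+ n)); last exact: pos_typeM.
by move=> h; rewrite exprS.
Qed.

Lemma pos_type_cvg (phi_ : nat -> R -> R[i]) phi :
  (forall n, pos_type (phi_ n)) ->
  (forall h, ccvg (fun n => phi_ n h) (phi h)) -> pos_type phi.
Proof.
move=> P phiP p p0.
have c := pairing_cvg (p := p) phiP.
rewrite -(cvg_lim _ c)//; apply: limr_ge; first by apply/cvg_ex; eexists; exact: c.
by apply: nearW => n; exact: P.
Qed.

Lemma pos_type_dilate (c : R) phi : pos_type phi -> pos_type (fun h => phi (c * h)).
Proof.
move=> P p p0.
have pd psi : pairing (fun h => psi (c * h)) p =
    pairing psi [seq (t.1, c * t.2) | t <- p].
  by rewrite /pairing big_map.
rewrite pd; apply: P => x; rewrite /ev -(pd (chr x)).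
have := p0 (c * x); rewrite /ev; congr (_ <= _); apply: eq_pairing => h.
by rewrite /chr; congr cis; ring.
Qed.

Lemma pos_type_prod (I : Type) (s : seq I) (phi : I -> R -> R[i]) :
  (forall i, pos_type (phi i)) -> pos_type (fun h => \prod_(i <- s) phi i h).
Proof.
move=> P; elim: s => [|i s ih].
  apply: (@eq_pos_type (fun=> rc 1)); last exact: pos_type_cst.
  by move=> h; rewrite big_nil.
apply: (@eq_pos_type (fun h => phi i h * \prod_(i <- s) phi i h)).
  by move=> h; rewrite big_cons.
exact: pos_typeM.
Qed.

(* A lower bound [rho] for the Hellinger affinity of the law with Fourier
   transform [phi] and its translate by [a], in dual form. *)
Definition affinity_ge phi (a rho : R) :=
  forall p q, (forall x, 0 <= ev p x) -> (forall x, 0 <= ev q x) ->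
    (forall x, 1 <= ev p x * ev q x) ->
    2 * rho <= pairing phi p + pairing (fun h => phi h * chr a h) q.

Lemma eq_affinity_ge phi psi a rho :
  phi =1 psi -> affinity_ge phi a rho -> affinity_ge psi a rho.
Proof.
move=> e A p q p0 q0 pq; rewrite -(eq_pairing _ e).
have <- : pairing (fun h => phi h * chr a h) q = pairing (fun h => psi h * chr a h) q.
  by apply: eq_pairing => h; rewrite e.
exact: A.
Qed.

Lemma affinity_ge_le phi a rho rho' :
  rho' <= rho -> affinity_ge phi a rho -> affinity_ge phi a rho'.
Proof.
move=> le A p q p0 q0 pq; apply: le_trans (A _ _ p0 q0 pq).
by rewrite ler_pM2l.
Qed.

Lemma affinity_geD phi psi a rho sigma :
  affinity_ge phi a rho -> affinity_ge psi a sigma ->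
  affinity_ge (fun h => phi h + psi h) a (rho + sigma).
Proof.
move=> A B p q p0 q0 pq; rewrite pairingD.
rewrite (@eq_pairing _ _ (fun h => _ * _) (fun h => phi h * chr a h + psi h * chr a h)).
  rewrite pairingD mulrDr addrACA.
  apply: lerD; first exact: A.
  exact: B.
by move=> h; rewrite mulrDl.
Qed.

Lemma affinity_geZ (c : R) phi a rho : 0 <= c ->
  affinity_ge phi a rho -> affinity_ge (fun h => rc c * phi h) a (c * rho).
Proof.
move=> c0 A p q p0 q0 pq; rewrite pairingZ.
rewrite (@eq_pairing _ _ (fun h => _ * _ * _) (fun h => rc c * (phi h * chr a h))).
  by rewrite pairingZ -mulrDr mulrCA ler_wpM2l// A.
by move=> h; rewrite mulrA.
Qed.

Lemma affinity_ge_cvg (phi_ : nat -> R -> R[i]) phi a (rho_ : nat -> R) rho :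
  (forall n, affinity_ge (phi_ n) a (rho_ n)) ->
  (forall h, ccvg (fun n => phi_ n h) (phi h)) ->
  rho_ n @[n --> \oo] --> rho -> affinity_ge phi a rho.
Proof.
move=> A phiP rhoP p q p0 q0 pq.
have c : pairing (phi_ n) p + pairing (fun h => phi_ n h * chr a h) q
    @[n --> \oo] --> pairing phi p + pairing (fun h => phi h * chr a h) q.
  apply: cvgD; apply: pairing_cvg => // h.
  by apply: ccvgM => //; exact: ccvg_cst.
have c2 : 2 * rho_ n @[n --> \oo] --> 2 * rho by apply: cvgM => //; exact: cvg_cst.
apply: (ler_cvg_to c2 c); apply: nearW => n; exact: A.
Qed.

(** Adding independent noise does not lower the affinity. For every [x] the hypothesis holds for the
    translates of [p] and [q] by [x], so the polynomial [r] is nonnegative, and [psi] may be paired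
    with it. The normalization [psi 0 = 1] keeps the constant term [2 * rho]. *)
Lemma affinity_geM phi psi a rho : affinity_ge phi a rho ->
  pos_type psi -> psi 0 = 1 -> affinity_ge (fun h => phi h * psi h) a rho.
Proof.
move=> A P psi0 p q p0 q0 pq.
pose r := twist phi p ++ twist (fun h => phi h * chr a h) q ++
  [:: (rc (- (2 * rho)), 0)].
suff : 0 <= pairing psi r.
  rewrite !pairing_cat !pairing_twist pairing_const// addrA subr_ge0.
  move=> /le_trans; apply; rewrite lerD2l.
  by rewrite le_eqVlt; apply/orP; left; apply/eqP/eq_pairing => h; rewrite mulrAC.
apply: P => x; rewrite /ev !pairing_cat -!/(ev _ _) ev_const !ev_twist.
rewrite addrA subr_ge0; apply: A => y; rewrite !ev_shift//.
Qed.

(** Replacing [p], [q] by [(l / c) p], [l^-1 q] and optimizing over [l] turns the sum into a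
    product. Only the product form can be iterated over coordinates, since its conclusion has the
    shape of its hypothesis. *)
Lemma affinity_geP phi a rho (c : R) p q : affinity_ge phi a rho ->
  0 <= rho -> 0 < c ->
  (forall x, 0 <= ev p x) -> (forall x, 0 <= ev q x) ->
  (forall x, c <= ev p x * ev q x) ->
  [/\ 0 <= pairing phi p, 0 <= pairing (fun h => phi h * chr a h) q &
   c * rho ^+ 2 <= pairing phi p * pairing (fun h => phi h * chr a h) q].
Proof.
move=> A rho0 c0 p0 q0 pq.
set U := pairing phi p; set V := pairing _ q.
have key l : 0 < l -> 2 * rho * l <= l ^+ 2 * (U / c) + V.
  move=> l0.
  have p1 x : 0 <= ev (scale (l / c) p) x.
    by rewrite ev_scale mulr_ge0// divr_ge0// ltW.
  have q1 x : 0 <= ev (scale l^-1 q) x.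
    by rewrite ev_scale mulr_ge0// invr_ge0 ltW.
  have pq1 x : 1 <= ev (scale (l / c) p) x * ev (scale l^-1 q) x.
    rewrite !ev_scale mulrACA.
    have -> : l / c * l^-1 = c^-1 by rewrite mulrAC divff ?mul1r ?gt_eqF.
    by rewrite ler_pdivlMl// mulr1.
  have := A _ _ p1 q1 pq1; rewrite !pairing_scale -/U -/V -(ler_pM2r l0).
  move=> /le_trans; apply.
  rewrite le_eqVlt; apply/orP; left; apply/eqP.
  by field; rewrite !gt_eqF.
have [Uc0 V0 UV] := quadratic_lower_bound rho0 key.
split => //; first by rewrite -(@pmulr_lge0 _ c^-1)// invr_gt0.
by move: UV; rewrite mulrAC ler_pdivlMr// mulrC.
Qed.

End line.

(** Admits [c = 0], which occurs in the induction over coordinates once some [rho] vanishes;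
    positive type then supplies the signs. *)
Lemma affinity_ge_pos (R : realType) (phi : R -> R[i]) a rho (c : R) p q :
  affinity_ge phi a rho -> pos_type phi ->
  0 <= rho -> 0 <= c ->
  (forall x, 0 <= ev p x) -> (forall x, 0 <= ev q x) ->
  (forall x, c <= ev p x * ev q x) ->
  [/\ 0 <= pairing phi p, 0 <= pairing (fun h => phi h * chr a h) q &
   c * rho ^+ 2 <= pairing phi p * pairing (fun h => phi h * chr a h) q].
Proof.
move=> A P rho0; rewrite le_eqVlt => /predU1P[<-|c0] p0 q0 pq; last first.
  exact: affinity_geP.
have U0 : 0 <= pairing phi p by exact: P.
have V0 : 0 <= pairing (fun h => phi h * chr a h) q.
  by apply: pos_typeM => //; exact: pos_type_chr.
by split => //; rewrite mul0r mulr_ge0.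
Qed.

(* The optimal choice of [l] is [(n - m) / 2]. *)
Lemma tv_from_affinity (R : realType) (m n delta : R) :
  `|m| <= 1 -> `|n| <= 1 -> 0 <= delta ->
  (forall l, 0 <= l < 1 ->
    (1 - l ^+ 2) * (1 - delta) <= (1 + l * m) * (1 - l * n)) ->
  n - m <= 2 * Num.sqrt delta.
Proof.
move=> m1 n1 d0 H.
suff : (n - m) / 2 <= Num.sqrt delta by lra.
have [s0|s0] := leP ((n - m) / 2) 0.
  by apply: le_trans s0 _; rewrite sqrtr_ge0.
set s := (n - m) / 2 in s0 *.
suff : s ^+ 2 <= delta.
  by move=> /ler_wsqrtr; rewrite sqrtr_sqr gtr0_norm.
move: m1 n1; rewrite !ler_norml => /andP[m1 m2] /andP[n1 n2].
have s1 : s <= 1 by rewrite /s; lra.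
(* The factors [1 + l * m] and [1 - l * n] have mean [1 - l * s], so their product is at most its
   square. *)
have key l : 0 <= l < 1 -> (1 - l ^+ 2) * (1 - delta) <= (1 - l * s) ^+ 2.
  move=> /H /le_trans; apply; rewrite -subr_ge0.
  have -> : (1 - l * s) ^+ 2 - (1 + l * m) * (1 - l * n) =
      (l * (m + n) / 2) ^+ 2 by rewrite /s; field.
  exact: sqr_ge0.
have [s1'|s1'] := ltP s 1.
  have := key s; rewrite s1' ltW// => /(_ isT).
  have -> : (1 - s * s) ^+ 2 = (1 - s ^+ 2) * (1 - s ^+ 2) by ring.
  rewrite ler_pM2l; first by lra.
  rewrite subr_gt0 expr2; nra.
have -> : s = 1 by apply/eqP; rewrite eq_le s1.
rewrite expr1n leNgt; apply/negP => d1.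
(* At [s = 1] the choice [l = s] is excluded by [l < 1]. With [w = 1 - delta > 0] and
   [l = 1 - w / 2] the inequality would force [w >= 3]. *)
have := key (1 - (1 - delta) / 2); have -> : s = 1 by apply/eqP; rewrite eq_le s1.
rewrite mulr1.
have -> : (0 <= 1 - (1 - delta) / 2 < 1) by apply/andP; split; lra.
move=> /(_ isT).
set w := 1 - delta; have w0 : 0 < w by rewrite /w; lra.
have w1 : w <= 1 by rewrite /w; lra.
nra.
Qed.

(** * Tensorization over finitely many coordinates *)

Section product.
Variable R : realType.
Implicit Types (p q : seq (R[i] * (nat -> R))) (x a : nat -> R)
  (phi : nat -> R -> R[i]).

Definition prod_fun N phi (h : nat -> R) : R[i] := \prod_(n < N) phi n (h n).

Definition chrN N x : (nat -> R) -> R[i] := prod_fun N (fun n => chr (x n)).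

Definition evN N p x : R := pairing (chrN N x) p.

Definition upd x N (y : R) : nat -> R := fun n => if n == N then y else x n.

(** Coordinates below [N] are frozen at [x]; a one-variable polynomial in coordinate [N] is left. *)
Definition section_poly N x p : seq (R[i] * R) :=
  [seq (t.1 * chrN N x t.2, t.2 N) | t <- p].

Lemma pairing_section N x p (phi : R -> R[i]) :
  pairing phi (section_poly N x p) = evN N (twist (fun h => phi (h N)) p) x.
Proof.
rewrite /evN pairing_twist /pairing big_map; apply: eq_bigr => t _ /=.
by rewrite -mulrA [_ * phi _]mulrC.
Qed.

Lemma ev_section N x p (y : R) : ev (section_poly N x p) y = evN N.+1 p (upd x N y).
Proof.
rewrite /ev pairing_section /evN pairing_twist; apply: eq_pairing => h.
rewrite /chrN /prod_fun big_ord_recr/= /upd eqxx mulrC; congr (_ * _).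
by apply: eq_bigr => i _; rewrite (ltn_eqF (ltn_ord i)).
Qed.

Lemma pairing_prod_funS N phi p : pairing (prod_fun N.+1 phi) p =
  pairing (prod_fun N phi) (twist (fun h => phi N (h N)) p).
Proof.
by rewrite pairing_twist; apply: eq_pairing => h; rewrite /prod_fun big_ord_recr/= mulrC.
Qed.

(** Integrate out coordinate [N] with the others frozen: the one-dimensional product inequality
    shows that the two averaged polynomials again have product at least a constant, now
    [c * rho N ^+ 2], and the induction hypothesis applies to them. *)
Lemma affinity_ge_prod N phi a (rho : nat -> R) (c : R) p q :
  (forall n, (n < N)%N -> affinity_ge (phi n) (a n) (rho n)) ->
  (forall n, pos_type (phi n)) -> (forall n, 0 <= rho n) -> 0 <= c ->
  (forall x, 0 <= evN N p x) -> (forall x, 0 <= evN N q x) ->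
  (forall x, c <= evN N p x * evN N q x) ->
  let L := pairing (prod_fun N phi) p in
  let L' := pairing (prod_fun N (fun n h => phi n h * chr (a n) h)) q in
  [/\ 0 <= L, 0 <= L' & c * (\prod_(n < N) rho n) ^+ 2 <= L * L'].
Proof.
move=> A P rho0; elim: N c p q A => [|N ih] c p q A c0 p0 q0 pq /=.
  have E psi r x : pairing (prod_fun 0 psi) r = evN 0 r x.
    by apply: eq_pairing => h; rewrite /chrN /prod_fun !big_ord0.
  by rewrite !(E _ _ a) big_ord0 expr1n mulr1.
rewrite !pairing_prod_funS.
have S x := @affinity_ge_pos R (phi N) (a N) (rho N) c
  (section_poly N x p) (section_poly N x q) (A N (ltnSn _)) (P N) (rho0 N) c0.
have S' x : [/\ 0 <= pairing (phi N) (section_poly N x p),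
    0 <= pairing (fun h => phi N h * chr (a N) h) (section_poly N x q) &
    c * rho N ^+ 2 <= pairing (phi N) (section_poly N x p) *
      pairing (fun h => phi N h * chr (a N) h) (section_poly N x q)].
  by apply: S => y; rewrite !ev_section.
have c1 : 0 <= c * rho N ^+ 2 by rewrite mulr_ge0// sqr_ge0.
have := ih (c * rho N ^+ 2) (twist (fun h => phi N (h N)) p)
  (twist (fun h => phi N (h N) * chr (a N) (h N)) q) _ c1.
case.
- by move=> n nN; apply: A; rewrite ltnS ltnW.
- by move=> x; rewrite -pairing_section; case: (S' x).
- by move=> x; rewrite -(pairing_section _ _ _ (fun h => phi N h * chr (a N) h)); case: (S' x).
- move=> x; rewrite -(pairing_section _ _ _ (fun h => phi N h * chr (a N) h)).
  by rewrite -pairing_section; case: (S' x).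
by move=> L0 L0' LL'; split => //; rewrite big_ord_recr/= exprMn [_ ^+ 2 * rho N ^+ 2]mulrC mulrA.
Qed.

Lemma evN_const N (b : R) x : evN N [:: (rc b, fun=> 0)] x = b.
Proof.
rewrite /evN /pairing big_seq1 Re_rcM /chrN /prod_fun big1 ?mulr1// => i _.
by rewrite /chr mul0r cis0.
Qed.

Lemma pairing_prod_const N phi (b : R) : (forall n, phi n 0 = 1) ->
  pairing (prod_fun N phi) [:: (rc b, fun=> 0)] = b.
Proof. by move=> phi0; rewrite /pairing big_seq1 Re_rcM /prod_fun big1 ?mulr1. Qed.

(** Test the product affinity on [1 + l r] and [1 - l r], whose product is
    [1 - l ^+ 2 * r ^+ 2 >= 1 - l ^+ 2]. The values [l = 1] and [l = -1] bound both integrals of [r]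
    by 1 in absolute value; the other [l] feed [tv_from_affinity]. *)
Lemma prod_fun_tv N phi a (rho : nat -> R) (delta : R) p :
  (forall n, (n < N)%N -> affinity_ge (phi n) (a n) (rho n)) ->
  (forall n, pos_type (phi n)) -> (forall n, phi n 0 = 1) ->
  (forall n, 0 <= rho n) -> 0 <= delta ->
  1 - delta <= (\prod_(n < N) rho n) ^+ 2 ->
  (forall x, `|evN N p x| <= 1) ->
  `|pairing (prod_fun N (fun n h => phi n h * chr (a n) h)) p -
    pairing (prod_fun N phi) p| <= 2 * Num.sqrt delta.
Proof.
move=> A P phi0 rho0 d0 rhod p1.
pose phi' n h := phi n h * chr (a n) h.
have phi'0 n : phi' n 0 = 1 by rewrite /phi' phi0 /chr mul0r mul1r cis0.
have half r : (forall x, `|evN N r x| <= 1) ->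
    pairing (prod_fun N phi') r - pairing (prod_fun N phi) r <= 2 * Num.sqrt delta.
  move=> r1.
  pose u (l : R) := [:: (rc 1, fun=> 0)] ++ scale l r.
  have evu l x : evN N (u l) x = 1 + l * evN N r x.
    by rewrite /evN pairing_cat pairing_scale -/(evN _ _ _) evN_const.
  have pu psi l : (forall n, psi n 0 = 1) ->
      pairing (prod_fun N psi) (u l) = 1 + l * pairing (prod_fun N psi) r.
    by move=> psi0; rewrite pairing_cat pairing_scale pairing_prod_const.
  have pos l x : `|l| <= 1 -> 0 <= evN N (u l) x.
    move=> l1; rewrite evu; have := r1 x.
    have : `|l * evN N r x| <= 1 by rewrite normrM mulr_ile1.
    by rewrite ler_norml => /andP[]; lra.
  have key (l : R) : `|l| <= 1 -> [/\ 0 <= 1 + l * pairing (prod_fun N phi) r,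
      0 <= 1 + - l * pairing (prod_fun N phi') r &
      (1 - l ^+ 2) * (\prod_(n < N) rho n) ^+ 2 <=
      (1 + l * pairing (prod_fun N phi) r) * (1 - l * pairing (prod_fun N phi') r)].
    move=> l1; rewrite -[1 - l * _]/(1 + - (l * _)) -[- (l * _)]mulNr.
    rewrite -!pu//; apply: (affinity_ge_prod A P rho0).
    - by rewrite subr_ge0 -real_normK ?num_real// exprn_ile1.
    - by move=> x; exact: pos.
    - by move=> x; apply: pos; rewrite normrN.
    - move=> x; rewrite !evu.
      have -> : (1 + l * evN N r x) * (1 + - l * evN N r x) =
        1 - l ^+ 2 * (evN N r x) ^+ 2 by ring.
      rewrite lerD2l lerN2 ler_piMr ?sqr_ge0// -real_normK ?num_real//.
      by rewrite exprn_ile1.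
  have [|m1 n1 _] := key 1; first by rewrite normr1.
  have [|m2 n2 _] := key (- 1); first by rewrite normrN normr1.
  apply: tv_from_affinity => //.
  - by rewrite ler_norml; lra.
  - by rewrite ler_norml; lra.
  - move=> l /andP[l0 l1]; have [|_ _] := key l; first by rewrite ger0_norm// ltW.
    apply: le_trans; rewrite ler_wpM2l// subr_ge0 expr_le1//; exact: ltW.
rewrite ler_norml half// andbT -subr_ge0 opprK.
(* The lower bound is the upper bound for [- p]. *)
have := half (scale (-1) p); rewrite !pairing_scale -subr_ge0 => H.
have : 0 <= 2 * Num.sqrt delta - (-1 * pairing (prod_fun N phi') p -
   -1 * pairing (prod_fun N phi) p).
  by apply: H => x; rewrite /evN pairing_scale normrM normrN normr1 mul1r; exact: p1.
by rewrite /phi'; lra.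
Qed.

End product.

(** * Gaussian mixtures *)


Section trigonometric_inequalities.
Variable R : realType.
Implicit Types x : R.

Lemma normr_sin_le x : `|sin x| <= `|x|.
Proof.
wlog x0 : x / 0 <= x.
  move=> H; have [/H//|/ltW] := leP 0 x.
  by rewrite -oppr_ge0 => /H; rewrite sinN !normrN.
have cs : {within `[0, x], continuous (@sin R)}.
  by apply: continuous_subspaceT => ?; exact: continuous_sin.
have [c _] := MVT_segment x0 (fun y _ => is_derive_sin y) cs.
rewrite sin0 !subr0 => ->; rewrite normrM ler_piMl//.
by rewrite ler_norml cos_geN1 cos_le1.
Qed.

Lemma one_sub_cosE x : 1 - cos x = 2 * sin (x / 2) ^+ 2.
Proof.
have e : x = (x / 2) *+ 2 by rewrite -mulr_natr; field.
by rewrite {1}e cos_mulr2n cos2sin2 -mulr_natl; ring.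
Qed.

Lemma one_sub_cos_ge0 x : 0 <= 1 - cos x.
Proof. by rewrite subr_ge0 cos_le1. Qed.

Lemma one_sub_cos_le2 x : 1 - cos x <= 2.
Proof. by have := cos_geN1 x; lra. Qed.

Lemma one_sub_cos_le x : 1 - cos x <= x ^+ 2 / 2.
Proof.
rewrite one_sub_cosE.
have -> : x ^+ 2 / 2 = 2 * `|x / 2| ^+ 2 by rewrite real_normK ?num_real//; field.
rewrite ler_pM2l// -[leLHS]real_normK ?num_real//.
by rewrite lerXn2r ?nnegrE//; exact: normr_sin_le.
Qed.

Lemma normr_sub_sin_le x : `|x - sin x| <= `|x| ^+ 3 / 2.
Proof.
wlog x0 : x / 0 <= x.
  move=> H; have [/H//|/ltW] := leP 0 x.
  by rewrite -oppr_ge0 => /H; rewrite sinN -opprD !normrN.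
have cs : {within `[0, x], continuous (fun y => y - sin y)}.
  by apply: continuous_subspaceT => y; apply: cvgB => //; exact: continuous_sin.
have ds y : y \in `]0, x[ -> is_derive y 1 (fun y => y - sin y) (1 - cos y).
  by move=> _; exact: is_deriveB.
have [c] := MVT_segment x0 ds cs.
rewrite in_itv/= => /andP[c0 cx].
rewrite sin0 !subr0 => ->; rewrite normrM exprSr mulrAC (ger0_norm x0) ler_wpM2r//.
rewrite ger0_norm ?one_sub_cos_ge0// (le_trans (one_sub_cos_le _))//.
by rewrite ler_pM2r// lerXn2r ?nnegrE.
Qed.

(** From [1 - cos 1 = 2 sin(1/2)^2] and [sin(1/2) >= 1/2 - 1/16]. It makes [cos 1 / 2 <= 1 / 3], the
    fraction of [f] that the Gaussian mixture retains. *)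
Lemma cos1_le : cos 1 <= 2 / 3 :> R.
Proof.
have := one_sub_cosE 1; have := normr_sub_sin_le 2^-1; rewrite mul1r.
have -> : `|2^-1 : R| ^+ 3 / 2 = 16^-1 by rewrite ger0_norm//; field.
rewrite ler_norml => /andP[_]; set t := sin _ => t1 e.
have t2 : 7 / 16 <= t by lra.
nra.
Qed.

(** Were pi below 9/4, [cos (9/8)] would be nonpositive, whereas [1 - x^2 / 2] is positive at 9/8.
    Needed as [3 / 2 <= sqrt pi] when summing the Gaussian densities. *)
Lemma pi_ge_9_4 : 9 / 4 <= pi :> R.
Proof.
rewrite leNgt; apply/negP => pi9.
have := one_sub_cos_le (9 / 8); suff : cos (9 / 8) <= 0 :> R by nra.
rewrite -(@cos_pihalf R); have pi2 := pi_ge2 R.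
by rewrite ltW// ltr_cos ?in_itv/=; lra.
Qed.

Lemma norm_cos_sin_le x : `|cos x| + `|sin x| <= expR `|x|.
Proof.
rewrite (le_trans _ (expR_ge1Dx _))// lerD ?normr_sin_le//.
by rewrite ler_norml cos_geN1 cos_le1.
Qed.

End trigonometric_inequalities.

(** * The complex exponential as a limit of powers *)

Section exponential_limit.
Variable R : realType.
Implicit Types (z w : R[i]).

Lemma cexpD z w : cexp (z + w) = cexp z * cexp w.
Proof.
by apply: eq_ReIm; rewrite ?Re_mulc ?Im_mulc/= ?Re_addc ?Im_addc/= expRD ?cosD ?sinD; ring.
Qed.

Lemma cexp0 : cexp (0 : R[i]) = 1.
Proof. by rewrite /cexp/= expR0 cos0 sin0 !mul1r. Qed.

Lemma cexp_sum (I : Type) (s : seq I) (z : I -> R[i]) :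
  cexp (\sum_(i <- s) z i) = \prod_(i <- s) cexp (z i).
Proof.
elim: s => [|a s ih]; first by rewrite !big_nil cexp0.
by rewrite !big_cons cexpD ih.
Qed.

Lemma cexp_rc (x : R) : cexp (rc x) = rc (expR x).
Proof. by rewrite /cexp /rc/= cos0 sin0 mulr1 mulr0. Qed.

Definition norm1 z : R := `|complex.Re z| + `|complex.Im z|.

Lemma norm1D z w : norm1 (z + w) <= norm1 z + norm1 w.
Proof. by rewrite /norm1 Re_addc Im_addc addrACA; apply: lerD; exact: ler_normD. Qed.

Lemma norm1M z w : norm1 (z * w) <= norm1 z * norm1 w.
Proof.
rewrite /norm1 Re_mulc Im_mulc mulrDl !mulrDr -!normrM.
set a := complex.Re z * _; set b := complex.Im z * complex.Im w.
set c := complex.Re z * _; set e := complex.Im z * _.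
have := ler_normB a b; have := ler_normD c e; lra.
Qed.

Lemma norm1_ge0 z : 0 <= norm1 z. Proof. by rewrite addr_ge0. Qed.

(** Telescoping. The exponent [n] of [M], where [n - 1] would do, is harmless because [1 <= M]. *)
Lemma norm1_subX (M : R) z w n : 1 <= M -> norm1 z <= M -> norm1 w <= M ->
  norm1 (z ^+ n - w ^+ n) <= n%:R * norm1 (z - w) * M ^+ n.
Proof.
move=> M1 zM wM; have M0 : 0 <= M by rewrite (le_trans _ M1).
have wX k : norm1 (w ^+ k) <= M ^+ k.
  elim: k => [|k ih]; first by rewrite /norm1 !expr0/= normr1 normr0 addr0.
  by rewrite !exprS (le_trans (norm1M _ _))// ler_pM// norm1_ge0.
elim: n => [|n ih]; first by rewrite !expr0 subrr /norm1/= !normr0 addr0 !mul0r.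
have -> : z ^+ n.+1 - w ^+ n.+1 = z * (z ^+ n - w ^+ n) + (z - w) * w ^+ n.
  by rewrite !exprS; ring.
apply: le_trans (norm1D _ _) _.
have h1 : norm1 (z * (z ^+ n - w ^+ n)) <= M * (n%:R * norm1 (z - w) * M ^+ n).
  by rewrite (le_trans (norm1M _ _))// ler_pM// norm1_ge0.
have h2 : norm1 ((z - w) * w ^+ n) <= norm1 (z - w) * M ^+ n.+1.
  rewrite (le_trans (norm1M _ _))// ler_pM// ?norm1_ge0//.
  by rewrite (le_trans (wX n))// exprS ler_peMl// exprn_ge0.
apply: le_trans (lerD h1 h2) _.
rewrite le_eqVlt; apply/orP; left; apply/eqP.
by rewrite exprS -natr1; ring.
Qed.

Lemma ccvg_norm1 (u : nat -> R[i]) z :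
  norm1 (u n - z) @[n --> \oo] --> 0 -> ccvg u z.
Proof.
move=> uz; split; apply/cvgrPdistC_le => e e0.
  near=> n; apply: (@le_trans _ _ (norm1 (u n - z))).
    by rewrite /norm1 Re_addc Re_oppc lerDl.
  have := ler_norm (norm1 (u n - z)) => /le_trans; apply.
  rewrite -[norm1 _]subr0; near: n.
  by move/cvgrPdistC_le : uz; apply.
near=> n; apply: (@le_trans _ _ (norm1 (u n - z))).
  by rewrite /norm1 Im_addc Im_oppc lerDr.
have := ler_norm (norm1 (u n - z)) => /le_trans; apply.
rewrite -[norm1 _]subr0; near: n.
by move/cvgrPdistC_le : uz; apply.
Unshelve. all: end_near. Qed.

Lemma cvg_diff_quotient (f : R -> R) (df : R) : is_derive (0 : R) 1 f df ->
  n.+1%:R * (f n.+1%:R^-1 - f 0) @[n --> \oo] --> df.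
Proof.
move=> fd.
have := @ex_derive _ _ _ _ _ _ _ fd; rewrite /derivable => /cvg_ex[l lP].
have <- : l = df.
  by rewrite -(@derive_val _ _ _ _ _ _ _ fd) /derive; apply/esym/cvg_lim.
have c : (n.+1%:R^-1 : R) @[n --> \oo] --> 0^'.
  move=> S S0.
  have H : \forall n \near \oo, harmonic n != 0 :> R -> S (harmonic n).
    exact: (@cvg_harmonic R _ S0).
  apply: (@filterS _ \oo _ (fun n => harmonic n != 0 :> R -> S (harmonic n))) H => n.
  by apply; rewrite gt_eqF// harmonic_gt0.
have := cvg_comp _ _ c lP; apply: cvg_trans; apply: near_eq_cvg.
by apply: nearW => n /=; rewrite /GRing.scale/= invrK mulr1 addr0.
Qed.

(** [A n] is the (n+1)-st root of [cexp z] and [B n] its first-order expansion, so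
    [n.+1 * (B n - A n)] tends to 0. Both have norm at most [expR (k / n.+1)], whose (n+1)-st power
    stays equal to [expR k]. *)
Lemma ccvg_cexp z :
  ccvg (fun n => (1 + rc n.+1%:R^-1 * z) ^+ n.+1) (cexp z).
Proof.
case: z => x y; set z := Complex x y.
pose A n := cexp (rc n.+1%:R^-1 * z); pose B n := 1 + rc n.+1%:R^-1 * z.
have An n : cexp z = A n ^+ n.+1.
  have -> : z = \sum_(i < n.+1) (rc n.+1%:R^-1 * z).
    have sumE k (w : R[i]) : \sum_(i < k) w = rc k%:R * w.
      elim: k => [|k ih]; first by rewrite big_ord0 mulr0n mul0r.
      by rewrite big_ord_recr/= ih -natr1 rcD mulrDl mul1r.
    by rewrite sumE mulrA -rcM divff ?pnatr_eq0// mul1r.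
  by rewrite cexp_sum prodr_const card_ord.
pose k : R := `|x| + `|y|.
have bound n : norm1 (B n ^+ n.+1 - cexp z) <=
    n.+1%:R * norm1 (B n - A n) * expR k.
  have eqk : expR k = expR (k / n.+1%:R) ^+ n.+1.
    by rewrite -expRM_natl mulrCA divff ?mulr1// gt_eqF.
  rewrite (An n) eqk; apply: norm1_subX.
  - by rewrite -expR0 ler_expR divr_ge0// addr_ge0.
  - apply: le_trans (norm1D _ _) _.
    rewrite (le_trans _ (expR_ge1Dx _))// {1}/norm1/= normr1 normr0 addr0 lerD2l.
    rewrite /norm1/= !mul0r subr0 addr0 !normrM ger0_norm ?invr_ge0//.
    by rewrite -mulrDr mulrC.
  - rewrite /norm1/= !mul0r subr0 addr0 !normrM gtr0_norm ?expR_gt0//.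
    rewrite -mulrDr /k mulrDl expRD ler_pM ?addr_ge0 ?expR_ge0//.
      by rewrite ler_expR mulrC ler_wpM2r ?invr_ge0// ler_norm.
    apply: le_trans (norm_cos_sin_le _) _.
    by rewrite ler_expR normrM ger0_norm ?invr_ge0// mulrC.
have d1 : is_derive (0 : R) 1 (fun s => expR (x * s) * cos (y * s)) x.
  by apply: is_derive_eq; rewrite !mulr0 expR0 cos0 sin0 /GRing.scale/=; ring.
have d2 : is_derive (0 : R) 1 (fun s => expR (x * s) * sin (y * s)) y.
  by apply: is_derive_eq; rewrite !mulr0 expR0 cos0 sin0 /GRing.scale/=; ring.
have := cvg_diff_quotient d1; have := cvg_diff_quotient d2.
rewrite !mulr0 expR0 cos0 sin0 !mul1r => c2 c1.
have c0 : n.+1%:R * norm1 (B n - A n) * expR k @[n --> \oo] --> 0 * expR k.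
  apply: cvgM; last exact: cvg_cst.
  have -> : (fun n => n.+1%:R * norm1 (B n - A n)) = (fun n =>
    `|x - n.+1%:R * (expR (x * n.+1%:R^-1) * cos (y * n.+1%:R^-1) - 1)| +
    `|y - n.+1%:R * (expR (x * n.+1%:R^-1) * sin (y * n.+1%:R^-1) - 0)|).
    apply/funext => n; have n0 : (n.+1%:R : R) != 0 by rewrite pnatr_eq0.
    have absE (t : R) : n.+1%:R * `|t| = `|n.+1%:R * t|.
      by rewrite normrM ger0_norm.
    rewrite /norm1 mulrDr !absE.
    rewrite /B /A /= !mul0r !subr0 !addr0 [x * _]mulrC [y * _]mulrC.
    by congr (_ + _); congr Num.norm; field; rewrite addrC natr1.
  have := cvgD (cvg_norm (cvgB (cvg_cst x) c1)) (cvg_norm (cvgB (cvg_cst y) c2)).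
  by rewrite !subrr normr0 addr0; apply.
rewrite mul0r in c0; apply: ccvg_norm1.
apply: (squeeze_cvgr _ (cvg_cst 0) c0).
by apply: nearW => n; rewrite norm1_ge0 bound.
Qed.

(** The powers [(1 + Q / n) ^+ n] are built from sums and products, which preserve positive type.
    When [Q] is the transform of a finite measure, this is, up to normalization, a compound Poisson
    law. *)
Lemma pos_type_cexp (Q : R -> R[i]) : pos_type Q -> pos_type (fun h => cexp (Q h)).
Proof.
move=> PQ; apply: (@pos_type_cvg _ (fun n h => (1 + rc n.+1%:R^-1 * Q h) ^+ n.+1)).
  move=> n; apply: pos_typeX; apply: pos_typeD; first exact: (@pos_type_cst _ 1).
  by apply: pos_typeZ => //; rewrite invr_ge0.
by move=> h; exact: ccvg_cexp.
Qed.

Lemma cvg_expR (x : R) : (1 + n.+1%:R^-1 * x) ^+ n.+1 @[n --> \oo] --> expR x.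
Proof.
have [+ _] := ccvg_cexp (rc x).
rewrite cexp_rc/=; apply: cvg_trans; apply: near_eq_cvg; apply: nearW => n.
have rcX (t : R) k : rc t ^+ k = rc (t ^+ k).
  by elim: k => // k ih; rewrite !exprS ih rcM.
by rewrite -rcM -[1 : R[i]]/(rc 1) -rcD rcX.
Qed.

End exponential_limit.

(** On the windows [[- n.+1, n.+1]] the integral is a difference of boundary values of [F], each at
    most [K / n.+1]. *)
Lemma Rintegral_derivative_eq0 (R : realType) (F f : R -> R) (K : R) :
  (forall y : R, is_derive y 1 F (f y)) -> continuous f ->
  lebesgue_measure.-integrable setT (EFin \o f) ->
  (forall y, `|y| * `|F y| <= K) ->
  \int[lebesgue_measure]_y f y = 0.
Proof.
move=> dF cf fi FK.
have cF : continuous F.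
  move=> y; apply/differentiable_continuous/derivable1_diffP.
  exact: (@ex_derive _ _ _ _ _ _ _ (dF y)).
pose D n := `[- n.+1%:R, n.+1%:R]%classic : set R.
have mD n : measurable (D n) by exact: measurable_itv.
have mf : measurable_fun setT f by exact: continuous_measurable_fun.
pose f_ n x := (f x * \1_(D n) x)%:E.
have fE n : (\int[lebesgue_measure]_x f_ n x = (F n.+1%:R - F (- n.+1%:R))%:E)%E.
  have -> : f_ n = (EFin \o f) \_ (D n).
    apply/funext => x; rewrite /f_ patchE indicE.
    by case: (x \in D n); rewrite ?mulr1 ?mulr0.
  rewrite -integral_mkcond.
  rewrite (@continuous_FTC2 _ f F)//.
  - by rewrite gtrN.
  - exact: continuous_subspaceT.
  - split.
    + by move=> x _; exact: (@ex_derive _ _ _ _ _ _ _ (dF x)).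
    + by apply: cvg_at_right_filter; exact: cF.
    + by apply: cvg_at_left_filter; exact: cF.
  - by move=> x _; rewrite derive1E; exact: (@derive_val _ _ _ _ _ _ _ (dF x)).
have f0 : (fun n => \int[lebesgue_measure]_x f_ n x)%E @ \oo --> 0%E.
  under eq_fun do rewrite fE.
  apply: cvg_EFin; first exact: nearW.
  have FN (n : nat) y : `|y| = n.+1%:R -> `|F y| <= K / n.+1%:R.
    by move=> yn; rewrite ler_pdivlMr// mulrC -{1}yn.
  have bound n : `|F n.+1%:R - F (- n.+1%:R)| <= 2 * K * n.+1%:R^-1.
    rewrite (le_trans (ler_normB _ _))//.
    have -> : 2 * K * n.+1%:R^-1 = K / n.+1%:R + K / n.+1%:R by ring.
    by apply: lerD; apply: FN; rewrite ?normrN ger0_norm.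
  have c0 : 2 * K * n.+1%:R^-1 @[n --> \oo] --> 0.
    by rewrite -(mulr0 (2 * K)); apply: cvgM; [exact: cvg_cst|exact: cvg_harmonic].
  apply: norm_cvg0; apply: (squeeze_cvgr _ (cvg_cst 0) c0).
  by apply: nearW => n; rewrite normr_ge0 bound.
rewrite /Rintegral.
suff -> : (\int[lebesgue_measure]_x (f x)%:E = 0)%E by [].
have [|||||_ _ H] := @dominated_convergence _ _ R lebesgue_measure setT measurableT
  f_ (EFin \o f) (abse \o (EFin \o f)).
- move=> n; apply/measurable_EFinP/measurable_funM => //; exact: measurable_indic (mD n).
- exact/measurable_EFinP.
- apply: aeW => x _; apply: cvg_near_cst; near=> n.
  rewrite /f_ indicE mem_set/= ?mulr1// /D/= in_itv/=.
  rewrite -ler_norml (le_trans (ltW (archi_boundP _)))// ler_nat.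
  by rewrite leqW//; near: n; exact: nbhs_infty_ge.
- exact: integrable_abse.
- apply: aeW => x n _ /=; rewrite /f_ indicE lee_fin normrM ler_piMr//.
  by case: (_ \in _); rewrite /= ?normr1 ?normr0.
exact: (cvg_unique _ H f0).
Unshelve. all: end_near. Qed.

(** * Fourier transform of the normal density *)

Section gaussian_fourier_transform.
Variables (R : realType) (m s : R).
Hypothesis s0 : 0 < s.
Let mu := @lebesgue_measure R.
Let N := normal_pdf m s.
Let s' := s * Num.sqrt 2.

Let sn0 : s != 0. Proof. by rewrite gt_eqF. Qed.
Let s'n0 : s' != 0. Proof. by rewrite gt_eqF// mulr_gt0// sqrtr_gt0. Qed.

Let NE y : N y = normal_peak s * expR (- (y - m) ^+ 2 / (s ^+ 2 *+ 2)).
Proof. by rewrite /N normal_pdfE. Qed.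

Let tail := s * normal_peak s / normal_peak s'.

Let tail_ge0 : 0 <= tail.
Proof. by rewrite /tail divr_ge0 ?mulr_ge0 ?normal_peak_ge0// ltW. Qed.

(** Half of the Gaussian exponent absorbs the linear factor, since
    [w <= 1 + w^2 / 4 <= exp(w^2 / 4)]; the other half is a normal density of standard deviation
    [s * sqrt 2], hence an integrable majorant. *)
Let normr_mul_normal_le y : `|y - m| * N y <= tail * normal_pdf m s' y.
Proof.
rewrite NE normal_pdfE// /tail /normal_fun.
set t := y - m; set u := (t / s) ^+ 2 / 4.
have -> : - t ^+ 2 / (s ^+ 2 *+ 2) = - u - u by rewrite /u; field.
have -> : - t ^+ 2 / (s' ^+ 2 *+ 2) = - u.
  by rewrite /u /s' exprMn sqr_sqrtr//; field.
have p'0 : normal_peak s' != 0 by rewrite gt_eqF// normal_peak_gt0.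
have -> : s * normal_peak s / normal_peak s' * (normal_peak s' * expR (- u)) =
    normal_peak s * (s * expR (- u)) by field.
rewrite mulrCA ler_wpM2l ?normal_peak_ge0// expRD mulrA ler_wpM2r ?expR_ge0//.
rewrite expRN ler_pdivrMr ?expR_gt0//.
have -> : `|t| = s * `|t / s|.
  by rewrite normrM normfV (gtr0_norm s0) mulrCA divff ?mulr1.
rewrite ler_wpM2l ?(ltW s0)// (le_trans _ (expR_ge1Dx _))// /u.
rewrite -(@real_normK _ (t / s)) ?num_real//.
set w := `|_|; have -> : 1 + w ^+ 2 / 4 = w + (w / 2 - 1) ^+ 2 by field.
by rewrite lerDl sqr_ge0.
Qed.

Let mN : measurable_fun setT N.
Proof. exact: measurable_normal_pdf. Qed.

Let iN : mu.-integrable setT (EFin \o N).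
Proof. exact: integrable_normal_pdf. Qed.

Let iN' : mu.-integrable setT (fun y => (tail * normal_pdf m s' y)%:E).
Proof.
under eq_fun do rewrite EFinM.
by apply: integrableZl => //; exact: integrable_normal_pdf.
Qed.

Let integrable_dom (g : R -> R) : continuous g -> (forall y, `|g y| <= `|y - m| * N y) ->
  mu.-integrable setT (EFin \o g).
Proof.
move=> cg gb; apply: le_integrable iN' => //.
  by apply/measurable_EFinP; exact: continuous_measurable_fun.
move=> y _ /=; rewrite lee_fin (le_trans (gb y))// (le_trans (normr_mul_normal_le y))//.
exact: ler_norm.
Qed.

Lemma integrable_mul_normal (g : R -> R) (M : R) :
  measurable_fun setT g -> (forall y, `|g y| <= M) ->
  mu.-integrable setT (fun y => (g y * N y)%:E).
Proof.
move=> mg gb; apply: (@le_integrable _ _ _ mu setT _ _ (fun y => (M * N y)%:E)) => //.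
- by apply/measurable_EFinP; exact: measurable_funM.
- move=> y _ /=; rewrite lee_fin !normrM ler_wpM2r//.
  by rewrite (le_trans (gb y))// ler_norm.
- by under eq_fun do rewrite EFinM; exact: integrableZl.
Qed.

Let dN y : is_derive (y : R) 1 N (- (y - m) / s ^+ 2 * N y).
Proof.
have -> : N = (fun y => normal_peak s * expR (- (y - m) ^+ 2 / (s ^+ 2 *+ 2))).
  by apply/funext => z; rewrite NE.
apply: is_derive_eq; rewrite /GRing.scale/=; field.
by rewrite sn0.
Qed.

Let cN : continuous N. Proof. exact: continuous_normal_pdf. Qed.

(** The offset [t] treats cosine and sine together: it is [h * m] for the first and [h * m - pi / 2]
    for the second. *)
Let phase (t h y : R) := h * (y - m) + t.

Let D (t h : R) := \int[mu]_y (cos (phase t h y) * N y).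
Let S (t h : R) := \int[mu]_y ((y - m) * sin (phase t h y) * N y).

Let c_phase t h : continuous (phase t h).
Proof.
by move=> y; apply: cvgD; [apply: cvgM; [|apply: cvgB]|]; first [exact: cvg_cst|exact: cvg_id].
Qed.

Let c_lin : continuous (fun y : R => y - m).
Proof. by move=> y; apply: cvgB; first [exact: cvg_cst|exact: cvg_id]. Qed.

Let c_cos t h : continuous (fun y => cos (phase t h y)).
Proof. by move=> y; apply: continuous_comp; [exact: c_phase|exact: continuous_cos]. Qed.

Let c_sin t h : continuous (fun y => sin (phase t h y)).
Proof. by move=> y; apply: continuous_comp; [exact: c_phase|exact: continuous_sin]. Qed.

Let i_sin t h : mu.-integrable setT (fun y => ((y - m) * sin (phase t h y) * N y)%:E).
Proof.
apply: integrable_dom.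
  by move=> y; apply: cvgM; [apply: cvgM; [exact: c_lin|exact: c_sin]|exact: cN].
move=> y; rewrite !normrM (ger0_norm (normal_pdf_ge0 _ _ _)) ler_wpM2r ?normal_pdf_ge0//.
by rewrite ler_piMr// ler_norml sin_geN1 sin_le1.
Qed.

Let i_cos t h : mu.-integrable setT (fun y => (cos (phase t h y) * N y)%:E).
Proof.
apply: (@integrable_mul_normal _ 1); first exact: continuous_measurable_fun.
by move=> y; rewrite ler_norml cos_geN1 cos_le1.
Qed.

(** The derivative of [sin (phase) * N] has integral 0, and [N' = - (y - m) / s^2 * N]. *)
Let by_parts t h : S t h = s ^+ 2 * (h * D t h).
Proof.
pose F y := sin (phase t h y) * N y.
pose f y := h * (cos (phase t h y) * N y) -
  s ^- 2 * ((y - m) * sin (phase t h y) * N y).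
have dF (y : R) : is_derive y 1 F (f y).
  have := dN y => dNy; rewrite /F /f /phase.
  by apply: is_derive_eq; rewrite /GRing.scale/=; field.
have cf : continuous f.
  move=> y; apply: cvgB; apply: cvgM; try exact: cvg_cst; apply: cvgM; try exact: cN.
    exact: c_cos.
  by apply: cvgM; [exact: c_lin|exact: c_sin].
have i1 : mu.-integrable setT (fun y => (h * (cos (phase t h y) * N y))%:E).
  by under eq_fun do rewrite EFinM; apply: integrableZl.
have i2 : mu.-integrable setT (fun y => (s ^- 2 * ((y - m) * sin (phase t h y) * N y))%:E).
  by under eq_fun do rewrite EFinM; apply: integrableZl.
have fi : mu.-integrable setT (EFin \o f).
  by rewrite /comp /f; under eq_fun do rewrite EFinB; exact: integrableB.
have FK y : `|y| * `|F y| <= tail * normal_peak s' + `|m| * normal_peak s.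
  have N0 := normal_pdf_ge0 m s y.
  apply: (@le_trans _ _ (`|y| * N y)).
    by rewrite ler_wpM2l// normrM (ger0_norm N0) ler_piMl// ler_norml sin_geN1 sin_le1.
  apply: (@le_trans _ _ (`|y - m| * N y + `|m| * N y)).
    rewrite -mulrDl; apply: ler_wpM2r => //.
    by rewrite -[X in `|X| <= _](subrK m y) ler_normD.
  apply: lerD; last by rewrite ler_wpM2l// normal_pdf_ub.
  by rewrite (le_trans (normr_mul_normal_le y))// ler_wpM2l// normal_pdf_ub.
have := Rintegral_derivative_eq0 dF cf fi FK.
rewrite /f RintegralB// !RintegralZl//; try exact: i_cos; try exact: i_sin.
rewrite -/(D t h) -/(S t h) => /eqP; rewrite subr_eq0 => /eqP ->.
by rewrite mulrA divff ?mul1r// expf_neq0.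
Qed.

Let D_derive t (h : R) : is_derive h 1 (D t) (- (s ^+ 2 * h) * D t h).
Proof.
pose f h y := cos (phase t h y) * N y.
have hI : `]h - 1, h + 1[%classic h by rewrite /= in_itv/=; lra.
have dfE (x y : R) : is_derive x 1 (f ^~ y) (- ((y - m) * sin (phase t x y) * N y)).
  by rewrite /f /phase; apply: is_derive_eq; rewrite /GRing.scale/=; ring.
have df (x y : R) : `]h - 1, h + 1[%classic x -> setT y -> derivable (f ^~ y) x 1.
  by move=> _ _; exact: (@ex_derive _ _ _ _ _ _ _ (dfE x y)).
have d1 (x y : R) : partial1of2 f x y = - ((y - m) * sin (phase t x y) * N y).
  by rewrite partial1of2E (@derive_val _ _ _ _ _ _ _ (dfE x y)).
pose G y := tail * normal_pdf m s' y.
have G0 y : 0 <= G y by rewrite mulr_ge0// normal_pdf_ge0.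
have Gb (x y : R) : `]h - 1, h + 1[%classic x -> setT y -> `|partial1of2 f x y| <= G y.
  move=> _ _; rewrite d1 normrN (le_trans _ (normr_mul_normal_le y))//.
  rewrite !normrM (ger0_norm (normal_pdf_ge0 _ _ _)) ler_wpM2r ?normal_pdf_ge0//.
  by rewrite ler_piMr// ler_norml sin_geN1 sin_le1.
have intf x : `]h - 1, h + 1[%classic x -> mu.-integrable setT (EFin \o f x).
  by move=> _; exact: i_cos.
have dD := derivable_under_integral measurableT hI intf df G0 iN' Gb.
have := differentiation_under_integral measurableT hI intf df G0 iN' Gb.
rewrite derive1E => dE; apply: DeriveDef => //.
rewrite dE; under eq_Rintegral do rewrite d1 -mulN1r.
rewrite RintegralZl//; last exact: i_sin.
by rewrite -/(S t h) by_parts; ring.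
Qed.

Let D_eq t h : D t h = expR (- (s ^+ 2 * h ^+ 2 / 2)) * cos t.
Proof.
pose U h := expR (s ^+ 2 * h ^+ 2 / 2) * D t h.
(* Integrating factor for the equation [D' = - s^2 h D]. *)
have dU (x : R) : is_derive x 1 U 0.
  have := D_derive t x => dD.
  by apply: is_derive_eq; rewrite /GRing.scale/=; field.
have := is_derive_0_is_cst h 0 dU; rewrite /U expr0n mulr0 mul0r expR0 mul1r.
have -> : D t 0 = cos t.
  rewrite /D /phase; under eq_Rintegral do rewrite mul0r add0r.
  rewrite RintegralZl// /Rintegral.
  by rewrite [X in fine X]integral_normal_pdf mulr1.
by move=> <-; rewrite mulrA -expRD addNr expR0 mul1r.
Qed.

Lemma normal_cos h :
  \int[mu]_y (cos (h * y) * N y) = expR (- (s ^+ 2 * h ^+ 2 / 2)) * cos (h * m).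
Proof.
rewrite -D_eq; apply: eq_Rintegral => y _; congr (cos _ * _).
by rewrite /phase; ring.
Qed.

Lemma normal_sin h :
  \int[mu]_y (sin (h * y) * N y) = expR (- (s ^+ 2 * h ^+ 2 / 2)) * sin (h * m).
Proof.
have cs (x : R) : sin x = cos (x - pi / 2) by rewrite cosB cos_pihalf sin_pihalf; ring.
rewrite cs -D_eq; apply: eq_Rintegral => y _; rewrite cs; congr (cos _ * _).
by rewrite /phase; ring.
Qed.

End gaussian_fourier_transform.

Section pairing_integral.
Context d (T : measurableType d) (R : realType) (mu : {measure set T -> \bar R}).
Variables (D : set T) (Y w : T -> R).
Hypothesis mD : measurable D.
Hypothesis icos : forall h, mu.-integrable D (fun x => (cos (h * Y x) * w x)%:E).
Hypothesis isin : forall h, mu.-integrable D (fun x => (sin (h * Y x) * w x)%:E).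

Let ev_cons (t : R[i] * R) p y : ev (t :: p) y =
  complex.Re t.1 * cos (t.2 * y) - complex.Im t.1 * sin (t.2 * y) + ev p y.
Proof. by rewrite /ev /pairing big_cons Re_mulc. Qed.

Lemma integrable_ev p : mu.-integrable D (fun x => (ev p (Y x) * w x)%:E).
Proof.
elim: p => [|t p ih].
  under eq_fun do rewrite /ev /pairing big_nil mul0r.
  exact: integrable0.
under eq_fun do rewrite ev_cons mulrDl mulrBl EFinD EFinB -!mulrA !EFinM.
apply: integrableD => //; apply: integrableB => //; apply: integrableZl => //.
- by under eq_fun do rewrite -EFinM; exact: icos.
- by under eq_fun do rewrite -EFinM; exact: isin.
Qed.

Lemma pairing_integral p : pairing (fun h => Complex
    (\int[mu]_(x in D) (cos (h * Y x) * w x))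
    (\int[mu]_(x in D) (sin (h * Y x) * w x))) p =
  \int[mu]_(x in D) (ev p (Y x) * w x).
Proof.
elim: p => [|t p ih].
  rewrite /pairing big_nil; under eq_Rintegral do rewrite /ev /pairing big_nil mul0r.
  by rewrite Rintegral_cst// mul0r.
under eq_Rintegral do rewrite ev_cons mulrDl mulrBl -!mulrA.
have i1 : mu.-integrable D (fun x => (complex.Re t.1 * (cos (t.2 * Y x) * w x))%:E).
  by under eq_fun do rewrite EFinM; apply: integrableZl.
have i2 : mu.-integrable D (fun x => (complex.Im t.1 * (sin (t.2 * Y x) * w x))%:E).
  by under eq_fun do rewrite EFinM; apply: integrableZl.
rewrite RintegralD//; last 2 first.
  by rewrite /comp; under eq_fun do rewrite EFinB; apply: integrableB.
  exact: integrable_ev.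
rewrite RintegralB// !RintegralZl//; try exact: isin; try exact: icos.
by rewrite [LHS]/pairing big_cons Re_mulc; congr (_ + _); exact: ih.
Qed.

End pairing_integral.

Section gaussian_affinity.
Variable R : realType.

Lemma am_gm2 (u v al be ga : R) : 0 <= u -> 0 <= v -> 0 <= al -> 0 <= be ->
  0 <= ga -> 1 <= u * v -> al * be = ga ^+ 2 -> 2 * ga <= u * al + v * be.
Proof.
move=> u0 v0 a0 b0 g0 uv abg.
rewrite -(@ler_pXn2r _ 2)// ?nnegrE ?mulr_ge0 ?addr_ge0 ?mulr_ge0//.
apply: (@le_trans _ _ (4 * (u * v) * (al * be))).
  by rewrite abg exprMn -natrX ler_wpM2r ?sqr_ge0// ler_peMr.
rewrite -subr_ge0.
have -> : (u * al + v * be) ^+ 2 - 4 * (u * v) * (al * be) =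
  (u * al - v * be) ^+ 2 by ring.
exact: sqr_ge0.
Qed.

(** The law is normal of variance [x / 2]. Completing the square gives
    [N_0 * N_a = (rho * N_{a/2})^2] pointwise, with [rho] the claimed bound, so the
    arithmetic-geometric mean gives [p N_0 + q N_a >= 2 rho N_{a/2}], which integrates to
    [2 rho]. *)
Lemma gaussian_affinity (x a : R) : 0 < x ->
  affinity_ge (fun h => rc (expR (- (x * (h ^+ 2 / 4))))) a (expR (- (a ^+ 2 / 4 / x))).
Proof.
move=> x0 p q p0 q0 pq.
set s := Num.sqrt (x / 2).
have s0 : 0 < s by rewrite sqrtr_gt0 divr_gt0.
have s2 : s ^+ 2 = x / 2 by rewrite sqr_sqrtr// divr_ge0// ltW.
have xn0 : x != 0 by rewrite gt_eqF.
pose mu := @lebesgue_measure R.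
have mcos h : measurable_fun setT (fun y : R => cos (h * y)).
  by apply: continuous_measurable_fun => y; apply: continuous_comp;
    [exact: mulrl_continuous|exact: continuous_cos].
have msin h : measurable_fun setT (fun y : R => sin (h * y)).
  by apply: continuous_measurable_fun => y; apply: continuous_comp;
    [exact: mulrl_continuous|exact: continuous_sin].
have icos m h : mu.-integrable setT (fun y => (cos (h * y) * normal_pdf m s y)%:E).
  by apply: (@integrable_mul_normal _ _ _ _ 1) => // y; rewrite ler_norml cos_geN1 cos_le1.
have isin m h : mu.-integrable setT (fun y => (sin (h * y) * normal_pdf m s y)%:E).
  by apply: (@integrable_mul_normal _ _ _ _ 1) => // y; rewrite ler_norml sin_geN1 sin_le1.
have ft m r : pairing (fun h => rc (expR (- (x * (h ^+ 2 / 4)))) * chr m h) r =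
    \int[mu]_y (ev r y * normal_pdf m s y).
  rewrite -(pairing_integral measurableT (icos m) (isin m)); apply: eq_pairing => h.
  rewrite normal_cos// normal_sin// s2.
  have -> : x / 2 * h ^+ 2 / 2 = x * (h ^+ 2 / 4) by field.
  by apply: eq_ReIm; rewrite ?Re_mulc ?Im_mulc/=; ring.
rewrite (_ : pairing _ p = pairing (fun h => rc (expR (- (x * (h ^+ 2 / 4)))) * chr 0 h) p); last first.
  by apply: eq_pairing => h; rewrite /chr mulr0 [cis 0]cis0 mulr1.
rewrite !ft -RintegralD//; try exact: (integrable_ev measurableT (icos _) (isin _)).
set rho := expR _.
have -> : 2 * rho = \int[mu]_y (2 * rho * normal_pdf (a / 2) s y).
  rewrite RintegralZl//; last exact: integrable_normal_pdf.
  by rewrite /Rintegral integral_normal_pdf mulr1.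
apply: le_Rintegral => //.
- by rewrite /comp; under eq_fun do rewrite EFinM; apply: integrableZl => //; exact: integrable_normal_pdf.
- rewrite /comp; under eq_fun do rewrite EFinD.
  by apply: integrableD => //; exact: (integrable_ev measurableT (icos _) (isin _)).
move=> y _; rewrite -mulrA; apply: am_gm2 => //; rewrite ?normal_pdf_ge0//.
  by rewrite mulr_ge0 ?expR_ge0 ?normal_pdf_ge0.
rewrite !normal_pdfE ?gt_eqF// /normal_fun s2 /rho.
set c := normal_peak s.
have -> : - (y - 0) ^+ 2 / (x / 2 *+ 2) = - (y ^+ 2 / x) by field.
have -> : - (y - a) ^+ 2 / (x / 2 *+ 2) = - ((y - a) ^+ 2 / x) by field.
have -> : - (y - a / 2) ^+ 2 / (x / 2 *+ 2) = - ((y - a / 2) ^+ 2 / x) by field.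
rewrite mulrACA -expRD mulrCA exprMn -expRD -expRM_natl -expr2; congr (_ * expR _).
by field.
Qed.

End gaussian_affinity.

(** * Gaussian mixtures, encoded by the Laplace transform of their variance *)

Section mixtures.
Variable R : realType.

(* The closed cone generated by the exponentials: Laplace transforms of finite
   measures on [0, +oo[. *)
Inductive laplace : (R -> R) -> Prop :=
| laplace_exp x : 0 <= x -> laplace (fun r => expR (- (x * r)))
| laplaceD l m : laplace l -> laplace m -> laplace (fun r => l r + m r)
| laplaceZ c l : 0 <= c -> laplace l -> laplace (fun r => c * l r)
| laplace_cvg (l_ : nat -> R -> R) l : (forall n, laplace (l_ n)) ->
    (forall r, l_ n r @[n --> \oo] --> l r) -> laplace l.

Lemma eq_laplace l m : l =1 m -> laplace l -> laplace m.
Proof.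
move=> e L; apply: (@laplace_cvg (fun=> l)) => // r; rewrite e; exact: cvg_cst.
Qed.

Lemma laplace_cst c : 0 <= c -> laplace (fun=> c).
Proof.
move=> c0; apply: (@eq_laplace (fun r => c * expR (- (0 * r)))).
  by move=> r; rewrite mul0r oppr0 expR0 mulr1.
by apply: laplaceZ => //; exact: laplace_exp.
Qed.

(** The product is bilinear and continuous in each factor, so induction on both reduces it to two
    exponentials, whose exponents add. *)
Lemma laplaceM l m : laplace l -> laplace m -> laplace (fun r => l r * m r).
Proof.
move=> L; elim=> {m} [x x0|m m' _ ih _ ih'|c m c0 _ ih|m_ m _ ih c].
- elim: L => {l} [y y0|l l' _ ih _ ih'|c l c0 _ ih|l_ l _ ih c].
  + apply: (@eq_laplace (fun r => expR (- ((x + y) * r)))).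
      by move=> r; rewrite -expRD; congr expR; ring.
    by apply: laplace_exp; rewrite addr_ge0.
  + apply: eq_laplace (laplaceD ih ih') => r.
    by rewrite mulrDl.
  + apply: eq_laplace (laplaceZ c0 ih) => r.
    by rewrite mulrA.
  + apply: (laplace_cvg ih) => r.
    by apply: cvgM; [exact: c|exact: cvg_cst].
- by apply: eq_laplace (laplaceD ih ih') => r; rewrite mulrDr.
- by apply: eq_laplace (laplaceZ c0 ih) => r; rewrite mulrCA.
- apply: (laplace_cvg ih) => r.
  by apply: cvgM; [exact: cvg_cst|exact: c].
Qed.

Lemma laplaceX l n : laplace l -> laplace (fun r => l r ^+ n).
Proof.
move=> L; elim: n => [|n ih]; first exact: laplace_cst.
by apply: eq_laplace (laplaceM L ih) => r; rewrite exprS.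
Qed.

Lemma laplace_dilate k l : 0 <= k -> laplace l -> laplace (fun r => l (k * r)).
Proof.
move=> k0; elim=> {l} [x x0|l m _ ih _ ih'|c l c0 _ ih|l_ l _ ih c].
- by apply: eq_laplace (laplace_exp (mulr_ge0 x0 k0)) => r; rewrite mulrA.
- exact: laplaceD.
- exact: laplaceZ.
- by apply: (laplace_cvg ih) => r; exact: c.
Qed.

Lemma laplace_sum (I : Type) (t : seq I) (l : I -> R -> R) :
  (forall i, laplace (l i)) -> laplace (fun r => \sum_(i <- t) l i r).
Proof.
move=> L; elim: t => [|i t ih].
  by apply: eq_laplace (laplace_cst (lexx 0)) => r; rewrite big_nil.
by apply: eq_laplace (laplaceD (L i) ih) => r; rewrite big_cons.
Qed.

Lemma laplace_prod (I : Type) (t : seq I) (l : I -> R -> R) :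
  (forall i, laplace (l i)) -> laplace (fun r => \prod_(i <- t) l i r).
Proof.
move=> L; elim: t => [|i t ih].
  by apply: eq_laplace (laplace_cst ler01) => r; rewrite big_nil.
by apply: eq_laplace (laplaceM (L i) ih) => r; rewrite big_cons.
Qed.

Lemma laplace_expR l : laplace l -> laplace (fun r => expR (l r)).
Proof.
move=> L; apply: (@laplace_cvg (fun n r => (1 + n.+1%:R^-1 * l r) ^+ n.+1)).
  move=> n; apply: laplaceX; apply: laplaceD; first exact: laplace_cst.
  by apply: laplaceZ => //; rewrite invr_ge0.
by move=> r; exact: cvg_expR.
Qed.

(* With b = a^2 / 4 this bounds E(1 - exp(- b / S)) by Riemann sums of
   b * E(1 / S) = b * \int_0^oo E(exp(- r S)) dr, truncated at r = M * delta. *)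
Definition affinity_defect (b delta : R) (M : nat) (l : R -> R) :=
  b * (delta * \sum_(j < M) l (j%:R * delta)) + l (M%:R * delta).

(** With [q = expR (- (x * delta))], the bound [1 - q <= x * delta] and the geometric sum put the
    left side below [(1 - q ^+ M) * (1 - b / x)]. This is at most [1 - b / x] or negative, hence at
    most [expR (- (b / x))]. *)
Lemma affinity_defect_exp (b delta x : R) M : 0 <= b -> 0 <= delta -> 0 < x ->
  1 - affinity_defect b delta M (fun r => expR (- (x * r))) <= expR (- (b / x)).
Proof.
move=> b0 d0 x0; rewrite /affinity_defect.
set q := expR (- (x * delta)).
have qj j : expR (- (x * (j%:R * delta))) = q ^+ j.
  by rewrite /q -expRM_natl; congr expR; ring.
under eq_bigr do rewrite qj.
rewrite qj.
have q1 : q <= 1 by rewrite /q -expR0 ler_expR oppr_le0 mulr_ge0// ltW.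
have q0 : 0 <= q by exact: expR_ge0.
have geo : 1 - q ^+ M <= x * (delta * \sum_(j < M) q ^+ j).
  elim: M => [|M ih]; first by rewrite big_ord0 expr0 !mulr0 subrr.
  rewrite big_ord_recr/= !mulrDr.
  have -> : 1 - q ^+ M.+1 = (1 - q ^+ M) + (1 - q) * q ^+ M by rewrite exprS; ring.
  apply: lerD => //; rewrite mulrA ler_wpM2r ?exprn_ge0//.
  by rewrite lerBlDr addrC -lerBlDr; have := expR_ge1Dx (- (x * delta)); rewrite /q; lra.
have qM1 : q ^+ M <= 1 by rewrite exprn_ile1.
have qM0 : 0 <= q ^+ M by rewrite exprn_ge0.
have bx : 0 <= b / x by rewrite divr_ge0// ltW.
apply: (@le_trans _ _ ((1 - q ^+ M) * (1 - b / x))).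
  suff : b / x * (1 - q ^+ M) <= b * (delta * \sum_(j < M) q ^+ j) by lra.
  rewrite mulrAC ler_pdivrMr// -!mulrA ler_wpM2l//.
  by apply: le_trans geo _; rewrite le_eqVlt; apply/orP; left; apply/eqP; ring.
have [h|h] := leP 0 (1 - b / x); last first.
  apply: (@le_trans _ _ 0); last exact: expR_ge0.
  by rewrite mulr_ge0_le0 ?subr_ge0// ltW.
apply: (@le_trans _ _ (1 - b / x)).
  by rewrite ler_piMl// lerBlDr lerDl.
exact: expR_ge1Dx.
Qed.

(** Both [l 0] and the defect are linear and pointwise continuous in [l], and affinity bounds add,
    scale and pass to limits; so induction over the cone leaves only a single Gaussian. *)
Lemma laplace_affinity l a delta M : laplace l -> 0 <= delta ->
  affinity_ge (fun h => rc (l (h ^+ 2 / 4))) a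
    (l 0 - affinity_defect (a ^+ 2 / 4) delta M l).
Proof.
move=> L d0; have b0 : 0 <= a ^+ 2 / 4 by rewrite divr_ge0 ?sqr_ge0.
elim: L => {l} [x|l m _ ih _ ih'|c l c0 _ ih|l_ l _ ih c].
- rewrite le_eqVlt => /predU1P[<-|x0]; last first.
    apply: affinity_ge_le (gaussian_affinity _ x0).
    by rewrite mulr0 oppr0 expR0; exact: affinity_defect_exp.
  (* The case [x = 0] is a Dirac mass, which its translate need not meet. Here the tail term of the
     defect equals 1 and makes the bound nonpositive. *)
  move=> p q p0 q0 pq; rewrite /affinity_defect.
  under eq_bigr do rewrite mul0r oppr0 expR0.
  rewrite !mul0r !oppr0 expR0 opprD addrCA subrr addr0.
  have -> : pairing (fun h => rc (expR (- (0 * (h ^+ 2 / 4))))) p = ev p 0.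
    by apply: eq_pairing => h; rewrite mul0r oppr0 expR0 /chr mulr0 [cis 0]cis0.
  have -> : pairing (fun h => rc (expR (- (0 * (h ^+ 2 / 4)))) * chr a h) q = ev q a.
    by apply: eq_pairing => h; rewrite mul0r oppr0 expR0 mul1r.
  apply: (@le_trans _ _ 0); last by rewrite addr_ge0.
  by rewrite mulrN oppr_le0 mulr_ge0// mulr_ge0// mulr_ge0// sumr_ge0.
- apply: (@eq_affinity_ge _ (fun h => rc (l (h ^+ 2 / 4)) + rc (m (h ^+ 2 / 4)))).
    by move=> h; rewrite rcD.
  apply: affinity_ge_le (affinity_geD ih ih').
  by rewrite /affinity_defect big_split/=; lra.
- apply: (@eq_affinity_ge _ (fun h => rc c * rc (l (h ^+ 2 / 4)))).
    by move=> h; rewrite rcM.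
  apply: affinity_ge_le (affinity_geZ c0 ih).
  rewrite /affinity_defect -mulr_sumr le_eqVlt; apply/orP; left; apply/eqP; ring.
- apply: (affinity_ge_cvg ih).
    by move=> h; split => //=; exact: cvg_cst.
  apply: cvgB => //; apply: cvgD => //; apply: cvgM; first exact: cvg_cst.
  apply: cvgM; first exact: cvg_cst.
  elim: (index_enum _) => [|j t iht].
    by rewrite big_nil; under eq_fun do rewrite big_nil; exact: cvg_cst.
  by rewrite big_cons; under eq_fun do rewrite big_cons; apply: cvgD.
Qed.

End mixtures.

(** * Bernstein functions and Levy measures *)


Section bernstein_functions.
Variables (R : realType) (f : R -> R).
Hypothesis bf : bernstein f.
Hypothesis f0 : f 0 = 0.

Let df (x : R) : 0 < x -> is_derive x 1 f (derive1n 1 f x).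
Proof.
move=> x0; have [_ _ d _] := bf; apply: DeriveDef; first exact: (d 0%N).
by rewrite -derive1E.
Qed.

Let ddf (x : R) : 0 < x -> is_derive x 1 (derive1n 1 f) (derive1n 2 f x).
Proof.
move=> x0; have [_ _ d _] := bf; apply: DeriveDef; first exact: (d 1%N).
by rewrite -derive1E.
Qed.

Let df_ge0 x : 0 < x -> 0 <= derive1n 1 f x.
Proof. by move=> x0; have [_ _ _ /(_ 1%N x isT x0)] := bf; rewrite expr1 mulN1r oppr_le0. Qed.

Let ddf_le0 x : 0 < x -> derive1n 2 f x <= 0.
Proof. by move=> x0; have [_ _ _ /(_ 2%N x isT x0)] := bf; rewrite sqrrN expr1n mul1r. Qed.

Let cf a b : 0 <= a -> {within `[a, b], continuous f}.
Proof.
move=> a0; have [_ c _ _] := bf; apply: continuous_subspaceW c.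
by move=> x/=; rewrite !in_itv/= andbT => /andP[/(le_trans a0)].
Qed.

Let cdf a b : 0 < a -> {within `[a, b], continuous (derive1n 1 f)}.
Proof.
move=> a0; apply: continuous_in_subspaceT => x; rewrite inE/= in_itv/= => /andP[ax _].
apply/differentiable_continuous/derivable1_diffP.
by apply: (@ex_derive _ _ _ _ _ _ _ (ddf _)); rewrite (lt_le_trans a0).
Qed.

Lemma bernstein_ge0 x : 0 <= x -> 0 <= f x.
Proof. by have [+ _ _ _] := bf; apply. Qed.

Lemma bernstein_le x y : 0 <= x -> x <= y -> f x <= f y.
Proof.
move=> x0; rewrite le_eqVlt => /predU1P[->//|xy].
have d z : z \in `]x, y[ -> is_derive z 1 f (derive1n 1 f z).
  by rewrite in_itv/= => /andP[xz _]; apply: df; rewrite (le_lt_trans x0).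
have [c + e] := MVT xy d (cf x0); rewrite in_itv/= => /andP[xc _].
by rewrite -subr_ge0 e mulr_ge0 ?subr_ge0 ?(ltW xy)//; apply: df_ge0; rewrite (le_lt_trans x0).
Qed.

(** The mean slopes over [[0, l * x]] and [[l * x, x]] are values of the derivative, which
    decreases; [f 0 = 0] turns this into the inequality. *)
Lemma bernstein_concave l x : 0 <= l <= 1 -> 0 <= x -> l * f x <= f (l * x).
Proof.
move=> /andP[l0 l1]; rewrite le_eqVlt => /predU1P[<-|x0]; first by rewrite mulr0 f0 mulr0.
move: l0; rewrite le_eqVlt => /predU1P[<-|l0]; first by rewrite !mul0r f0.
move: l1; rewrite le_eqVlt => /predU1P[->|l1]; first by rewrite !mul1r.
have lx : 0 < l * x by rewrite mulr_gt0.
have lxx : l * x < x by rewrite gtr_pMl.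
have d1 z : z \in `]0, (l * x)[ -> is_derive z 1 f (derive1n 1 f z).
  by rewrite in_itv/= => /andP[xz _]; exact: df.
have d2 z : z \in `](l * x), x[ -> is_derive z 1 f (derive1n 1 f z).
  by rewrite in_itv/= => /andP[xz _]; apply: df; rewrite (lt_trans lx).
have [c1 + e1] := MVT lx d1 (cf (lexx 0)); rewrite in_itv/= => /andP[c10 c1l].
have [c2 + e2] := MVT lxx d2 (cf (ltW lx)); rewrite in_itv/= => /andP[c2l c2x].
have c12 : c1 < c2 by rewrite (lt_trans c1l).
have d3 z : z \in `]c1, c2[ -> is_derive z 1 (derive1n 1 f) (derive1n 2 f z).
  by rewrite in_itv/= => /andP[xz _]; apply: ddf; rewrite (lt_trans c10).
have [c3 + e3] := MVT c12 d3 (cdf c10); rewrite in_itv/= => /andP[c31 _].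
have D12 : derive1n 1 f c2 <= derive1n 1 f c1.
  rewrite -subr_le0 e3 mulr_le0_ge0 ?subr_ge0 ?(ltW c12)//.
  by apply: ddf_le0; rewrite (lt_trans c10).
move: e1 e2; rewrite f0 !subr0 => e1 e2.
have -> : f x = f (l * x) + derive1n 1 f c2 * (x - l * x) by rewrite -e2; ring.
rewrite e1; move: D12; set a := derive1n 1 f c1; set b := derive1n 1 f c2 => ba.
rewrite -subr_ge0.
have -> : a * (l * x) - l * (a * (l * x) + b * (x - l * x)) =
  (a - b) * (l * (1 - l) * x) by ring.
by rewrite mulr_ge0 ?subr_ge0// !mulr_ge0 ?subr_ge0 ?ltW.
Qed.

Lemma bernstein_dilate w r : 0 <= w -> 0 <= r -> f (w * r) <= Num.max 1 w * f r.
Proof.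
move=> w0 r0; have [w1|w1] := leP w 1.
  by rewrite mul1r bernstein_le ?mulr_ge0// ler_piMl.
have wp : 0 < w by rewrite (lt_trans _ w1).
have := @bernstein_concave w^-1 (w * r); rewrite invr_ge0 w0 invf_le1// ltW//= mulr_ge0//.
by move=> /(_ isT isT); rewrite mulrA mulVf ?gt_eqF// mul1r ler_pdivrMl.
Qed.

End bernstein_functions.

(** * A finite Gaussian mixture below the density [|z|^-1 * f (z ^- 2)] *)

Section dyadic_mixture.
Variables (R : realType) (f : R -> R).
Hypothesis bf : bernstein f.
Hypothesis f0 : f 0 = 0.
Variable M : nat.

(** For [k <= 2 * M] these are the powers of 2 from [2 ^ - M] to [2 ^ M]. *)
Definition node k : R := 2 ^+ k / 2 ^+ M.

Lemma node_gt0 k : 0 < node k.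
Proof. by rewrite divr_gt0// exprn_gt0. Qed.

Lemma nodeS k : node k.+1 = 2 * node k.
Proof. by rewrite /node exprS mulrA. Qed.

(** The integral of [1 - cos (h * z)] against [mixture_density] is this function at [h ^+ 2 / 4]. It
    replaces [f], up to a factor 3, on the range of the squared nodes. *)
Definition mixture_exponent (r : R) :=
  \sum_(k < (2 * M).+1) f (node k ^+ 2) / 2 * (1 - expR (- ((node k ^+ 2)^-1 * r))).

Definition mixture_density (z : R) :=
  \sum_(k < (2 * M).+1) f (node k ^+ 2) / 2 * normal_pdf 0 (node k * Num.sqrt 2)^-1 z.

Let fnode k : 0 <= f (node k ^+ 2) / 2.
Proof. by rewrite divr_ge0// (bernstein_ge0 bf)// sqr_ge0. Qed.

Lemma mixture_term_ge0 k r : 0 <= r ->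
  0 <= f (node k ^+ 2) / 2 * (1 - expR (- ((node k ^+ 2)^-1 * r))).
Proof.
move=> r0; rewrite mulr_ge0// subr_ge0 -expR0 ler_expR oppr_le0 mulr_ge0//.
by rewrite invr_ge0 sqr_ge0.
Qed.

Lemma mixture_exponent0 : mixture_exponent 0 = 0.
Proof. by rewrite /mixture_exponent big1// => k _; rewrite mulr0 oppr0 expR0 subrr mulr0. Qed.

Let one_sub_exp (x : R) : 0 <= x -> x / (1 + x) <= 1 - expR (- x).
Proof.
move=> x0; have x1 : 0 < 1 + x by rewrite ltr_pwDl.
have -> : x / (1 + x) = 1 - (1 + x)^-1 by field; rewrite gt_eqF.
by rewrite lerD2l lerN2 expRN lef_pV2 ?posrE ?expR_gt0// expR_ge1Dx.
Qed.

Let bracket n (r : R) : (0 < n)%N -> node 0 ^+ 2 <= r -> r <= node n ^+ 2 ->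
  exists2 k, (k < n)%N & node k ^+ 2 <= r <= node k.+1 ^+ 2.
Proof.
elim: n => // n ih _ r0 rn.
have [h|h] := leP (node n ^+ 2) r; first by exists n => //; rewrite h.
case: n => [|n] in ih rn h *; first by move: (lt_le_trans h r0); rewrite ltxx.
by have [k kn ?] := ih isT r0 (ltW h); exists k => //; rewrite ltnW.
Qed.

(* Two neighbouring terms of the sum suffice: with y = r / node k ^ 2 in [1, 4],
   1 / (1 + y) + y / (4 + y) >= 2 / 3 because (y - 2) ^ 2 >= 0. *)
Lemma mixture_exponent_ge r : (0 < M)%N -> node 0 ^+ 2 <= r -> r <= node (2 * M) ^+ 2 ->
  f r / 3 <= mixture_exponent r.
Proof.
move=> M0 r0 rM.
have M20 : (0 < 2 * M)%N by rewrite muln_gt0.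
have [k kM /andP[kr rk]] := bracket M20 r0 rM.
have nk := node_gt0 k; set n2 := node k ^+ 2 in kr *.
have n20 : 0 < n2 by rewrite exprn_gt0.
have rp : 0 < r by rewrite (lt_le_trans n20).
have e4 : node k.+1 ^+ 2 = 4 * n2 by rewrite nodeS exprMn -natrX.
pose y := r / n2.
have yr : r = y * n2 by rewrite /y divfK// gt_eqF.
have y0 : 0 < y by rewrite divr_gt0.
have kS : (k.+1 < (2 * M).+1)%N by rewrite ltnS.
have kl : (k < (2 * M).+1)%N by rewrite ltnW.
rewrite /mixture_exponent (bigD1 (Ordinal kl))//= (bigD1 (Ordinal kS))/=; last first.
  by rewrite -val_eqE/= gtn_eqF.
rewrite addrA -[leLHS]addr0; apply: lerD; last first.
  by apply: sumr_ge0 => i _; apply: mixture_term_ge0; exact: ltW.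
rewrite e4 -/n2.
have h1 : f r / (2 * (1 + y)) <= f n2 / 2 * (1 - expR (- (n2^-1 * r))).
  have -> : n2^-1 * r = y by rewrite mulrC.
  have fr : y^-1 * f r <= f n2.
    have -> : n2 = y^-1 * r by rewrite yr mulKf// gt_eqF.
    apply: bernstein_concave => //; last exact: ltW.
    by rewrite invr_ge0 ltW//= invf_le1// ler_pdivlMr// mul1r.
  have -> : f r / (2 * (1 + y)) = (y^-1 * f r) / 2 * (y / (1 + y)).
    by field; rewrite !gt_eqF// addr_gt0.
  have fr0 : 0 <= f r by rewrite (bernstein_ge0 bf)// ltW.
  have y1 : 0 <= y / (1 + y) by rewrite divr_ge0 ?addr_ge0// ltW.
  apply: ler_pM; [|by []| |exact/one_sub_exp/ltW].
    by rewrite divr_ge0// mulr_ge0// invr_ge0 ltW.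
  by rewrite ler_wpM2r.
have h2 : f r * (y / (4 + y)) / 2 <= f (4 * n2) / 2 * (1 - expR (- ((4 * n2)^-1 * r))).
  have -> : (4 * n2)^-1 * r = y / 4 by rewrite /y invfM; ring.
  have -> : f r * (y / (4 + y)) / 2 = f r / 2 * ((y / 4) / (1 + y / 4)).
    by field; rewrite !gt_eqF// ?addr_gt0// mulr_gt0// addr_gt0.
  have fr0 : 0 <= f r by rewrite (bernstein_ge0 bf)// ltW.
  have y4 : 0 <= y / 4 by rewrite divr_ge0// ltW.
  apply: ler_pM; [by rewrite divr_ge0|by rewrite divr_ge0// addr_ge0| |exact: one_sub_exp].
  by rewrite ler_wpM2r// (bernstein_le bf) ?(ltW rp)// -e4.
apply: le_trans (lerD h1 h2).
have fr0 : 0 <= f r by rewrite (bernstein_ge0 bf)// ltW.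
have -> : f r / (2 * (1 + y)) + f r * (y / (4 + y)) / 2 =
    f r * ((1 + y)^-1 + y / (4 + y)) / 2.
  by field; rewrite !gt_eqF// addr_gt0.
rewrite -mulrA ler_wpM2l//.
suff : 2 / 3 <= (1 + y)^-1 + y / (4 + y) by lra.
have -> : (1 + y)^-1 + y / (4 + y) = 2 / 3 + (y - 2) ^+ 2 / (3 * (1 + y) * (4 + y)).
  by field; rewrite !gt_eqF// addr_gt0.
have yy := ltW y0.
by rewrite lerDl divr_ge0 ?sqr_ge0// mulr_ge0 ?addr_ge0// mulr_ge0// addr_ge0.
Qed.

Let sqr_le_exp (w : R) : 0 <= w -> w ^+ 2 <= expR w.
Proof.
move=> w0; have -> : w = 4 * (w / 4) by field.
rewrite expRM_natl.
have v0 : 0 <= w / 4 by rewrite divr_ge0.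
have h := expR_ge1Dx (w / 4).
apply: (@le_trans _ _ ((1 + w / 4) ^+ 4)); last first.
  by rewrite lerXn2r// ?nnegrE ?expR_ge0// addr_ge0.
set v := w / 4 in v0 *.
have -> : (1 + v) ^+ 4 = ((1 + v) ^+ 2) ^+ 2 by rewrite -exprM.
rewrite lerXn2r ?nnegrE ?sqr_ge0//; first by rewrite mulr_ge0.
rewrite -subr_ge0.
have -> : (1 + v) ^+ 2 - 4 * v = (1 - v) ^+ 2 by ring.
exact: sqr_ge0.
Qed.

(** A bound uniform in [n] whose two branches are stable under the doubling of [x] made by peeling
    off the first term. *)
Let geom n (x : R) : 0 < x ->
  \sum_(k < n) Num.min (2 ^+ k * x) (2 ^+ k * x)^-1 <=
  if x <= 1 then 3 - x else 2 / x.
Proof.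
elim: n x => [|n ih] x x0.
  by rewrite big_ord0; case: ifPn => [x1|_]; [lra|rewrite divr_ge0// ltW].
rewrite big_ord_recl/= expr0 mul1r.
under eq_bigr => i _ do rewrite /bump/= add1n exprSr -mulrA.
have x20 : 0 < 2 * x by rewrite mulr_gt0.
have := ih _ x20; set S := \sum_(i < n) _ => iS.
case: ifPn iS => [x2|]; last rewrite -ltNge => x2; move=> iS.
  have -> : x <= 1 by lra.
  suff : Num.min x x^-1 <= x by lra.
  by rewrite ge_min lexx.
have e : 2 / (2 * x) = x^-1 by field; rewrite gt_eqF.
case: ifPn => [x1|]; last rewrite -ltNge => x1.
  apply: (@le_trans _ _ (x + x^-1)).
    by rewrite -e; apply: lerD => //; rewrite ge_min lexx.
  suff : x^-1 <= 3 - 2 * x by lra.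
  by rewrite -[x^-1]mul1r ler_pdivrMr//; nra.
have -> : 2 / x = x^-1 + x^-1 by ring.
by rewrite -[in X in _ <= _ + X]e lerD// ge_min lexx orbT.
Qed.

(** With [x = node k * |z|], [bernstein_dilate] gives [f (node k ^+ 2) <= max(1, x^2) * f (z ^- 2)],
    and the Gaussian factor reduces the k-th term to a common multiple of [min(x, 1/x)]. These
    minima sum to at most 3 over dyadic [x], leaving the factor [3 / (2 sqrt pi) <= 1]. *)
Lemma mixture_density_le (z : R) : z != 0 ->
  mixture_density z <= `|z|^-1 * f (z ^- 2).
Proof.
move=> z0; have az : 0 < `|z| by rewrite normr_gt0.
have fz : 0 <= f (z ^- 2) by rewrite (bernstein_ge0 bf)// invr_ge0 sqr_ge0.
have spi : 0 < Num.sqrt pi :> R by rewrite sqrtr_gt0 pi_gt0.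
have term k : f (node k ^+ 2) / 2 * normal_pdf 0 (node k * Num.sqrt 2)^-1 z <=
   `|z|^-1 * f (z ^- 2) / (2 * Num.sqrt pi) *
     Num.min (2 ^+ k * (`|z| / 2 ^+ M)) (2 ^+ k * (`|z| / 2 ^+ M))^-1.
  have nk := node_gt0 k.
  set x := 2 ^+ k * (`|z| / 2 ^+ M).
  have xE : x = node k * `|z| by rewrite /x /node; ring.
  have x0 : 0 < x by rewrite xE mulr_gt0.
  have x2E : x ^+ 2 = node k ^+ 2 * z ^+ 2.
    by rewrite xE exprMn real_normK ?num_real.
  have s0 : (node k * Num.sqrt 2)^-1 != 0 by rewrite invr_neq0// mulf_neq0// gt_eqF// sqrtr_gt0.
  have s2 : (node k * Num.sqrt 2)^-1 ^+ 2 = (2 * node k ^+ 2)^-1.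
    by rewrite exprVn exprMn sqr_sqrtr// mulrC.
  rewrite normal_pdfE// /normal_peak /normal_fun s2 subr0.
  have -> : - z ^+ 2 / ((2 * node k ^+ 2)^-1 *+ 2) = - x ^+ 2.
    by rewrite x2E; field; rewrite gt_eqF.
  have -> : (Num.sqrt ((2 * node k ^+ 2)^-1 * pi *+ 2))^-1 = node k / Num.sqrt pi.
    have -> : (2 * node k ^+ 2)^-1 * pi *+ 2 = (node k)^-1 ^+ 2 * pi.
      by field; rewrite gt_eqF.
    by rewrite sqrtrM ?sqr_ge0// sqrtr_sqr gtr0_norm ?invr_gt0// invfM invrK.
  have fk : f (node k ^+ 2) <= Num.max 1 (x ^+ 2) * f (z ^- 2).
    have -> : node k ^+ 2 = x ^+ 2 * z ^- 2.
      by rewrite x2E; field.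
    by apply: bernstein_dilate => //; rewrite ?invr_ge0 sqr_ge0.
  have key : Num.max 1 (x ^+ 2) * (x * expR (- x ^+ 2)) <= Num.min x x^-1.
    rewrite le_min; apply/andP; split.
      rewrite mulrCA ler_piMr ?(ltW x0)// expRN ler_pdivrMr ?expR_gt0// mul1r.
      rewrite ge_max -{1}expR0 ler_expR sqr_ge0/=.
      by rewrite (le_trans _ (expR_ge1Dx _))// lerDr.
    rewrite -(@ler_pM2r _ x)// mulVf ?gt_eqF//.
    have -> : Num.max 1 (x ^+ 2) * (x * expR (- x ^+ 2)) * x =
      Num.max 1 (x ^+ 2) * x ^+ 2 * expR (- x ^+ 2) by ring.
    rewrite expRN ler_pdivrMr ?expR_gt0// mul1r.
    have [x1|x1] := leP (x ^+ 2) 1.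
      by rewrite mul1r (le_trans _ (expR_ge1Dx _))// lerDr.
    by rewrite -expr2; apply: sqr_le_exp; rewrite sqr_ge0.
  have -> : f (node k ^+ 2) / 2 * (node k / Num.sqrt pi * expR (- x ^+ 2)) =
      f (node k ^+ 2) * ((x * expR (- x ^+ 2)) * (`|z|^-1 / (2 * Num.sqrt pi))).
    by rewrite xE; field; rewrite !gt_eqF.
  apply: (@le_trans _ _ (Num.max 1 (x ^+ 2) * f (z ^- 2) *
      ((x * expR (- x ^+ 2)) * (`|z|^-1 / (2 * Num.sqrt pi))))).
    by rewrite ler_wpM2r// !mulr_ge0 ?expR_ge0 ?invr_ge0 ?mulr_ge0 ?(ltW x0) ?(ltW spi).
  have -> : Num.max 1 (x ^+ 2) * f (z ^- 2) *
      ((x * expR (- x ^+ 2)) * (`|z|^-1 / (2 * Num.sqrt pi))) =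
     `|z|^-1 * f (z ^- 2) / (2 * Num.sqrt pi) *
     (Num.max 1 (x ^+ 2) * (x * expR (- x ^+ 2))) by ring.
  by rewrite ler_wpM2l// divr_ge0 ?mulr_ge0 ?invr_ge0// ltW.
apply: le_trans (ler_sum _ (fun (i : 'I__) _ => term i)) _.
rewrite -mulr_sumr.
have zM : 0 < `|z| / 2 ^+ M by rewrite divr_gt0// exprn_gt0.
have S3 : \sum_(k < (2 * M).+1) Num.min (2 ^+ k * (`|z| / 2 ^+ M)) (2 ^+ k * (`|z| / 2 ^+ M))^-1 <= 3.
  apply: le_trans (geom _ zM) _; case: ifPn => [_|]; first by lra.
  by rewrite -ltNge => x1; rewrite ler_pdivrMr//; lra.
apply: (@le_trans _ _ (`|z|^-1 * f (z ^- 2) / (2 * Num.sqrt pi) * 3)).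
  by rewrite ler_wpM2l// divr_ge0 ?mulr_ge0 ?invr_ge0// ltW.
rewrite -mulrA ler_piMr ?mulr_ge0 ?invr_ge0//.
rewrite mulrC ler_pdivrMr ?mulr_gt0// mul1r.
suff : 3 / 2 <= Num.sqrt pi :> R by lra.
rewrite -(@ler_pXn2r _ 2)// ?nnegrE ?sqrtr_ge0 ?divr_ge0//.
rewrite sqr_sqrtr ?pi_ge0//.
have := pi_ge_9_4 R; rewrite expr2; lra.
Qed.

(** The exponent is a constant minus a positive combination of exponentials, so the function is a
    positive constant times the exponential of an element of the cone: the random variance is
    compound Poisson. *)
Lemma laplace_mixture (tau c : R) : 0 <= tau ->
  0 <= c -> laplace (fun r => expR (- (tau * mixture_exponent (c * r)))).
Proof.
move=> t0 c0.
pose S := \sum_(k < (2 * M).+1) tau * (f (node k ^+ 2) / 2).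
pose E r := \sum_(k < (2 * M).+1) tau * (f (node k ^+ 2) / 2) * expR (- ((node k ^+ 2)^-1 * r)).
apply: (@eq_laplace _ (fun r => expR (- S) * expR (E (c * r)))).
  move=> r; rewrite -expRD; congr expR; rewrite /mixture_exponent mulr_sumr /S /E.
  by rewrite -!sumrN -big_split/=; apply: eq_bigr => k _; ring.
apply: laplaceZ; first exact: expR_ge0.
apply: (@laplace_dilate _ c (fun r => expR (E r))) => //; apply: laplace_expR.
apply: (@laplace_sum _ _ _ (fun (k : 'I_(2 * M).+1) r =>
  tau * (f (node k ^+ 2) / 2) * expR (- ((node k ^+ 2)^-1 * r)))) => k.
apply: laplaceZ; first by rewrite mulr_ge0.
by apply: laplace_exp; rewrite invr_ge0 sqr_ge0.
Qed.

End dyadic_mixture.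

Section layers.
Variable R : realType.

Lemma count_le (n : nat) (y : R) : 0 <= y ->
  \sum_(i < n) (i.+1%:R <= y :> R)%:R <= y /\
  (y <= n%:R -> y <= \sum_(i < n) (i.+1%:R <= y :> R)%:R + 1).
Proof.
move=> y0; elim: n => [|n [ih1 ih2]].
  by rewrite big_ord0; split => //; rewrite add0r => /le_trans; apply.
rewrite big_ord_recr/=; have [ny|ny] := leP n.+1%:R y; last first.
  rewrite addr0; split => // _.
  have [yn|/ltW yn] := leP y n%:R; first exact: ih2.
  rewrite (le_trans (ltW ny))// -natr1 lerD2r -{1}[n]card_ord -sum1_card natr_sum.
  apply: ler_sum => i _.
  by rewrite (le_trans _ yn)// ler_nat.
have -> : \sum_(i < n) (i.+1%:R <= y :> R)%:R = n%:R :> R.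
  rewrite -[n in RHS]card_ord -sum1_card natr_sum; apply: eq_bigr => i _.
  by rewrite (le_trans _ ny)// ler_nat ltnS ltnW.
by rewrite natr1; split => // yn; rewrite (le_trans yn)// lerDl.
Qed.

(** A layer-cake average of superlevel indicators. Its weights are nonnegative with sum 1, so an
    inequality for indicators with additive error [c] passes to functions with the same [c]. *)
Definition layer (T : Type) (n : nat) (g : T -> R) (x : T) : R :=
  n.+1%:R^-1 * \sum_(i < n.+1) \1_[set x | i.+1%:R <= n.+1%:R * g x] x.

Lemma layerP (T : Type) n (g : T -> R) x : 0 <= g x <= 1 ->
  layer n g x <= g x <= layer n g x + n.+1%:R^-1.
Proof.
move=> /andP[g0 g1].
have n0 : 0 < n.+1%:R :> R by [].
have y0 : 0 <= n.+1%:R * g x by rewrite mulr_ge0.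
have [h1 h2] := count_le n.+1 y0.
have E : \sum_(i < n.+1) \1_[set x | i.+1%:R <= n.+1%:R * g x] x =
    \sum_(i < n.+1) (i.+1%:R <= n.+1%:R * g x :> R)%:R :> R.
  by apply: eq_bigr => i _; rewrite indicE; congr ((nat_of_bool _)%:R); apply/idP/idP; rewrite inE.
rewrite /layer E; apply/andP; split; first by rewrite ler_pdivrMl.
rewrite -[X in _ + X]mulr1 -mulrDr ler_pdivlMl//; apply: h2.
by rewrite ler_piMr.
Qed.

End layers.

Lemma Rintegral_sum d (T : measurableType d) (R : realType)
    (mu : {measure set T -> \bar R}) (D : set T) (I : Type) (s : seq I)
    (f : I -> T -> R) : measurable D ->
  (forall i, mu.-integrable D (EFin \o f i)) ->
  \int[mu]_(x in D) (\sum_(i <- s) f i x) = \sum_(i <- s) \int[mu]_(x in D) f i x.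
Proof.
move=> mD fi; elim: s => [|i s ih].
  rewrite big_nil; under eq_Rintegral do rewrite big_nil.
  by rewrite Rintegral_cst// mul0r.
rewrite big_cons -ih; under eq_Rintegral do rewrite big_cons.
rewrite RintegralD//.
have -> : EFin \o (fun x => \sum_(i <- s) f i x) =
    (fun x => \sum_(i <- s) (f i x)%:E)%E by apply/funext => x /=; rewrite sumEFin.
by apply: integrable_sum => // k _; exact: fi.
Qed.

Lemma integrable_bounded d (T : measurableType d) (R : realType)
    (mu : {measure set T -> \bar R}) (D : set T) (g : T -> R) (K : R) :
  measurable D -> (mu D < +oo)%E -> measurable_fun D g ->
  (forall x, `|g x| <= K) -> mu.-integrable D (EFin \o g).
Proof.
move=> mD fD mg gK; apply: measurable_bounded_integrable => //.
by exists K; split; [exact: num_real|move=> x Kx y _ /=; rewrite (le_trans (gK y))// ltW].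
Qed.

Lemma integrable_boundedM d (T : measurableType d) (R : realType)
    (mu : {measure set T -> \bar R}) (D : set T) (w g : T -> R) (K : R) :
  measurable D -> mu.-integrable D (EFin \o w) -> measurable_fun setT g ->
  (forall x, `|g x| <= K) -> mu.-integrable D (fun x => (g x * w x)%:E).
Proof.
move=> mD iw mg gK.
apply: (@le_integrable _ _ _ mu D mD _ (fun x => (K * w x)%:E)).
- apply/measurable_EFinP/measurable_funM; first exact: measurable_funTS.
  by case/integrableP : iw => /measurable_EFinP.
- move=> x _ /=; rewrite lee_fin !normrM ler_wpM2r//.
  by rewrite (le_trans (gK x))// ler_norm.
- by under eq_fun do rewrite EFinM; exact: integrableZl.
Qed.

Section from_indicators_to_functions.
Context d1 d2 d (T1 : measurableType d1) (T2 : measurableType d2)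
  (S : measurableType d) (R : realType).
Variables (m1 : {measure set T1 -> \bar R}) (m2 : {measure set T2 -> \bar R}).
Variables (D1 : set T1) (D2 : set T2) (w1 : T1 -> R) (w2 : T2 -> R).
Variables (Y1 : T1 -> S) (Y2 : T2 -> S) (c : R).
Hypotheses (mD1 : measurable D1) (mD2 : measurable D2).
Hypotheses (mY1 : measurable_fun setT Y1) (mY2 : measurable_fun setT Y2).
Hypotheses (iw1 : m1.-integrable D1 (EFin \o w1)) (iw2 : m2.-integrable D2 (EFin \o w2)).
Hypothesis H : forall B, measurable B ->
  \int[m1]_(x in D1) (\1_B (Y1 x) * w1 x) <= \int[m2]_(x in D2) (\1_B (Y2 x) * w2 x) + c.

Let Rint_layer_near d' (T : measurableType d') (m : {measure set T -> \bar R}) D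
    (w : T -> R) (Y : T -> S) (u : S -> R) n :
  measurable D -> measurable_fun setT Y -> m.-integrable D (EFin \o w) ->
  measurable_fun setT u -> (forall z, 0 <= u z <= 1) ->
  `|\int[m]_(x in D) (u (Y x) * w x) - \int[m]_(x in D) (layer n u (Y x) * w x)| <=
  n.+1%:R^-1 * \int[m]_(x in D) `|w x| /\
  \int[m]_(x in D) (layer n u (Y x) * w x) =
   n.+1%:R^-1 * \sum_(i < n.+1) \int[m]_(x in D)
     (\1_[set z | i.+1%:R <= n.+1%:R * u z] (Y x) * w x).
Proof.
move=> mD mY iw mu u01.
pose B (i : 'I_n.+1) : set S := [set z | i.+1%:R <= n.+1%:R * u z].
have mB i : measurable (B i).
  rewrite [X in measurable X](_ : _ = (fun z => n.+1%:R * u z) @^-1` `[i.+1%:R, +oo[); last first.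
    by apply/seteqP; split => z /=; rewrite in_itv/= andbT.
  by rewrite -[X in measurable X]setTI; apply: measurable_funM.
have m1B i : measurable_fun setT (\1_(B i) : S -> R) by exact: measurable_indic.
have ml : measurable_fun setT (layer n u).
  by apply: measurable_funM => //; apply: measurable_sum => i; exact: m1B.
have i1 i : m.-integrable D (fun x => (\1_(B i) (Y x) * w x)%:E).
  apply: (@integrable_boundedM _ _ _ _ _ _ (fun x => \1_(B i) (Y x)) 1) => //.
    exact: (measurableT_comp (m1B i)).
  by move=> x; rewrite indicE ger0_norm//; case: (_ \in _).
have l01 z : 0 <= layer n u z <= 1.
  have /andP[h1 h2] := layerP n (u01 z); have /andP[_ h] := u01 z.
  by rewrite (le_trans h1)// andbT /layer mulr_ge0 ?invr_ge0// sumr_ge0.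
have iu : m.-integrable D (fun x => (u (Y x) * w x)%:E).
  apply: (@integrable_boundedM _ _ _ _ _ _ (fun x => u (Y x)) 1) => //.
    exact: measurableT_comp.
  by move=> x; have /andP[? ?] := u01 (Y x); rewrite ger0_norm.
have il : m.-integrable D (fun x => (layer n u (Y x) * w x)%:E).
  apply: (@integrable_boundedM _ _ _ _ _ _ (fun x => layer n u (Y x)) 1) => //.
    exact: (measurableT_comp ml).
  by move=> x; have /andP[? ?] := l01 (Y x); rewrite ger0_norm.
have iaw : m.-integrable D (EFin \o (fun x => `|w x|)) by exact: integrable_norm.
split.
  rewrite -RintegralB// -RintegralZl//.
  have iB : m.-integrable D (EFin \o (fun x => u (Y x) * w x - layer n u (Y x) * w x)).
    by rewrite /comp; under eq_fun do rewrite EFinB; exact: integrableB.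
  apply: (le_trans (le_normr_Rintegral mD iB)).
  apply: le_Rintegral => //; first exact: integrable_norm.
    by rewrite /comp; under eq_fun do rewrite EFinM; exact: integrableZl.
  move=> x _; rewrite -mulrBl normrM ler_wpM2r//.
  have /andP[h1 h2] := layerP n (u01 (Y x)).
  by rewrite ger0_norm ?subr_ge0// lerBlDl.
rewrite -Rintegral_sum// -RintegralZl//.
  by apply: eq_Rintegral => x _; rewrite /layer -mulrA mulr_suml.
have -> : EFin \o (fun x => \sum_(i < n.+1) \1_(B i) (Y x) * w x) =
    (fun x => \sum_(i < n.+1) (\1_(B i) (Y x) * w x)%:E)%E.
  by apply/funext => x /=; rewrite sumEFin.
by apply: integrable_sum => // k _; exact: i1.
Qed.

(** Replacing [u] by its layers costs [1 / n.+1] times the L^1 norms of the weights. Used with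
    [c = 0] to compare measures or laws, and with [c > 0] for total variation. *)
Lemma le_Rintegral_from_indic (u : S -> R) :
  measurable_fun setT u -> (forall z, 0 <= u z <= 1) ->
  \int[m1]_(x in D1) (u (Y1 x) * w1 x) <= \int[m2]_(x in D2) (u (Y2 x) * w2 x) + c.
Proof.
move=> mu u01.
set A1 := \int[m1]_(x in D1) _; set A2 := \int[m2]_(x in D2) _.
pose J := \int[m1]_(x in D1) `|w1 x| + \int[m2]_(x in D2) `|w2 x|.
have key n : A1 <= A2 + c + n.+1%:R^-1 * J.
  have [h1 e1] := Rint_layer_near n mD1 mY1 iw1 mu u01.
  have [h2 e2] := Rint_layer_near n mD2 mY2 iw2 mu u01.
  have h : \int[m1]_(x in D1) (layer n u (Y1 x) * w1 x) <=
      \int[m2]_(x in D2) (layer n u (Y2 x) * w2 x) + c.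
    rewrite e1 e2 -[c](@mulKf _ n.+1%:R)// -mulrDr ler_wpM2l ?invr_ge0//.
    have -> : n.+1%:R * c = \sum_(i < n.+1) c.
      by rewrite sumr_const card_ord mulr_natl.
    rewrite -big_split/=; apply: ler_sum => i _; apply: H.
    rewrite [X in measurable X](_ : _ = (fun z => n.+1%:R * u z) @^-1` `[i.+1%:R, +oo[); last first.
      by apply/seteqP; split => z /=; rewrite in_itv/= andbT.
    by rewrite -[X in measurable X]setTI; apply: measurable_funM.
  move: h1 h2; rewrite -/A1 -/A2 !ler_norml => /andP[_ k1] /andP[k2 _].
  rewrite /J mulrDr; move: k1 k2 h.
  set a1 := _^-1 * _; set a2 := _^-1 * _. lra.
have cv : A2 + c + n.+1%:R^-1 * J @[n --> \oo] --> A2 + c + 0 * J.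
  apply: cvgD; first exact: cvg_cst.
  by apply: cvgM; [exact: cvg_harmonic|exact: cvg_cst].
rewrite mul0r addr0 in cv; rewrite -(cvg_lim _ cv)//; apply: limr_ge.
  by apply/cvg_ex; eexists; exact: cv.
exact: nearW.
Qed.

End from_indicators_to_functions.

(** * Splitting the Gaussian mixture off a Levy measure *)

Section levy_measures.
Variable R : realType.
Let mu := @lebesgue_measure R.

Lemma continuous_cosM (h : R) : continuous (fun y : R => cos (h * y)).
Proof. by move=> y; apply: continuous_comp; [exact: mulrl_continuous|exact: continuous_cos]. Qed.

Lemma continuous_sinM (h : R) : continuous (fun y : R => sin (h * y)).
Proof. by move=> y; apply: continuous_comp; [exact: mulrl_continuous|exact: continuous_sin]. Qed.

Lemma measurable_ev (p : seq (R[i] * R)) : measurable_fun setT (ev p).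
Proof.
elim: p => [|t p ih].
  rewrite (_ : ev [::] = cst 0)//.
  by apply/funext => x; rewrite /ev /pairing big_nil.
rewrite (_ : ev (t :: p) = fun y =>
  complex.Re t.1 * cos (t.2 * y) - complex.Im t.1 * sin (t.2 * y) + ev p y); last first.
  by apply/funext => x; rewrite /ev /pairing big_cons Re_mulc.
apply: measurable_funD => //; apply: measurable_funB; apply: measurable_funM => //.
  by apply: continuous_measurable_fun; exact: continuous_cosM.
by apply: continuous_measurable_fun; exact: continuous_sinM.
Qed.

Lemma ev_bounded (p : seq (R[i] * R)) : exists2 K : R, 0 < K & forall x, `|ev p x| <= K.
Proof.
elim: p => [|t p [K K0 ih]].
  by exists 1 => // x; rewrite /ev /pairing big_nil normr0.
exists (norm1 t.1 + K); first by rewrite ltr_wpDl// norm1_ge0.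
move=> x; rewrite /ev /pairing big_cons Re_mulc (le_trans (ler_normD _ _))// lerD//; last exact: ih.
apply: (le_trans (ler_normB _ _)); rewrite /norm1 !normrM; apply: lerD; rewrite ler_piMr// ler_norml.
  by rewrite cos_geN1 cos_le1.
by rewrite sin_geN1 sin_le1.
Qed.

Definition punctured (n : nat) : set (measurableTypeR R) := [set z | n.+1%:R^-1 < `|z|].

Lemma open_punctured n : open (punctured n : set R).
Proof.
rewrite (_ : punctured n = Num.norm @^-1` `]n.+1%:R^-1, +oo[%classic); last first.
  by apply/seteqP; split => z /=; rewrite in_itv/= andbT.
by apply: open_comp; [move=> z _; exact: norm_continuous|exact: interval_open].
Qed.

Lemma measurable_punctured n : measurable (punctured n).
Proof. by apply: open_measurable; exact: open_punctured. Qed.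

Lemma cvg_Rintegral_punctured (m : {measure set (measurableTypeR R) -> \bar R}) (g : R -> R) :
  m.-integrable setT (EFin \o g) -> g 0 = 0 ->
  \int[m]_(z in punctured n) g z @[n --> \oo] --> \int[m]_z g z.
Proof.
move=> ig g0.
pose f_ n z := (g z * \1_(punctured n) z)%:E.
have mg : measurable_fun setT g by case/integrableP : ig => /measurable_EFinP.
have mf n : measurable_fun setT (f_ n).
  apply/measurable_EFinP/measurable_funM => //.
  exact: (measurable_indic (measurable_punctured n)).
have fle n z : (`|f_ n z| <= `|(g z)%:E|)%E.
  rewrite /f_ indicE lee_fin normrM ler_piMr//.
  by case: (_ \in _); rewrite /= ?normr1 ?normr0.
have ifn n : m.-integrable setT (f_ n).
  by apply: le_integrable ig; [|exact: mf|move=> z _; exact: fle].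
have fE n : (\int[m]_z f_ n z = \int[m]_(z in punctured n) (g z)%:E)%E.
  rewrite [in RHS]integral_mkcond; apply: eq_integral => z _; rewrite /f_ patchE indicE.
  by case: (z \in punctured n); rewrite ?mulr1 ?mulr0.
have [|||||_ _ H] := @dominated_convergence _ _ R m setT measurableT
  f_ (EFin \o g) (abse \o (EFin \o g)).
- by [].
- exact/measurable_EFinP.
- apply: aeW => z _; apply: cvg_near_cst.
  have [->|z0] := eqVneq z 0; first by apply: nearW => n; rewrite /f_ /= g0 mul0r.
  near=> n; rewrite /f_ indicE mem_set/= ?mulr1//.
  rewrite /punctured/= invf_plt ?posrE// ?normr_gt0//.
  rewrite (lt_le_trans (archi_boundP _))// ?invr_ge0// ler_nat leqW//.
  by near: n; exact: nbhs_infty_ge.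
- exact: integrable_abse.
- by apply: aeW => z n _; exact: fle.
have fin : (\int[m]_z (EFin \o g) z)%E \is a fin_num by exact: integrable_fin_num.
rewrite /Rintegral; apply: fine_cvg; rewrite fineK//.
apply: cvg_trans H; apply: near_eq_cvg; apply: nearW => n.
exact: fE.
Unshelve. all: end_near. Qed.

Variables (nu : {measure set (measurableTypeR R) -> \bar R}).
Hypothesis lnu : levy_measure nu.

Let m1 (z : R) : R := Num.min 1 (z ^+ 2).

Let m1_ge0 z : 0 <= m1 z. Proof. by rewrite le_min ler01 sqr_ge0. Qed.

Let measurable_m1 : measurable_fun setT m1.
Proof. by apply: measurable_minr => //; exact: measurable_funX. Qed.

Let im1 : nu.-integrable setT (EFin \o m1).
Proof.
apply/integrableP; split; first exact/measurable_EFinP.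
under eq_integral do rewrite /= ger0_norm//.
by have [] := lnu.
Qed.

Lemma levy_integrable (g : R -> R) (K : R) : measurable_fun setT g ->
  (forall z, `|g z| <= K * Num.min 1 (z ^+ 2)) -> nu.-integrable setT (EFin \o g).
Proof.
move=> mg gK; apply: (@le_integrable _ _ _ nu setT _ _ (fun z => (K * m1 z)%:E)) => //.
- exact/measurable_EFinP.
- by move=> z _; rewrite lee_fin (le_trans (gK z))// ler_norm.
- by under eq_fun do rewrite EFinM; exact: integrableZl.
Qed.

Lemma levy_punctured_fin n : (nu (punctured n) < +oo)%E.
Proof.
have [_ fin] := lnu.
have c0 : 0 < n.+1%:R^-1 ^+ 2 :> R by rewrite exprn_gt0.
have : ((n.+1%:R^-1 ^+ 2)%:E * nu (punctured n) <= \int[nu]_z (m1 z)%:E)%E.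
  rewrite -integral_cst//; last exact: measurable_punctured.
  apply: (@le_trans _ _ (\int[nu]_(z in punctured n) (m1 z)%:E)%E).
    apply: ge0_le_integral => //.
    - exact: measurable_punctured.
    - by move=> z _; rewrite lee_fin ltW.
    - exact/measurable_EFinP/measurable_funTS.
    - move=> z /= zn; rewrite lee_fin le_min; apply/andP; split.
        by rewrite exprn_ile1// invf_le1// ler1n.
      by rewrite -[leRHS]real_normK ?num_real// lerXn2r ?nnegrE// ltW.
  apply: ge0_subset_integral => //.
  - exact: measurable_punctured.
  - exact/measurable_EFinP.
  - by move=> z _; rewrite lee_fin.
move=> /le_lt_trans => /(_ _ fin).
have [->|] := eqVneq (nu (punctured n)) +oo%E; last by rewrite -ltey.
by rewrite gt0_muley ?lte_fin.
Qed.

Variables (f : R -> R) (M : nat).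
Hypothesis bf : bernstein f.
Hypothesis f0 : f 0 = 0.
Hypothesis fnu : forall (B : set (measurableTypeR R)), measurable B ->
  (\int[lebesgue_measure]_(z in B) (`|z|^-1 * f (z ^- 2))%:E <= nu B)%E.

Let j := mixture_density f M.

Let sk_gt0 k : 0 < (node R M k * Num.sqrt 2)^-1.
Proof. by rewrite invr_gt0 mulr_gt0 ?node_gt0// sqrtr_gt0. Qed.

Let fk k : 0 <= f (node R M k ^+ 2) / 2.
Proof. by rewrite divr_ge0// (bernstein_ge0 bf)// sqr_ge0. Qed.

Let j_ge0 z : 0 <= j z.
Proof. by apply: sumr_ge0 => k _; rewrite mulr_ge0// normal_pdf_ge0. Qed.

Let mj : measurable_fun setT j.
Proof.
by apply: measurable_sum => k; apply: measurable_funM => //; exact: measurable_normal_pdf.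
Qed.

Let jM (g : R -> R) : measurable_fun setT g -> (forall z, `|g z| <= 1) ->
  mu.-integrable setT (fun z => (g z * j z)%:E) /\
  \int[mu]_z (g z * j z) = \sum_(k < (2 * M).+1) f (node R M k ^+ 2) / 2 *
    \int[mu]_z (g z * normal_pdf 0 (node R M k * Num.sqrt 2)^-1 z).
Proof.
move=> mg g1.
have i1 (k : 'I_(2 * M).+1) : mu.-integrable setT (fun z => (g z *
    normal_pdf 0 (node R M k * Num.sqrt 2)^-1 z)%:E).
  exact: (@integrable_mul_normal _ _ _ _ 1).
have i2 (k : 'I_(2 * M).+1) : mu.-integrable setT (EFin \o (fun z => f (node R M k ^+ 2) / 2 * (g z *
    normal_pdf 0 (node R M k * Num.sqrt 2)^-1 z))).
  by rewrite /comp; under eq_fun do rewrite EFinM; exact: integrableZl.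
have e z : g z * j z = \sum_(k < (2 * M).+1) f (node R M k ^+ 2) / 2 * (g z *
    normal_pdf 0 (node R M k * Num.sqrt 2)^-1 z).
  by rewrite /j /mixture_density mulr_sumr; apply: eq_bigr => k _; rewrite mulrCA.
split.
  under eq_fun do rewrite e -sumEFin.
  by apply: integrable_sum => // k _; exact: i2.
under eq_Rintegral do rewrite e.
by rewrite Rintegral_sum//; apply: eq_bigr => k _; rewrite RintegralZl//; exact: i1.
Qed.

Let cos1 (x : R) : `|cos x| <= 1.
Proof. by rewrite ler_norml cos_geN1 cos_le1. Qed.

Let sin1 (x : R) : `|sin x| <= 1.
Proof. by rewrite ler_norml sin_geN1 sin_le1. Qed.

Let mcos h : measurable_fun setT (fun y : R => cos (h * y)).
Proof. by apply: continuous_measurable_fun; exact: continuous_cosM. Qed.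

Let msin h : measurable_fun setT (fun y : R => sin (h * y)).
Proof. by apply: continuous_measurable_fun; exact: continuous_sinM. Qed.

Let ijcos h : mu.-integrable setT (fun z => (cos (h * z) * j z)%:E).
Proof. by have [] := jM (mcos h) (fun z => cos1 _). Qed.

Let ijsin h : mu.-integrable setT (fun z => (sin (h * z) * j z)%:E).
Proof. by have [] := jM (msin h) (fun z => sin1 _). Qed.

Let normr_cst1 (z : R) : `|(cst 1 z : R)| <= 1.
Proof. by rewrite normr1. Qed.

Let jM1 := @jM (cst 1) (measurable_cst _) normr_cst1.

Let ij : mu.-integrable setT (EFin \o j).
Proof. by have [+ _] := jM1; under eq_fun do rewrite mul1r. Qed.

Let int_jsin h : \int[mu]_z (sin (h * z) * j z) = 0.
Proof.
have [_ ->] := jM (msin h) (fun z => sin1 _).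
by rewrite big1// => k _; rewrite normal_sin// mulr0 sin0 !mulr0.
Qed.

Let int_jcos h : \int[mu]_z ((1 - cos (h * z)) * j z) = mixture_exponent f M (h ^+ 2 / 4).
Proof.
under eq_Rintegral do rewrite mulrBl.
have [i1 e1] := jM1.
rewrite RintegralB//; last exact: ijcos.
have [_ ->] := jM (mcos h) (fun z => cos1 _).
rewrite e1 -sumrB; apply: eq_bigr => k _; rewrite -mulrBr; congr (_ * _).
rewrite normal_cos// mulr0 cos0 mulr1 RintegralZl//; last exact: integrable_normal_pdf.
rewrite /Rintegral integral_normal_pdf/= mul1r; congr (1 - expR (- _)).
have nk : node R M k != 0 by rewrite gt_eqF// node_gt0.
by rewrite exprVn exprMn sqr_sqrtr//; field.
Qed.

Let mD n := measurable_punctured n.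

Let jD n : mu.-integrable (punctured n) (EFin \o j).
Proof. exact: (integrableS measurableT). Qed.

Let j_le_nu n (B : set (measurableTypeR R)) : measurable B -> B `<=` punctured n ->
  (\int[mu]_(z in B) (j z)%:E <= nu B)%E.
Proof.
move=> mB Bn; apply: le_trans (fnu mB).
have Bz z : B z -> z != 0.
  by move=> /Bn; rewrite /punctured/= => zn; apply: contraTneq zn => ->; rewrite normr0 -leNgt invr_ge0.
apply: ge0_le_integral => //.
- by move=> z _; rewrite lee_fin.
- exact/measurable_EFinP/measurable_funTS.
- apply/measurable_EFinP; apply: (measurable_funS (mD n) Bn).
  apply: open_continuous_measurable_fun; first exact: open_punctured.
  move=> z; rewrite inE /= => zn.
  have z0 : z != 0 by apply: contraTneq zn => ->; rewrite normr0 -leNgt invr_ge0.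
  apply: cvgM.
    by apply: cvgV; [rewrite normr_eq0|exact: norm_continuous].
  have z2 : 0 < z ^- 2 by rewrite invr_gt0 exprn_even_gt0.
  apply: (@cvg_comp _ _ _ (fun z => z ^- 2) f _ (nbhs (z ^- 2))).
    by apply: cvgV; [rewrite expf_neq0|exact: exprn_continuous].
  have : {for z ^- 2, continuous f}.
    apply/differentiable_continuous/derivable1_diffP.
    by have [_ _ d _] := bf; exact: (d 0%N).
  exact.
- by move=> z Bzz; rewrite lee_fin; apply: mixture_density_le => //; exact: Bz.
Qed.

Let nu1 n : nu.-integrable (punctured n) (EFin \o cst 1).
Proof. by apply: (@integrable_bounded _ _ _ _ _ _ 1) => //; exact: levy_punctured_fin. Qed.

Let compare n (u : R -> R) : measurable_fun setT u -> (forall z, 0 <= u z <= 1) ->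
  \int[mu]_(z in punctured n) (u z * j z) <= \int[nu]_(z in punctured n) (u z * 1).
Proof.
move=> mU u01.
have H B : measurable B -> \int[mu]_(z in punctured n) (\1_B z * j z) <=
    \int[nu]_(z in punctured n) (\1_B z * 1) + 0.
  move=> mB; rewrite addr0.
  have B1 (z : R) : `|(\1_B z : R)| <= 1.
    by rewrite indicE; case: (_ \in _); rewrite ?normr1 ?normr0.
  have mB1 : measurable_fun setT (\1_B : R -> R) by exact: measurable_indic.
  have iB := integrable_boundedM (mD n) (jD n) mB1 B1.
  have iB' := integrable_boundedM (mD n) (nu1 n) mB1 B1.
  rewrite /Rintegral fine_le//.
  - exact (integrable_fin_num (mD n) iB).
  - exact (integrable_fin_num (mD n) iB').
  - under [X in (_ <= X)%E]eq_integral do rewrite mulr1.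
    rewrite integral_indic// [X in (X <= _)%E](_ : _ = \int[mu]_(z in B `&` punctured n) (j z)%:E)%E.
      by apply: (@j_le_nu n); [exact: measurableI|exact: subIsetr].
    rewrite [RHS]integral_mkcondl; apply: eq_integral => z _.
    by rewrite patchE indicE; case: (z \in B); rewrite ?mul1r ?mul0r.
have := le_Rintegral_from_indic (mD n) (mD n) (@measurable_id _ _ setT)
  (@measurable_id _ _ setT) (jD n) (nu1 n) H mU u01.
by rewrite addr0.
Qed.

(** Fourier transform of [nu - j dz] restricted to [punctured n]. That measure is nonnegative
    because [j] lies below the assumed lower density of [nu], and finite because a neighbourhood of
    0 is removed. *)
Definition truncated_exponent n (h : R) : R[i] :=
  Complex (\int[nu]_(z in punctured n) (cos (h * z) * 1))
          (\int[nu]_(z in punctured n) (sin (h * z) * 1)) +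
  rc (-1) * Complex (\int[mu]_(z in punctured n) (cos (h * z) * j z))
          (\int[mu]_(z in punctured n) (sin (h * z) * j z)).

Lemma pos_type_truncated_exponent n : pos_type (truncated_exponent n).
Proof.
move=> p p0; rewrite pairingD pairingZ.
have inu (g : R -> R) : measurable_fun setT g -> (forall z, `|g z| <= 1) ->
    nu.-integrable (punctured n) (fun z => (g z * 1)%:E).
  by move=> mg g1; exact (integrable_boundedM (mD n) (nu1 n) mg g1).
have icn h := inu _ (mcos h) (fun z => cos1 _).
have isn h := inu _ (msin h) (fun z => sin1 _).
have icj h : mu.-integrable (punctured n) (fun z => (cos (h * z) * j z)%:E).
  exact: (integrableS measurableT).
have isj h : mu.-integrable (punctured n) (fun z => (sin (h * z) * j z)%:E).
  exact: (integrableS measurableT).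
rewrite (pairing_integral (mD n) icn isn) (pairing_integral (mD n) icj isj).
rewrite mulN1r subr_ge0.
have [K K0 pK] := ev_bounded p.
have u01 z : 0 <= K^-1 * ev p z <= 1.
  apply/andP; split; first by rewrite mulr_ge0// invr_ge0 ltW.
  by rewrite ler_pdivrMl// mulr1 (le_trans _ (pK z))// ler_norm.
have mU : measurable_fun setT (fun z => K^-1 * ev p z).
  by apply: measurable_funM => //; exact: measurable_ev.
have := compare n mU u01.
under eq_Rintegral do rewrite -mulrA.
under [X in _ <= X]eq_Rintegral do rewrite -mulrA.
rewrite !RintegralZl//; last 2 first.
  exact: (integrable_ev (mD n) icn isn).
  exact: (integrable_ev (mD n) icj isj).
by rewrite ler_pM2l// invr_gt0.
Qed.

Let int_nu_fun (g : R -> R) n : measurable_fun setT g -> (forall z, `|g z| <= 1) ->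
  nu.-integrable (punctured n) (EFin \o g).
Proof.
by move=> mg g1; apply: (integrable_bounded (mD n) (levy_punctured_fin n) (measurable_funTS mg) g1).
Qed.

Let small (z : R) : R := z * (`|z| <= 1)%R%:R.

Let normr_small z : `|small z| <= 1.
Proof.
rewrite /small; case: (leP `|z| 1) => h; first by rewrite mulr1.
by rewrite mulr0 normr0.
Qed.

Let m_small : measurable_fun setT small.
Proof.
apply: measurable_funM => //.
rewrite (_ : (fun z : R => _) = \1_`[-1, 1]); last first.
  apply/funext => z; rewrite indicE; congr ((nat_of_bool _)%:R).
  by apply/idP/idP; rewrite inE/= in_itv/= ler_norml.
by apply: measurable_indic; exact: measurable_itv.
Qed.

Let ilevy_cos h : nu.-integrable setT (EFin \o (fun z => 1 - cos (h * z))).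
Proof.
apply: (@levy_integrable _ (2 + h ^+ 2 / 2)).
  by apply: measurable_funB.
move=> z; rewrite ger0_norm ?one_sub_cos_ge0//.
have h0 : 0 <= h ^+ 2 / 2 by rewrite divr_ge0// sqr_ge0.
rewrite minEle; case: ifPn => _.
  by rewrite mulr1 (le_trans (one_sub_cos_le2 _))// lerDl.
rewrite (le_trans (one_sub_cos_le _))// exprMn mulrAC ler_wpM2r ?sqr_ge0//.
by rewrite lerDr.
Qed.

Let ilevy_sin h : nu.-integrable setT (EFin \o (fun z => h * z * (`|z| <= 1)%R%:R - sin (h * z))).
Proof.
apply: (@levy_integrable _ (1 + `|h| ^+ 3 / 2)).
  apply: measurable_funB => //.
  by under eq_fun do rewrite -mulrA; apply: measurable_funM.
move=> z; have h0 : 0 <= `|h| ^+ 3 / 2 by rewrite divr_ge0// exprn_ge0.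
have [z1|z1] := leP `|z| 1; last first.
  rewrite mulr0 sub0r normrN min_l; last first.
    by rewrite -real_normK ?num_real// expr_ge1// ltW.
  by rewrite mulr1 (le_trans (sin1 _))// lerDl.
rewrite mulr1 min_r; last by rewrite -real_normK ?num_real// expr_le1.
rewrite (le_trans (normr_sub_sin_le _))// normrM exprMn mulrAC -(@real_normK _ z) ?num_real//.
apply: (@le_trans _ _ (`|h| ^+ 3 / 2 * `|z| ^+ 2)).
  by rewrite ler_wpM2l// exprS ler_piMl// exprn_ge0.
by rewrite ler_wpM2r ?exprn_ge0// lerDr.
Qed.

(** Formally this is the transform of an infinitely divisible law of Levy measure [tau (nu - j dz)].
    It is reached as a limit of translated compound Poisson laws with jumps in [punctured n]. *)
Lemma pos_type_levy (tau : R) : 0 <= tau ->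
  pos_type (fun h => cexp (- (rc tau * levy_exponent nu h)) *
    rc (expR (tau * mixture_exponent f M (h ^+ 2 / 4)))).
Proof.
move=> tau0.
(* [c_ n] is the mass of the truncated measure and normalizes the exponential; [b_ n] is the
   compensating drift of the jumps of size at most 1. The symmetric [j] needs no drift. *)
pose c_ n := complex.Re (truncated_exponent n 0).
pose b_ n := \int[nu]_(z in punctured n) small z.
pose W n h := cexp (rc tau * truncated_exponent n h) * (rc (expR (- (tau * c_ n))) *
  chr (- (tau * b_ n)) h).
apply: (@pos_type_cvg _ W).
  move=> n; apply: pos_typeM.
    by apply: pos_type_cexp; apply: pos_typeZ => //; exact: pos_type_truncated_exponent.
  by apply: pos_typeZ; [exact: expR_ge0|exact: pos_type_chr].
move=> h.
pose E n := Complex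
  (- tau * \int[nu]_(z in punctured n) (1 - cos (h * z)) +
    tau * \int[mu]_(z in punctured n) ((1 - cos (h * z)) * j z))
  (- tau * \int[nu]_(z in punctured n) (h * z * (`|z| <= 1)%R%:R - sin (h * z)) -
    tau * \int[mu]_(z in punctured n) (sin (h * z) * j z)).
have WE n : W n h = cexp (E n).
  have -> : W n h = cexp (rc tau * truncated_exponent n h +
      (rc (- (tau * c_ n)) + Complex 0 (h * - (tau * b_ n)))).
    rewrite /W !cexpD cexp_rc; congr (_ * (_ * _)).
    by rewrite /chr /cis /cexp/= expR0 !mul1r.
  have in1 : nu.-integrable (punctured n) (EFin \o (fun z => 1 - cos (h * z))).
    exact: (integrableS measurableT).
  have in2 : nu.-integrable (punctured n) (EFin \o (fun z => cos (h * z))).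
    by apply: int_nu_fun => // z.
  have in3 : nu.-integrable (punctured n) (EFin \o (fun z => sin (h * z))).
    by apply: int_nu_fun => // z.
  have in4 : nu.-integrable (punctured n) (EFin \o small) by exact: int_nu_fun.
  have in5 : nu.-integrable (punctured n) (EFin \o (fun z => h * small z)).
    by rewrite /comp; under eq_fun do rewrite EFinM; exact: integrableZl.
  have ic := integrableS measurableT (mD n) (@subsetT _ _) (ijcos h).
  have cE : c_ n = \int[nu]_(z in punctured n) 1 - \int[mu]_(z in punctured n) j z.
    rewrite /c_ /truncated_exponent Re_addc Re_rcM/= mulN1r; congr (_ - _).
      by apply: eq_Rintegral => z _; rewrite mul0r cos0 mulr1.
    by apply: eq_Rintegral => z _; rewrite mul0r cos0 mul1r.
  have mul1E (g : R -> R) : \int[nu]_(z in punctured n) (g z * 1) =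
      \int[nu]_(z in punctured n) g z.
    by apply: eq_Rintegral => z _; rewrite mulr1.
  congr cexp; apply: eq_ReIm.
    rewrite !Re_addc Re_rcM /truncated_exponent Re_addc Re_rcM/= cE.
    rewrite (RintegralB (mD n) (nu1 n) in2).
    have -> : \int[mu]_(z in punctured n) ((1 - cos (h * z)) * j z) =
        \int[mu]_(z in punctured n) j z - \int[mu]_(z in punctured n) (cos (h * z) * j z).
      under eq_Rintegral do rewrite mulrBl mul1r.
      by rewrite (RintegralB (mD n) (jD n) ic).
    by rewrite mul1E; ring.
  rewrite !Im_addc Im_rcM /truncated_exponent Im_addc Im_rcM/= add0r.
  have -> : \int[nu]_(z in punctured n) (h * z * (`|z| <= 1)%R%:R - sin (h * z)) =
      h * b_ n - \int[nu]_(z in punctured n) sin (h * z).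
    under eq_Rintegral do rewrite -mulrA.
    by rewrite (RintegralB (mD n) in5 in3) (RintegralZl _ (mD n) in4).
  by rewrite mul1E; ring.
have EP : ccvg E (- (rc tau * levy_exponent nu h) +
    rc (tau * mixture_exponent f M (h ^+ 2 / 4))).
  split.
    rewrite Re_addc Re_oppc Re_rcM/= -int_jcos -mulNr.
    apply: cvgD; apply: cvgM; try exact: cvg_cst.
      by apply: cvg_Rintegral_punctured => //; rewrite mulr0 cos0 subrr.
    apply: cvg_Rintegral_punctured; last by rewrite mulr0 cos0 subrr mul0r.
    rewrite /comp; under eq_fun do rewrite mulrBl mul1r EFinB.
    by apply: integrableB => //; exact: ijcos.
  rewrite Im_addc Im_oppc Im_rcM/= -mulNr -[X in _ + X]oppr0 -(mulr0 tau) -(int_jsin h).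
  apply: cvgB; apply: cvgM; try exact: cvg_cst.
    by apply: cvg_Rintegral_punctured => //; rewrite !mulr0 mul0r sin0 subrr.
  by apply: cvg_Rintegral_punctured; [exact: ijsin|rewrite mulr0 sin0 mul0r].
rewrite -cexp_rc -cexpD; under [fun n => W n h]eq_fun do rewrite WE.
by case: EP => e1 e2; split; apply: cvgM;
  first [exact: (continuous_cvg _ (@continuous_expR _ _) e1)
        |exact: (continuous_cvg _ (@continuous_cos _ _) e2)
        |exact: (continuous_cvg _ (@continuous_sin _ _) e2)].
Qed.

End levy_measures.

(** * From the discretized defect to the integral *)

Section riemann_sum_of_exponential.
Variables (R : realType) (f : R -> R) (c b I : R).
Hypothesis bf : bernstein f.
Hypothesis f_log : f r / ln (1 + r) @[r --> +oo] --> +oo.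
Hypotheses (c0 : 0 < c) (b0 : 0 <= b).
Let E r := expR (- (c * f r)).
Hypothesis int_E : (\int[lebesgue_measure]_(r in `[0%R, +oo[) (E r)%:E = I%:E)%E.

Let E_ge0 r : 0 <= E r. Proof. exact: expR_ge0. Qed.

Let E_le1 r : 0 <= r -> E r <= 1.
Proof.
move=> r0; rewrite -expR0 ler_expR oppr_le0 mulr_ge0//; first exact: ltW.
exact: (bernstein_ge0 bf).
Qed.

Let E_anti r s : 0 <= r -> r <= s -> E s <= E r.
Proof. by move=> r0 rs; rewrite ler_expR lerN2 ler_pM2l// (bernstein_le bf). Qed.

Let mE : measurable_fun (`[0, +oo[%classic : set R) E.
Proof.
rewrite (_ : E = expR \o (fun r => - c * f r)); last first.
  by apply/funext => r /=; rewrite mulNr.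
apply: measurableT_comp => //; apply: measurable_funM => //.
have [_ cf _ _] := bf.
by apply: subspace_continuous_measurable_fun => //; exact: measurable_itv.
Qed.

Let sum_le (d : R) M : 0 < d ->
  ((d * \sum_(j < M) E (j.+1%:R * d))%:E <=
   \int[lebesgue_measure]_(r in `[0%R, (M%:R * d)%R[) (E r)%:E)%E.
Proof.
move=> d0; elim: M => [|M ih].
  by rewrite big_ord0 mulr0 integral_ge0// => r _; rewrite lee_fin.
have Md0 : 0 <= M%:R * d by rewrite mulr_ge0// ltW.
have -> : `[0%R, (M.+1%:R * d)%R[%classic =
    `[0%R, (M%:R * d)%R[%classic `|` `[(M%:R * d)%R, (M.+1%:R * d)%R[%classic.
  apply/seteqP; split => r /=; rewrite !in_itv/=.
    by move=> /andP[-> ->]; case: (ltP r (M%:R * d)) => h; [left|right].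
  rewrite -natr1 mulrDl mul1r; move=> [|] /andP[h1 h2]; apply/andP; split; lra.
rewrite ge0_integral_setU//=; last 3 first.
- apply/measurable_EFinP; apply: measurable_funS mE => //.
  by move=> r /=; rewrite !in_itv/= => -[|] /andP[h1 h2]; rewrite andbT//; lra.
- by move=> r _; rewrite lee_fin.
- apply/eqP; rewrite -subset0 => r [] /=; rewrite !in_itv/= => /andP[_ h1] /andP[h2 _].
  by move: (lt_le_trans h1 h2); rewrite ltxx.
rewrite big_ord_recr/= mulrDr EFinD; apply: leeD => //.
apply: (@le_trans _ _ (\int[lebesgue_measure]_(r in `[(M%:R * d)%R, (M.+1%:R * d)%R[) (E (M.+1%:R * d))%:E)%E).
  rewrite integral_cst//= lebesgue_measure_itv/= lte_fin ltr_pM2r// ltr_nat ltnSn.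
  by rewrite -EFinB -EFinM lee_fin -natr1 mulrDl mul1r addrAC subrr add0r mulrC.
apply: ge0_le_integral => //.
- by move=> r _; rewrite lee_fin.
- apply/measurable_EFinP; apply: measurable_funS mE => //.
  by move=> r /=; rewrite !in_itv/= => /andP[h1 h2]; rewrite andbT; lra.
- move=> r /=; rewrite in_itv/= => /andP[h1 h2]; rewrite lee_fin; apply: E_anti; lra.
Qed.

(** The term at 0 costs at most [d]; the others are values at right endpoints of a decreasing
    function, hence below its integral. *)
Let riemann_le (d : R) M : 0 < d -> d * \sum_(j < M) E (j%:R * d) <= d + I.
Proof.
move=> d0; case: M => [|M].
  rewrite big_ord0 mulr0 addr_ge0 ?(ltW d0)//.
  by rewrite -lee_fin -int_E integral_ge0// => r _; rewrite lee_fin.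
rewrite big_ord_recl/= mulrDr; apply: lerD.
  by rewrite mul0r ler_piMr ?(ltW d0)// E_le1.
rewrite -lee_fin -int_E; apply: le_trans (sum_le M d0) _.
apply: ge0_subset_integral => //.
- by apply/measurable_EFinP.
- by move=> r _; rewrite lee_fin.
- by move=> r /=; rewrite !in_itv/= => /andP[-> _].
Qed.

Let E_small : \forall n \near \oo, E n.+1%:R <= n.+1%:R^-1.
Proof.
have /cvgryPge /(_ c^-1) H := f_log.
have H' : \forall r \near +oo, c^-1 <= f r / ln (1 + r) by exact: H.
case: H' => A [Areal HA].
near=> n.
have n0 : (0 : R) < n.+1%:R by [].
have An : A < n.+1%:R.
  apply: (@le_lt_trans _ _ `|A|); first exact: ler_norm.
  rewrite (lt_le_trans (archi_boundP _))// ler_nat leqW//.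
  by near: n; exact: nbhs_infty_ge.
have := HA _ An.
have l0 : 0 < ln (1 + n.+1%:R) :> R by rewrite ln_gt0// ltrDl.
rewrite ler_pdivlMr// ler_pdivrMl// => h.
apply: (@le_trans _ _ (expR (- ln (1 + n.+1%:R)))); first by rewrite ler_expR lerN2.
rewrite expRN lnK ?posrE ?addr_gt0// lef_pV2 ?posrE ?addr_gt0//.
by rewrite lerDr.
Unshelve. all: end_near. Qed.

Lemma affinity_from_defect (phi : R -> R[i]) a :
  (forall d M, 0 < d -> affinity_ge phi a (1 - affinity_defect b d M E)) ->
  affinity_ge phi a (1 - b * I).
Proof.
move=> H.
pose rho_ n := 1 - (b * (n.+1%:R^-1 + I) + E n.+1%:R).
apply: (@affinity_ge_cvg _ (fun=> phi) _ _ rho_).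
(* Mesh [1 / n.+1] with [n.+1 ^ 2] points: the mesh tends to 0 while the cut-off [n.+1] tends to
   infinity. *)
- move=> n; apply: affinity_ge_le (H n.+1%:R^-1 (n.+1 * n.+1)%N _); last by rewrite invr_gt0.
  rewrite lerD2l lerN2 /affinity_defect lerD//.
    by rewrite ler_wpM2l// riemann_le// invr_gt0.
  by rewrite natrM mulfK.
- by move=> h; exact: ccvg_cst.
- have E0 : E n.+1%:R @[n --> \oo] --> 0.
    apply: (squeeze_cvgr _ (cvg_cst 0) (@cvg_harmonic R)).
    by near=> n; rewrite E_ge0/=; near: n; exact: E_small.
  rewrite -[b * I]addr0 -{1}[I]add0r.
  apply: cvgB; first exact: cvg_cst.
  apply: cvgD => //; apply: cvgM; first exact: cvg_cst.
  by apply: cvgD; [exact: cvg_harmonic|exact: cvg_cst].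
Unshelve. all: end_near. Qed.

End riemann_sum_of_exponential.

Lemma node_range (R : realType) (x y : R) : 0 < x ->
  exists2 M, (0 < M)%N & node R M 0 ^+ 2 <= x /\ y <= node R M (2 * M) ^+ 2.
Proof.
move=> x0; pose M := (Num.bound x^-1 + Num.bound `|y|).+1.
have M0 : 0 < (2 ^+ M : R) by rewrite exprn_gt0.
have MM : M%:R <= 2 ^+ M :> R by rewrite -natrX ler_nat ltnW// ltn_expl.
have M1 : 1 <= 2 ^+ M :> R by rewrite exprn_ege1// ler1n.
have M2 : M%:R <= (2 ^+ M) ^+ 2 :> R by rewrite (le_trans MM)// expr2 ler_peMl// ltW.
exists M => //; rewrite /node expr0; split.
  rewrite div1r exprVn -[leRHS]invrK lef_pV2 ?posrE ?exprn_gt0 ?invr_gt0//.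
  rewrite (le_trans _ M2)// (le_trans (ltW (archi_boundP _))) ?invr_ge0 ?(ltW x0)//.
  by rewrite ler_nat /M -addnS leq_addr.
rewrite mul2n -addnn exprD mulfK ?gt_eqF// (le_trans _ M2)//.
rewrite (le_trans (ler_norm y))// (le_trans (ltW (archi_boundP _)))//.
by rewrite ler_nat /M -addSn leq_addl.
Qed.

(** * Affinity of one Ornstein-Uhlenbeck coordinate *)

Section coordinate_affinity.
Variables (R : realType) (nu : {measure set (measurableTypeR R) -> \bar R}).
Variables (f : R -> R) (gamma t : R).
Hypothesis lnu : levy_measure nu.
Hypothesis bf : bernstein f.
Hypothesis f0 : f 0 = 0.
Hypothesis f_log : f r / ln (1 + r) @[r --> +oo] --> +oo.
Hypothesis fnu : forall (B : set (measurableTypeR R)), measurable B ->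
  (\int[lebesgue_measure]_(z in B) (`|z|^-1 * f (z ^- 2))%:E <= nu B)%E.
Hypotheses (gamma0 : 0 < gamma) (t0 : 0 < t).

Definition grid n (k : nat) : R := k%:R * (t / n.+1%:R).

Definition weight n k : R := expR (- (gamma * (t - grid n k))).

(** Characteristic function of the left-point Riemann sum of the stochastic integral, a product
    because increments are independent and stationary. *)
Definition riemann_char n (h : R) : R[i] :=
  \prod_(k < n.+1) cexp (- (rc (t / n.+1%:R) * levy_exponent nu (weight n k * h))).

Lemma levy_exponent0 : levy_exponent nu 0 = 0.
Proof.
rewrite /levy_exponent; apply: eq_ReIm => /=.
  under eq_Rintegral do rewrite mul0r cos0 subrr.
  by rewrite Rintegral_cst// mul0r.
under eq_Rintegral do rewrite !mul0r sin0 subrr.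
by rewrite Rintegral_cst// mul0r.
Qed.

Let dt_ge0 n : 0 <= t / n.+1%:R.
Proof. by rewrite divr_ge0// ltW. Qed.

Let grid_le n k : (k < n.+1)%N -> grid n k <= t.
Proof.
move=> kn; rewrite /grid mulrCA ler_piMr ?(ltW t0)// ler_pdivrMr// mul1r ler_nat.
exact: ltnW.
Qed.

Let grid_ge0 n k : 0 <= grid n k.
Proof. by rewrite mulr_ge0. Qed.

Let weight_gt0 n k : 0 < weight n k. Proof. exact: expR_gt0. Qed.

Let weight_le1 n k : (k < n.+1)%N -> weight n k <= 1.
Proof.
move=> kn; rewrite -expR0 ler_expR oppr_le0 mulr_ge0 ?(ltW gamma0)// subr_ge0.
exact: grid_le.
Qed.

Let weight_ge n k : expR (- (gamma * t)) <= weight n k.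
Proof.
rewrite ler_expR lerN2 ler_wpM2l ?(ltW gamma0)// lerBlDr lerDl; exact: grid_ge0.
Qed.

(** Factor the characteristic function as [l (h^2 / 4) * W h]. Here [W] collects the remainders of
    [pos_type_levy] and is discarded by [affinity_geM], while [l] is the Laplace transform of a
    random variance, to which [laplace_affinity] applies. *)
Lemma riemann_affinity n (E : R -> R) a d m : 0 < d ->
  (forall r, 0 <= r -> expR (- (\sum_(k < n.+1)
     (t / n.+1%:R * (f (weight n k ^+ 2 * r) / 3)))) <= E r) ->
  affinity_ge (riemann_char n) a (1 - affinity_defect (a ^+ 2 / 4) d m E).
Proof.
move=> d0 HE.
(* The dyadic range must contain [weight ^+ 2 * (j * d)] for every weight and all [1 <= j <= m];
   weights lie between [expR (- (gamma * t))] and 1. *)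
have [M M0 [Mlo Mhi]] : exists2 M, (0 < M)%N &
    (node R M 0 ^+ 2 <= expR (- (gamma * t)) ^+ 2 * d /\
     m%:R * d <= node R M (2 * M) ^+ 2).
  by apply: node_range; rewrite mulr_gt0// exprn_gt0// expR_gt0.
pose g := mixture_exponent f M.
pose l r := \prod_(k < n.+1) expR (- (t / n.+1%:R * g (weight n k ^+ 2 * r))).
have lE r : l r = expR (- (\sum_(k < n.+1) (t / n.+1%:R * g (weight n k ^+ 2 * r)))).
  by rewrite /l -expR_sum sumrN.
have Ll : laplace l.
  apply: (@laplace_prod _ _ _ (fun (k : 'I_n.+1) r =>
    expR (- (t / n.+1%:R * g (weight n k ^+ 2 * r))))) => k.
  by apply: laplace_mixture => //; rewrite sqr_ge0.
pose W h := \prod_(k < n.+1) (cexp (- (rc (t / n.+1%:R) * levy_exponent nu (weight n k * h))) *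
    rc (expR (t / n.+1%:R * g ((weight n k * h) ^+ 2 / 4)))).
have PW : pos_type W.
  apply: (@pos_type_prod _ _ _ (fun (k : 'I_n.+1) h =>
    cexp (- (rc (t / n.+1%:R) * levy_exponent nu (weight n k * h))) *
    rc (expR (t / n.+1%:R * g ((weight n k * h) ^+ 2 / 4))))) => k.
  apply: (@pos_type_dilate _ (weight n k) (fun h =>
    cexp (- (rc (t / n.+1%:R) * levy_exponent nu h)) *
    rc (expR (t / n.+1%:R * g (h ^+ 2 / 4))))).
  exact: pos_type_levy.
have g0 : g 0 = 0 by exact: mixture_exponent0.
have W0 : W 0 = 1.
  rewrite /W big1// => k _.
  by rewrite !mulr0 levy_exponent0 mulr0 oppr0 cexp0 expr0n mul0r g0 mulr0 expR0 mul1r.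
have l0 : l 0 = 1.
  by rewrite lE big1 ?oppr0 ?expR0// => k _; rewrite mulr0 g0 mulr0.
have rcP (I : Type) (s : seq I) (F : I -> R) : rc (\prod_(i <- s) F i) = \prod_(i <- s) rc (F i).
  elim: s => [|i s ih]; first by rewrite !big_nil.
  by rewrite !big_cons rcM ih.
apply: (@eq_affinity_ge _ (fun h => rc (l (h ^+ 2 / 4)) * W h)).
  move=> h; rewrite /l rcP -big_split/=; apply: eq_bigr => k _.
  rewrite mulrCA -rcM -expRD exprMn mulrA addNr expR0.
  by rewrite -[rc 1]/(1 : R[i]) mulr1.
apply: affinity_geM => //.
apply: affinity_ge_le (laplace_affinity a m Ll (ltW d0)).
rewrite l0 lerD2l lerN2.
have lE' (j : nat) : (j <= m)%N -> l (j%:R * d) <= E (j%:R * d).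
  move=> jm; have jd0 : 0 <= j%:R * d by rewrite mulr_ge0// ltW.
  apply: le_trans (HE _ jd0); rewrite lE ler_expR lerN2.
  apply: ler_sum => k _; rewrite ler_wpM2l//.
  have [j0|j0] := posnP j.
    by rewrite j0 mul0r mulr0 f0 g0 mul0r.
  have wk1 := weight_le1 (ltn_ord k).
  have wk0 := weight_gt0 n k.
  apply: mixture_exponent_ge => //.
    apply: (le_trans Mlo).
    rewrite ler_pM ?exprn_ge0 ?expR_ge0 ?(ltW d0)//.
      by rewrite lerXn2r ?nnegrE ?expR_ge0.
    by rewrite ler_peMl ?(ltW d0)// ler1n.
  apply: le_trans Mhi.
  apply: (@le_trans _ _ (j%:R * d)).
    by rewrite ler_piMl// expr_le1// ltW.
  by rewrite ler_wpM2r ?(ltW d0)// ler_nat.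
rewrite /affinity_defect; apply: lerD; last exact: lE'.
rewrite ler_wpM2l ?divr_ge0 ?sqr_ge0// ler_wpM2l ?(ltW d0)//.
by apply: ler_sum => j _; apply: lE'; rewrite ltnW.
Qed.

Section limit.
Variable phi : R -> R[i].
Hypothesis phiP : forall h, ccvg (fun n => riemann_char n h) (phi h).

Let c : R := cos 1 / 2.

Let c_gt0 : 0 < c.
Proof.
rewrite divr_gt0//; apply: cos_gt0_pihalf; apply/andP; split.
  by have := pihalf_ge1 R; lra.
by have := pi_ge_9_4 R; lra.
Qed.

Let c_le : c <= 3^-1. Proof. by have := cos1_le R; rewrite /c; lra. Qed.

Let fe (r : R) := bernstein_ge0 bf (x := r).

(** Each weight is at least [q = expR (- (gamma * t))] and [f] increases, so every
    [f (weight ^+ 2 * r)] is at least [f (q ^+ 2 * r)]. *)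
Lemma affinity_slow (zeta I : R) :
  (\int[lebesgue_measure]_(r in `[0%R, +oo[) (expR (- (c * t * f r)))%:E = I%:E)%E ->
  affinity_ge phi (expR (- (gamma * t)) * zeta) (1 - zeta ^+ 2 / 4 * I).
Proof.
move=> int_E.
set q := expR (- (gamma * t)); have q0 : 0 < q by exact: expR_gt0.
apply: (affinity_from_defect bf f_log _ _ int_E).
- by rewrite mulr_gt0.
- by rewrite divr_ge0// sqr_ge0.
move=> d m d0.
pose E r := expR (- (c * t * f (q ^+ 2 * r))).
(* Rescaling [r] by [q ^+ 2] cancels the [q ^+ 2] of the squared translation; hence the first
   integral in C_t has no factor [expR (- (gamma * t))] in front. *)
have -> : affinity_defect (zeta ^+ 2 / 4) d m (fun r => expR (- (c * t * f r))) =
    affinity_defect ((q * zeta) ^+ 2 / 4) (q ^- 2 * d) m E.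
  rewrite /affinity_defect /E.
  have e j : q ^+ 2 * (j%:R * (q ^- 2 * d)) = j%:R * d.
    by field; rewrite gt_eqF.
  rewrite e; congr (_ + _).
  under [in RHS]eq_bigr do rewrite e.
  by field; rewrite gt_eqF.
apply: (@affinity_ge_cvg _ riemann_char _ _ (fun=> _)); last exact: cvg_cst.
  move=> n; apply: riemann_affinity.
    by rewrite mulr_gt0// invr_gt0 exprn_gt0.
  move=> r r0; rewrite /E ler_expR lerN2.
  have -> : c * t * f (q ^+ 2 * r) = \sum_(k < n.+1) (t / n.+1%:R * (c * f (q ^+ 2 * r))).
    rewrite sumr_const card_ord -mulr_natl; field.
    by rewrite addrC natr1.
  apply: ler_sum => k _; rewrite ler_wpM2l//.
  have qr : 0 <= q ^+ 2 * r by rewrite mulr_ge0// exprn_ge0// ltW.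
  rewrite [leRHS]mulrC ler_pM ?(ltW c_gt0)// ?fe//.
  apply: (bernstein_le bf) => //; rewrite ler_wpM2r//.
  by rewrite lerXn2r ?nnegrE ?(ltW q0) ?(ltW (weight_gt0 _ _))// weight_ge.
exact: phiP.
Qed.

Let kap n := \sum_(k < n.+1) (t / n.+1%:R * weight n k ^+ 2).

(** [kap n] is a Riemann sum of [expR (- (2 * gamma * (t - s)))] over [[0, t]]. Being geometric it
    is explicit, and its limit is that of a difference quotient of the exponential. *)
Let kap_cvg : kap n @[n --> \oo] --> (1 - expR (- (2 * gamma * t))) / (2 * gamma).
Proof.
have d1 : is_derive (0 : R) 1 (fun s => expR (2 * gamma * t * s)) (2 * gamma * t).
  by apply: is_derive_eq; rewrite !mulr0 expR0 /GRing.scale/=; ring.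
have := cvg_diff_quotient d1; rewrite mulr0 expR0 => H.
have g2 : 2 * gamma * t != 0 by rewrite gt_eqF// !mulr_gt0.
pose q n := expR (2 * gamma * t * n.+1%:R^-1).
have kapE n : kap n = (1 - expR (- (2 * gamma * t))) * t * (n.+1%:R * (q n - 1))^-1.
  have n0 : n.+1%:R != 0 :> R by rewrite pnatr_eq0.
  have q1 : q n - 1 != 0.
    by rewrite subr_eq0 gt_eqF// expR_gt1 mulr_gt0 ?invr_gt0// !mulr_gt0.
  have wE k : weight n k ^+ 2 = expR (- (2 * gamma * t)) * q n ^+ k.
    rewrite /weight /q /grid -!expRM_natl -expRD; congr expR; field.
    by rewrite addrC natr1.
  have geo m : (q n - 1) * \sum_(k < m) q n ^+ k = q n ^+ m - 1.
    elim: m => [|m ih]; first by rewrite big_ord0 mulr0 expr0 subrr.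
    by rewrite big_ord_recr/= mulrDr ih exprS; ring.
  have qN : q n ^+ n.+1 = expR (2 * gamma * t).
    by rewrite /q -expRM_natl mulrCA divff// mulr1.
  rewrite /kap; under eq_bigr do rewrite wE mulrA.
  rewrite -mulr_sumr.
  have -> : \sum_(i < n.+1) q n ^+ i = (expR (2 * gamma * t) - 1) / (q n - 1).
    by rewrite -qN -geo mulrAC divff// mul1r.
  have -> : 1 - expR (- (2 * gamma * t)) = expR (- (2 * gamma * t)) * (expR (2 * gamma * t) - 1).
    by rewrite mulrBr mulr1 -expRD addNr expR0.
  by field; rewrite q1 addrC natr1.
under eq_fun do rewrite kapE.
have -> : (1 - expR (- (2 * gamma * t))) / (2 * gamma) =
    (1 - expR (- (2 * gamma * t))) * t * (2 * gamma * t)^-1.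
  by field; rewrite !gt_eqF.
by apply: cvgM; [exact: cvg_cst|apply: cvgV].
Qed.

(** Concavity gives [f (weight ^+ 2 * r) >= weight ^+ 2 * f r], so the squared weights sum to
    [kap n], whose limit is the factor in the exponent of the second integral. *)
Lemma affinity_fast (zeta I : R) :
  (\int[lebesgue_measure]_(r in `[0%R, +oo[)
    (expR (- (cos 1 * (1 - expR (- (2 * gamma * t))) / (4 * gamma) * f r)))%:E = I%:E)%E ->
  affinity_ge phi (expR (- (gamma * t)) * zeta)
    (1 - zeta ^+ 2 / 4 * (expR (- (gamma * t)) * I)).
Proof.
set kappa := (1 - expR (- (2 * gamma * t))) / (2 * gamma).
have ck : cos 1 * (1 - expR (- (2 * gamma * t))) / (4 * gamma) = c * kappa.
  by rewrite /c /kappa; field; rewrite gt_eqF.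
have kappa0 : 0 < kappa.
  rewrite divr_gt0 ?mulr_gt0// subr_gt0 -expR0 ltr_expR oppr_lt0 !mulr_gt0//.
rewrite ck => int_E.
set q := expR (- (gamma * t)); have q0 : 0 < q by exact: expR_gt0.
have q1 : q <= 1.
  by rewrite -expR0 ler_expR oppr_le0 mulr_ge0// ltW.
have I0 : 0 <= I.
  by rewrite -lee_fin -int_E integral_ge0// => r _; rewrite lee_fin expR_ge0.
(* The argument gives the factor [q ^+ 2] in front of [I]; C_t carries the larger [q]. *)
apply: (@affinity_ge_le _ _ _ (1 - (q * zeta) ^+ 2 / 4 * I)).
  rewrite lerD2l lerN2 mulrA ler_wpM2r// exprMn expr2.
  have -> : q * q * zeta ^+ 2 / 4 = q * (q * zeta ^+ 2 / 4) by ring.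
  have -> : zeta ^+ 2 / 4 * q = 1 * (q * zeta ^+ 2 / 4) by ring.
  by apply: ler_wpM2r => //; rewrite divr_ge0// mulr_ge0 ?sqr_ge0// ltW.
apply: (affinity_from_defect bf f_log _ _ int_E).
- by rewrite mulr_gt0.
- by rewrite divr_ge0// sqr_ge0.
move=> d m d0.
apply: (@affinity_ge_cvg _ riemann_char _ _ (fun n => 1 -
  affinity_defect ((q * zeta) ^+ 2 / 4) d m (fun r => expR (- (c * kap n * f r))))).
- move=> n; apply: riemann_affinity => // r r0; rewrite ler_expR lerN2.
  rewrite /kap mulr_sumr mulr_suml; apply: ler_sum => k _.
  have -> : c * (t / n.+1%:R * weight n k ^+ 2) * f r =
    t / n.+1%:R * (weight n k ^+ 2 * f r * c) by ring.
  rewrite ler_wpM2l//.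
  have wk1 := weight_le1 (ltn_ord k).
  have wk0 := weight_gt0 n k.
  have wf : weight n k ^+ 2 * f r <= f (weight n k ^+ 2 * r).
    apply: bernstein_concave => //.
    by rewrite exprn_ge0 ?(ltW wk0)//= expr_le1// ltW.
  apply: ler_pM => //; last exact: ltW.
  by rewrite mulr_ge0 ?fe// exprn_ge0// ltW.
- exact: phiP.
- have Ec r : expR (- (c * kap n * f r)) @[n --> \oo] --> expR (- (c * kappa * f r)).
    apply: continuous_cvg; first exact: continuous_expR.
    apply: cvgN; apply: cvgM; last exact: cvg_cst.
    by apply: cvgM; [exact: cvg_cst|exact: kap_cvg].
  apply: cvgB; first exact: cvg_cst.
  apply: cvgD; last exact: Ec.
  apply: cvgM; first exact: cvg_cst.
  apply: cvgM; first exact: cvg_cst.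
  elim: (index_enum _) => [|j s ih].
    by rewrite big_nil; under eq_fun do rewrite big_nil; exact: cvg_cst.
  by rewrite big_cons; under eq_fun do rewrite big_cons; apply: cvgD.
Qed.

End limit.

End coordinate_affinity.

(** * Independence and stochastic integrals *)


Lemma eq_Rintegral_from_indic d1 d2 d (T1 : measurableType d1) (T2 : measurableType d2)
    (S : measurableType d) (R : realType)
    (m1 : {measure set T1 -> \bar R}) (m2 : {measure set T2 -> \bar R})
    (w1 : T1 -> R) (w2 : T2 -> R) (Y1 : T1 -> S) (Y2 : T2 -> S) :
  measurable_fun setT Y1 -> measurable_fun setT Y2 ->
  m1.-integrable setT (EFin \o w1) -> m2.-integrable setT (EFin \o w2) ->
  (forall B, measurable B ->
    \int[m1]_x (\1_B (Y1 x) * w1 x) = \int[m2]_x (\1_B (Y2 x) * w2 x)) ->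
  forall g : S -> R, measurable_fun setT g -> (forall z, `|g z| <= 1) ->
  \int[m1]_x (g (Y1 x) * w1 x) = \int[m2]_x (g (Y2 x) * w2 x).
Proof.
move=> mY1 mY2 i1 i2 H g mg g1.
have H1 B : measurable B ->
    \int[m1]_x (\1_B (Y1 x) * w1 x) <= \int[m2]_x (\1_B (Y2 x) * w2 x) + 0.
  by move=> mB; rewrite addr0 H.
have H2 B : measurable B ->
    \int[m2]_x (\1_B (Y2 x) * w2 x) <= \int[m1]_x (\1_B (Y1 x) * w1 x) + 0.
  by move=> mB; rewrite addr0 H.
pose u z := 2^-1 * (1 + g z).
have mu : measurable_fun setT u.
  by apply: measurable_funM => //; apply: measurable_funD.
have u01 z : 0 <= u z <= 1.
  by have := g1 z; rewrite ler_norml /u => /andP[? ?]; apply/andP; split; lra.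
have h1 := le_Rintegral_from_indic measurableT measurableT mY1 mY2 i1 i2 H1 mu u01.
have h2 := le_Rintegral_from_indic measurableT measurableT mY2 mY1 i2 i1 H2 mu u01.
have e0 : \int[m1]_x w1 x = \int[m2]_x w2 x.
  have := H setT measurableT.
  by under eq_Rintegral do rewrite indicT mul1r;
    under [X in _ = X]eq_Rintegral do rewrite indicT mul1r.
have uE d' (T : measurableType d') (m : {measure set T -> \bar R}) (Y : T -> S) (w : T -> R) :
    measurable_fun setT Y -> m.-integrable setT (EFin \o w) ->
    \int[m]_x (u (Y x) * w x) = 2^-1 * (\int[m]_x w x + \int[m]_x (g (Y x) * w x)).
  move=> mY iw.
  have ig : m.-integrable setT (EFin \o (fun x => g (Y x) * w x)).
    apply: (integrable_boundedM measurableT iw _ (fun x => g1 (Y x))).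
    exact: measurableT_comp.
  under eq_Rintegral do rewrite /u -mulrA mulrDl mul1r.
  rewrite RintegralZl//; first by rewrite RintegralD.
  by rewrite /comp; under eq_fun do rewrite EFinD; exact: integrableD.
have := le_anti (introT andP (conj h1 _)).
rewrite addr0 => /(_ _)/=.
move: h1 h2; rewrite !addr0 !uE// e0 => h1 h2 _.
by apply/eqP; rewrite eq_le; apply/andP; split; lra.
Qed.

Section complex_expectation.
Context d (T : measurableType d) (R : realType) (P : probability T R).
Implicit Types (U V : T -> R[i]) (Y : T -> R).

Definition cexpect V : R[i] :=
  Complex (\int[P]_w complex.Re (V w)) (\int[P]_w complex.Im (V w)).

Definition cmeasurable V :=
  measurable_fun setT (fun w => complex.Re (V w)) /\
  measurable_fun setT (fun w => complex.Im (V w)).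

Lemma probability_fin : (P setT < +oo)%E.
Proof. by rewrite probability_setT ltry. Qed.

Lemma integrable_P (g : T -> R) (K : R) : measurable_fun setT g ->
  (forall w, `|g w| <= K) -> P.-integrable setT (EFin \o g).
Proof. exact: integrable_bounded measurableT probability_fin. Qed.

Lemma cmeasurableM U V : cmeasurable U -> cmeasurable V ->
  cmeasurable (fun w => U w * V w).
Proof.
move=> [U1 U2] [V1 V2]; split.
  under eq_fun do rewrite Re_mulc.
  by apply: measurable_funB; apply: measurable_funM.
under eq_fun do rewrite Im_mulc.
by apply: measurable_funD; apply: measurable_funM.
Qed.

Lemma cmeasurable_rc Y : measurable_fun setT Y -> cmeasurable (fun w => rc (Y w)).
Proof. by move=> mY; split => //=. Qed.

Lemma cmeasurable_cis Y : measurable_fun setT Y -> cmeasurable (fun w => cis (Y w)).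
Proof.
by move=> mY; split => /=; apply: measurableT_comp => //; apply: continuous_measurable_fun;
  [exact: continuous_cos|exact: continuous_sin].
Qed.

Lemma cmeasurable_prod (I : Type) (s : seq I) (p : pred I) (V : I -> T -> R[i]) :
  (forall i, cmeasurable (V i)) -> cmeasurable (fun w => \prod_(i <- s | p i) V i w).
Proof.
move=> mV; elim: s => [|i s ih].
  under eq_fun do rewrite big_nil.
  by split; exact: measurable_cst.
under eq_fun do rewrite big_cons.
by case: (p i) => //; exact: cmeasurableM.
Qed.

Lemma norm1_prod (I : Type) (s : seq I) (p : pred I) (V : I -> R[i]) :
  (forall i, norm1 (V i) <= 2) -> norm1 (\prod_(i <- s | p i) V i) <= 2 ^+ size s.
Proof.
move=> V2; elim: s => [|i s ih]; first by rewrite big_nil /norm1/= normr1 normr0 addr0.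
rewrite big_cons exprS; case: (p i).
  by rewrite (le_trans (norm1M _ _))// ler_pM// norm1_ge0.
by rewrite (le_trans ih)// ler_peMl// ?ler1n ?exprn_ge0.
Qed.

Lemma norm1_cis x : norm1 (cis x : R[i]) <= 2.
Proof.
have c1 : `|cos x| <= 1 by rewrite ler_norml cos_geN1 cos_le1.
have s1 : `|sin x| <= 1 by rewrite ler_norml sin_geN1 sin_le1.
by rewrite /norm1/=; lra.
Qed.

Lemma Re_le_norm1 (z : R[i]) : `|complex.Re z| <= norm1 z.
Proof. by rewrite /norm1 lerDl. Qed.

Lemma Im_le_norm1 (z : R[i]) : `|complex.Im z| <= norm1 z.
Proof. by rewrite /norm1 lerDr. Qed.

(** Factorization against all indicators of [Y] extends to bounded functions of [Y], here cosine and
    sine, applied to each part of [V]. *)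
Lemma cexpect_cis_mul Y V (c : R[i]) (K : R) :
  measurable_fun setT Y -> cmeasurable V -> (forall w, norm1 (V w) <= K) ->
  (forall B, measurable B -> cexpect (fun w => rc (\1_B (Y w)) * V w) =
    rc (\int[P]_w \1_B (Y w)) * c) ->
  cexpect (fun w => cis (Y w) * V w) = cexpect (fun w => cis (Y w)) * c.
Proof.
move=> mY [mV1 mV2] VK H.
have i1 : P.-integrable setT (EFin \o (fun w => complex.Re (V w))).
  by apply: (@integrable_P _ K) => // w; rewrite (le_trans (Re_le_norm1 _)).
have i2 : P.-integrable setT (EFin \o (fun w => complex.Im (V w))).
  by apply: (@integrable_P _ K) => // w; rewrite (le_trans (Im_le_norm1 _)).
have icst (k : R) : P.-integrable setT (EFin \o cst k).
  by apply: (@integrable_P _ `|k|).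
have ib (g w : T -> R) : P.-integrable setT (EFin \o w) -> measurable_fun setT g ->
    (forall x, `|g x| <= 1) -> P.-integrable setT (EFin \o (fun x => g x * w x)).
  by move=> iw mg g1; exact: (integrable_boundedM measurableT iw mg g1).
have ind1 (B : set R) (z : R) : `|(\1_B z : R)| <= 1.
  by rewrite indicE; case: (_ \in _); rewrite ?normr1 ?normr0.
have HR B : measurable B -> \int[P]_w (\1_B (Y w) * complex.Re (V w)) =
    \int[P]_w (\1_B (Y w) * cst (complex.Re c) w).
  move=> mB; have /(congr1 (@complex.Re R)) := H B mB; rewrite Re_rcM/= => e.
  have i : P.-integrable setT (EFin \o (fun w => (\1_B (Y w) : R))).
    apply: (@integrable_P _ 1) => //.
    by apply: (measurableT_comp (measurable_indic mB)).
  rewrite -[LHS]/(\int[P]_w (\1_B (Y w) * complex.Re (V w))) /=.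
  under [RHS]eq_Rintegral do rewrite mulrC.
  rewrite RintegralZl// mulrC -e; apply: eq_Rintegral => w _.
  by rewrite Re_rcM.
have HI B : measurable B -> \int[P]_w (\1_B (Y w) * complex.Im (V w)) =
    \int[P]_w (\1_B (Y w) * cst (complex.Im c) w).
  move=> mB; have /(congr1 (@complex.Im R)) := H B mB; rewrite Im_rcM/= => e.
  have i : P.-integrable setT (EFin \o (fun w => (\1_B (Y w) : R))).
    apply: (@integrable_P _ 1) => //.
    by apply: (measurableT_comp (measurable_indic mB)).
  under [RHS]eq_Rintegral do rewrite mulrC.
  rewrite RintegralZl// mulrC -e; apply: eq_Rintegral => w _.
  by rewrite Im_rcM.
have mc : measurable_fun setT (@cos R) by apply: continuous_measurable_fun; exact: continuous_cos.
have ms : measurable_fun setT (@sin R) by apply: continuous_measurable_fun; exact: continuous_sin.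
have c1 (x : R) : `|cos x| <= 1 by rewrite ler_norml cos_geN1 cos_le1.
have s1 (x : R) : `|sin x| <= 1 by rewrite ler_norml sin_geN1 sin_le1.
have E (g : R -> R) : measurable_fun setT g -> (forall z, `|g z| <= 1) ->
    \int[P]_w (g (Y w) * complex.Re (V w)) = \int[P]_w g (Y w) * complex.Re c /\
    \int[P]_w (g (Y w) * complex.Im (V w)) = \int[P]_w g (Y w) * complex.Im c.
  move=> mg g1.
  have ig : P.-integrable setT (EFin \o (fun w => g (Y w))).
    by apply: (@integrable_P _ 1) => //; exact: measurableT_comp.
  split.
    rewrite (eq_Rintegral_from_indic mY mY i1 (icst _) HR mg g1).
    by under eq_Rintegral do rewrite mulrC; rewrite RintegralZl// mulrC.
  rewrite (eq_Rintegral_from_indic mY mY i2 (icst _) HI mg g1).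
  by under eq_Rintegral do rewrite mulrC; rewrite RintegralZl// mulrC.
have [cR cI] := E _ mc c1; have [sR sI] := E _ ms s1.
have mcY : measurable_fun setT (fun w => cos (Y w)) by exact: measurableT_comp.
have msY : measurable_fun setT (fun w => sin (Y w)) by exact: measurableT_comp.
apply: eq_ReIm; rewrite ?Re_mulc ?Im_mulc /=.
  under eq_Rintegral do rewrite Re_mulc/=.
  by rewrite RintegralB ?cR ?sI//; exact: ib.
under eq_Rintegral do rewrite Im_mulc/=.
by rewrite RintegralD ?cI ?sR//; exact: ib.
Qed.

End complex_expectation.

Section independence.
Context d (T : measurableType d) (R : realType) (P : probability T R).
Variables (F : nat -> set_system T) (Y : nat -> T -> R).
Hypothesis indep : mutually_independent P F.
Hypothesis mY : forall i, measurable_fun setT (Y i).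
Hypothesis FY : forall i B, measurable B -> F i (Y i @^-1` B).

(** Interpolates between products of indicators ([n = 0]), where independence applies, and products
    of characters ([n = N]). Each step converts one slot; [B] stays arbitrary so that this slot can
    first carry any test set. *)
Let mixed n (B : nat -> set R) i (w : T) : R[i] :=
  if (i < n)%N then cis (Y i w) else rc (\1_(B i) (Y i w)).

Let indep_indic N (B : nat -> set R) : (forall i, measurable (B i)) ->
  \int[P]_w (\prod_(i < N) (\1_(B i) (Y i w) : R)) =
  \prod_(i < N) \int[P]_w (\1_(B i) (Y i w) : R).
Proof.
move=> mB.
pose J := [fset i in iota 0 N]%fset.
pose E i := Y i @^-1` (B i).
have mE i : measurable (E i) by rewrite -[E i]setTI; apply: mY.
have JE i : i \in J = (i < N)%N by rewrite in_fset/= mem_iota.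
have IE i : \int[P]_w (\1_(B i) (Y i w) : R) = fine (P (E i)).
  rewrite /Rintegral -[E i]setIT -integral_indic//.
have bJ (G : nat -> \bar R) : (\prod_(i <- J) G i = \prod_(i < N) G i)%E.
  rewrite -(big_mkord xpredT) /index_iota subn0; apply: perm_big.
  apply: uniq_perm; [exact: fset_uniq|exact: iota_uniq|].
  by move=> i; rewrite JE mem_iota.
have := @indep J E (fun i _ => @FY i (B i) (mB i)).
rewrite bJ => e.
have -> : \prod_(i < N) \int[P]_w (\1_(B i) (Y i w) : R) = fine (\prod_(i < N) P (E i))%E.
  under eq_bigr do rewrite IE.
  rewrite [in RHS](eq_bigr (fun i : 'I_N => (fine (P (E i)))%:E)); last first.
    by move=> i _; rewrite fineK// fin_num_measure.
  by rewrite prodEFin.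
have mJ : measurable (\bigcap_(i in [set` J]) E i).
  by apply: fin_bigcap_measurable => //; exact: finite_fset.
rewrite -e /Rintegral -[X in P X]setIT -integral_indic//.
congr fine; apply: eq_integral => w _; congr (_%:E).
have [wJ|wJ] := pselect ((\bigcap_(i in [set` J]) E i) w); rewrite indicE.
  rewrite mem_set// big1// => i _; rewrite indicE mem_set//; apply: wJ.
  by rewrite /= JE.
rewrite memNset//; have : exists i : 'I_N, ~ E i w.
  apply: contrapT => nE; apply: wJ => i /=; rewrite JE => iN.
  by apply: contrapT => nEi; apply: nE; exists (Ordinal iN).
by move=> [i nEi]; rewrite (bigD1 i)//= indicE memNset ?mul0r.
Qed.

Lemma cexpect_cis_sum N :
  cexpect P (fun w => cis (\sum_(i < N) Y i w)) =
  \prod_(i < N) cexpect P (fun w => cis (Y i w)).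
Proof.
have main n (B : nat -> set R) : (n <= N)%N -> (forall i, measurable (B i)) ->
    cexpect P (fun w => \prod_(i < N) mixed n B i w) =
    \prod_(i < N) (if (i < n)%N then cexpect P (fun w => cis (Y i w))
                   else rc (\int[P]_w (\1_(B i) (Y i w) : R))).
  elim: n B => [|n ih] B nN mB.
    have rcP (G : nat -> R) : \prod_(i < N) rc (G i) = rc (\prod_(i < N) G i).
      elim: N {nN} => [|k ihk]; first by rewrite !big_ord0.
      by rewrite !big_ord_recr/= ihk rcM.
    rewrite [RHS](eq_bigr (fun i : 'I_N => rc (\int[P]_w (\1_(B i) (Y i w) : R))))//.
    rewrite (rcP (fun i => \int[P]_w (\1_(B i) (Y i w) : R))) -indep_indic// (_ : (fun w => _) =
      (fun w => \prod_(i < N) rc (\1_(B i) (Y i w)))); last by [].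
    apply: eq_ReIm => /=.
      by apply: eq_Rintegral => w _; rewrite (rcP (fun i => \1_(B i) (Y i w))).
    rewrite (_ : (fun w => _) = cst 0); last first.
      by apply/funext => w; rewrite (rcP (fun i => \1_(B i) (Y i w))).
    by rewrite Rintegral_cst// mul0r.
  pose n' := Ordinal nN.
  rewrite (bigD1 n')//= ltnSn.
  pose V w := \prod_(i < N | i != n') mixed n.+1 B i w.
  have -> : (fun w => \prod_(i < N) mixed n.+1 B i w) = (fun w => cis (Y n w) * V w).
    by apply/funext => w; rewrite (bigD1 n')//= {1}/mixed/= ltnSn.
  have mixedS i w B' : (forall j, j != n -> B' j = B j) -> i != n' ->
      mixed n.+1 B i w = mixed n B' i w.
    move=> B'B; rewrite -val_eqE/= => ni; rewrite /mixed ltnS leq_eqVlt (negbTE ni)/=.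
    by case: ifP => // _; rewrite B'B.
  apply: (@cexpect_cis_mul _ _ _ _ _ _ _ (2 ^+ N)) => //.
  - apply: cmeasurable_prod => i; rewrite /mixed.
    case: (i < n.+1)%N; first exact: cmeasurable_cis.
    by apply: cmeasurable_rc; exact: (measurableT_comp (measurable_indic (mB _))).
  - move=> w; rewrite /V.
    have sN : size (index_enum 'I_N) = N by rewrite -[RHS]card_ord cardE enumT.
    rewrite -[X in _ <= _ ^+ X]sN; apply: norm1_prod => i; rewrite /mixed.
    case: (i < n.+1)%N; first exact: norm1_cis.
    rewrite /norm1/= normr0 addr0 indicE.
    by case: (_ \in _); rewrite ?normr1 ?normr0 ?ler1n.
  move=> C mC; pose B' j := if j == n then C else B j.
  have mB' j : measurable (B' j) by rewrite /B'; case: ifP.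
  have B'B j : j != n -> B' j = B j by rewrite /B' => /negbTE ->.
  have B'n : B' n = C by rewrite /B' eqxx.
  have := ih B' (ltnW nN) mB'.
  rewrite (bigD1 n')//= ltnn B'n.
  have -> : (fun w => \prod_(i < N) mixed n B' i w) = (fun w => rc (\1_C (Y n w)) * V w).
    apply/funext => w; rewrite (bigD1 n')//= {1}/mixed/= ltnn B'n; congr (_ * _).
    by apply: eq_bigr => i ni; rewrite (mixedS _ _ _ B'B ni).
  move=> ->; congr (_ * _); apply: eq_bigr => i.
  rewrite -val_eqE/= => ni; rewrite [(i < n.+1)%N]ltnS [(i <= n)%N]leq_eqVlt (negbTE ni)/=.
  by case: ifP => // _; rewrite B'B.
have := main N (fun=> setT) (leqnn N) (fun=> measurableT).
rewrite (eq_bigr (fun i : 'I_N => cexpect P (fun w => cis (Y i w)))); last first.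
  by move=> i _; rewrite ltn_ord.
move=> <-; congr (cexpect P _); apply/funext => w.
rewrite (eq_bigr (fun i : 'I_N => cis (Y i w))); last first.
  by move=> i _; rewrite /mixed ltn_ord.
elim: N {main} => [|k ihk]; first by rewrite !big_ord0 [cis 0]cis0.
by rewrite !big_ord_recr/= cisD ihk.
Qed.

End independence.

(** * Convergence in probability and characteristic functions *)

Section convergence_in_probability.
Context d (T : measurableType d) (R : realType) (P : probability T R).
Implicit Types (X : nat -> T -> R) (Y : T -> R).

Definition cvg_prob X Y := forall eps eta : R, 0 < eps -> 0 < eta ->
  \forall m \near \oo, (P [set w | (eps < `|X m w - Y w|)%R] < eta%:E)%E.

Lemma measurable_gt_norm (g : T -> R) (eps : R) : measurable_fun setT g ->
  measurable [set w | eps < `|g w|].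
Proof.
move=> mg.
rewrite [X in measurable X](_ : _ = (fun w => `|g w|) @^-1` `]eps, +oo[); last first.
  by apply/seteqP; split => z /=; rewrite in_itv/= andbT.
have mn : measurable_fun setT (fun w => `|g w|) by exact: measurableT_comp.
by rewrite -[X in measurable X]setTI; exact: mn.
Qed.

Lemma cvg_prob_cst Y : cvg_prob (fun=> Y) Y.
Proof.
move=> eps eta e0 n0; apply: nearW => m.
rewrite (_ : [set w | _] = set0) ?measure0 ?lte_fin//.
by rewrite -subset0 => w /=; rewrite subrr normr0 ltNge ltW.
Qed.

Lemma cvg_probD X X' Y Y' : (forall m, measurable_fun setT (X m)) ->
  (forall m, measurable_fun setT (X' m)) -> measurable_fun setT Y ->
  measurable_fun setT Y' -> cvg_prob X Y -> cvg_prob X' Y' ->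
  cvg_prob (fun m w => X m w + X' m w) (fun w => Y w + Y' w).
Proof.
move=> mX mX' mY mY' cX cX' eps eta e0 n0.
have e2 : 0 < eps / 2 by rewrite divr_gt0.
have n2 : 0 < eta / 2 by rewrite divr_gt0.
near=> m.
pose A := [set w | eps / 2 < `|X m w - Y w|].
pose A' := [set w | eps / 2 < `|X' m w - Y' w|].
have mA : measurable A by apply: measurable_gt_norm; exact: measurable_funB.
have mA' : measurable A' by apply: measurable_gt_norm; exact: measurable_funB.
apply: (@le_lt_trans _ _ (P (A `|` A'))).
  apply: le_measure; rewrite ?inE; [|exact: measurableU|].
    apply: measurable_gt_norm; apply: measurable_funB; exact: measurable_funD.
  move=> w /= h; apply: contrapT => /not_orP[/negP + /negP].
  rewrite -!leNgt => h1 h2; have : eps < eps; last by rewrite ltxx.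
  apply: (lt_le_trans h).
  have -> : X m w + X' m w - (Y w + Y' w) = (X m w - Y w) + (X' m w - Y' w) by ring.
  by rewrite (le_trans (ler_normD _ _))//; lra.
apply: (@le_lt_trans _ _ (P A + P A')%E); first exact: measureU2.
rewrite (splitr eta) EFinD; apply: lteD.
  by rewrite /A; near: m; exact: cX.
by rewrite /A'; near: m; exact: cX'.
Unshelve. all: end_near. Qed.

Lemma cvg_probZ X Y (c : R) : cvg_prob X Y ->
  cvg_prob (fun m w => c * X m w) (fun w => c * Y w).
Proof.
have [->|c0] := eqVneq c 0.
  move=> _ eps eta e0 n0; apply: nearW => m.
  rewrite (_ : [set w | _] = set0) ?measure0 ?lte_fin//.
  by rewrite -subset0 => w /=; rewrite !mul0r subrr normr0 ltNge ltW.
move=> cX eps eta e0 n0.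
have ec : 0 < eps / `|c| by rewrite divr_gt0// normr_gt0.
apply: filterS (cX _ _ ec n0) => m.
congr (P _ < _)%E; apply/seteqP; split => w /=;
  by rewrite -mulrBr normrM ltr_pdivrMr ?normr_gt0// mulrC.
Qed.

Lemma cvg_prob_sum (I : Type) (s : seq I) (X : I -> nat -> T -> R) (Y : I -> T -> R) :
  (forall i m, measurable_fun setT (X i m)) -> (forall i, measurable_fun setT (Y i)) ->
  (forall i, cvg_prob (X i) (Y i)) ->
  cvg_prob (fun m w => \sum_(i <- s) X i m w) (fun w => \sum_(i <- s) Y i w).
Proof.
move=> mX mY cX; elim: s => [|i s ih].
  rewrite (_ : (fun m w => _) = (fun=> cst 0)); last first.
    by apply/funext => m; apply/funext => w; rewrite big_nil.
  rewrite (_ : (fun w => _) = cst 0); last by apply/funext => w; rewrite big_nil.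
  exact: cvg_prob_cst.
rewrite (_ : (fun m w => _) = (fun m w => X i m w + \sum_(i <- s) X i m w)); last first.
  by apply/funext => m; apply/funext => w; rewrite big_cons.
rewrite (_ : (fun w => _) = (fun w => Y i w + \sum_(i <- s) Y i w)); last first.
  by apply/funext => w; rewrite big_cons.
by apply: cvg_probD => // [m|]; exact: measurable_sum.
Qed.

Lemma normr_subcos_le (a b : R) : `|cos a - cos b| <= `|a - b|.
Proof.
have -> : cos a - cos b = - 2 * sin ((a + b) / 2) * sin ((a - b) / 2).
  have e1 : cos a = cos ((a + b) / 2 + (a - b) / 2) by congr cos; field.
  have e2 : cos b = cos ((a + b) / 2 - (a - b) / 2) by congr cos; field.
  by rewrite e1 e2 cosD cosB; ring.
have h1 : `|sin ((a + b) / 2)| <= 1 by rewrite ler_norml sin_geN1 sin_le1.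
have h2 := normr_sin_le ((a - b) / 2).
have -> : `|a - b| = 2 * `|(a - b) / 2|.
  by rewrite normrM (@ger0_norm _ 2^-1)//; field.
rewrite -mulrA !normrM normrN (@ger0_norm _ 2)// ler_wpM2l//.
by rewrite normrM in h2; apply: le_trans h2; rewrite ler_piMl.
Qed.

Lemma normr_subsin_le (a b : R) : `|sin a - sin b| <= `|a - b|.
Proof.
rewrite -!cosBpihalf; have := normr_subcos_le (a - pi / 2) (b - pi / 2).
by have -> : a - pi / 2 - (b - pi / 2) = a - b by ring.
Qed.

Lemma cvg_prob_Rintegral X Y (g : R -> R) : (forall m, measurable_fun setT (X m)) ->
  measurable_fun setT Y -> measurable_fun setT g -> (forall a, `|g a| <= 1) ->
  (forall a b, `|g a - g b| <= `|a - b|) -> cvg_prob X Y ->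
  \int[P]_w g (X m w) @[m --> \oo] --> \int[P]_w g (Y w).
Proof.
move=> mX mY mg g1 gL cX; apply/cvgrPdist_le => e e0.
have e2 : 0 < e / 2 by rewrite divr_gt0.
have e4 : 0 < e / 4 by rewrite divr_gt0.
near=> m.
have igX : P.-integrable setT (EFin \o (fun w => g (X m w))).
  by apply: (@integrable_P _ _ _ _ _ 1) => //; exact: measurableT_comp.
have igY : P.-integrable setT (EFin \o (fun w => g (Y w))).
  by apply: (@integrable_P _ _ _ _ _ 1) => //; exact: measurableT_comp.
rewrite -RintegralB//.
have iB : P.-integrable setT (EFin \o (fun w => g (Y w) - g (X m w))).
  by rewrite /comp; under eq_fun do rewrite EFinB; exact: integrableB.
apply: (le_trans (le_normr_Rintegral measurableT iB)).
pose A := [set w | e / 2 < `|X m w - Y w|].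
have mA : measurable A by apply: measurable_gt_norm; exact: measurable_funB.
have iA : P.-integrable setT (EFin \o (fun w => (\1_A w : R))).
  apply: (@integrable_P _ _ _ _ _ 1); first exact: measurable_indic.
  by move=> w; rewrite indicE; case: (_ \in _); rewrite ?normr1 ?normr0.
have i2A : P.-integrable setT (EFin \o (fun w => 2 * (\1_A w : R))).
  by rewrite /comp; under eq_fun do rewrite EFinM; exact: integrableZl.
have ic : P.-integrable setT (EFin \o cst (e / 2)).
  by apply: (@integrable_P _ _ _ _ _ `|e / 2|).
(* Off [A] the Lipschitz bound gives [e / 2]; on [A] the difference is at most 2, and [A] has
   probability below [e / 4]. *)
apply: (@le_trans _ _ (\int[P]_w (e / 2 + 2 * \1_A w))).
  apply: le_Rintegral => //; first exact: integrable_norm.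
    by rewrite /comp; under eq_fun do rewrite EFinD; exact: integrableD.
  move=> w _; rewrite indicE; case: (boolP (w \in A)) => [_|].
    rewrite mulr1 (le_trans (ler_normB _ _))// (le_trans (lerD (g1 _) (g1 _)))//.
    by rewrite -[leLHS]add0r lerD2r ltW.
  rewrite notin_setE /A /= => /negP; rewrite -leNgt => h.
  by rewrite mulr0 addr0 (le_trans (gL _ _))// distrC.
have -> : \int[P]_w (e / 2 + 2 * \1_A w) =
    \int[P]_w (e / 2) + \int[P]_w (2 * \1_A w) by exact: RintegralD.
have -> : \int[P]_w (2 * \1_A w) = 2 * \int[P]_w (\1_A w : R) by exact: RintegralZl.
have -> : \int[P]_w (e / 2) = e / 2.
  have PT : fine (P setT) = 1 by rewrite probability_setT.
  have := @Rintegral_cst _ _ _ P setT measurableT (e / 2).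
  by rewrite PT mulr1.
rewrite {2}(splitr e) lerD2l.
have -> : \int[P]_w (\1_A w : R) = fine (P A).
  by rewrite /Rintegral integral_indic// setIT.
have : (P A < (e / 4)%:E)%E by rewrite /A; near: m; exact: cX.
rewrite -{1}(fineK (fin_num_measure P A mA)) lte_fin; lra.
Unshelve. all: end_near. Qed.

Lemma cvg_prob_cis X Y : (forall m, measurable_fun setT (X m)) ->
  measurable_fun setT Y -> cvg_prob X Y ->
  ccvg (fun m => cexpect P (fun w => cis (X m w))) (cexpect P (fun w => cis (Y w))).
Proof.
move=> mX mY cX; split => /=; apply: cvg_prob_Rintegral => //.
- by apply: continuous_measurable_fun; exact: continuous_cos.
- by move=> a; rewrite ler_norml cos_geN1 cos_le1.
- exact: normr_subcos_le.
- by apply: continuous_measurable_fun; exact: continuous_sin.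
- by move=> a; rewrite ler_norml sin_geN1 sin_le1.
- exact: normr_subsin_le.
Qed.

End convergence_in_probability.

Section ornstein_uhlenbeck_coordinate.
Context d (T : measurableType d) (R : realType) (P : probability T R).
Variables (Z : R -> {RV P >-> R}) (nu : {measure set (measurableTypeR R) -> \bar R}).
Variables (gamma t : R).
Hypothesis HZ : pure_jump_levy_process Z nu.
Hypothesis t0 : 0 < t.

Definition riemann_rv m (w : T) : R := \sum_(k < m.+1)
  weight gamma t m k * (Z (grid t m k.+1) w - Z (grid t m k) w).

Let gridS m k : grid t m k.+1 = grid t m k + t / m.+1%:R.
Proof. by rewrite /grid -natr1 mulrDl mul1r. Qed.

Let step_gt0 m : 0 < t / m.+1%:R. Proof. by rewrite divr_gt0. Qed.

Let grid_partition m := [seq grid t m k.+1 | k <- iota 0 m.+1].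

Let nth_partition m k : (k <= m.+1)%N ->
  nth t (0 :: grid_partition m) k = grid t m k.
Proof.
case: k => [_|k km]; first by rewrite /grid mul0r.
by rewrite /= (nth_map 0%N) ?size_iota// nth_iota.
Qed.

Let size_partition m : size (grid_partition m) = m.+1.
Proof. by rewrite size_map size_iota. Qed.

Let partitionP m : itv_partition 0 t (grid_partition m).
Proof.
split.
  apply/(pathP t) => k; rewrite size_partition => km.
  have := @nth_partition m k.+1 km; rewrite /= => ->.
  by rewrite nth_partition ?(ltnW km)// gridS ltrDl.
suff : last 0 (grid_partition m) = t by move/eqP.
rewrite (last_nth t) size_partition nth_partition// /grid mulrCA divff ?mulr1//.
Qed.

Lemma riemann_rv_cvg (J : T -> R) :
  is_stoch_integral (fun s => expR (- (gamma * (t - s)))) Z 0 t J ->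
  cvg_prob P riemann_rv J.
Proof.
move=> HJ eps eta e0 n0; have [delta d0 H] := HJ _ _ e0 n0.
have dt0 : 0 < delta / t by rewrite divr_gt0.
near=> m.
have mesh : mesh_lt 0 t (grid_partition m) delta.
  move=> k; rewrite size_partition => km.
  have := @nth_partition m k.+1 km; rewrite /= => ->.
  rewrite nth_partition ?(ltnW km)// gridS addrAC subrr add0r.
  rewrite mulrC -ltr_pdivlMr//; near: m.
  exact: near_infty_natSinv_lt (PosNum dt0).
have := H _ (partitionP m) mesh; congr (P _ < _)%E.
apply/seteqP; split => w /=; rewrite /riemann_sum size_partition big_mkord;
  congr (_ < `|_ - _|); apply: eq_bigr => k _;
  have := @nth_partition m k.+1 (ltn_ord k); rewrite /= => ->;
  by rewrite nth_partition ?(ltnW (ltn_ord k)).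
Unshelve. all: end_near. Qed.

Let mZ s : measurable_fun setT (Z s). Proof. exact: measurable_funPT. Qed.

Lemma measurable_riemann_rv m : measurable_fun setT (riemann_rv m).
Proof.
apply: measurable_sum => k; apply: measurable_funM => //.
exact: measurable_funB.
Qed.

Let cexpect_increment s u c : 0 <= s -> 0 <= u ->
  cexpect P (fun w => cis (c * (Z (s + u) w - Z s w))) =
  cexp (- (rc u * levy_exponent nu c)).
Proof.
have [[_ _ stat _ _] _ charZ] := HZ.
move=> s0 u0; rewrite -charZ//.
have mD : measurable_fun setT (fun w => Z (s + u) w - Z s w) by exact: measurable_funB.
have i1 : P.-integrable setT (EFin \o (cst 1 : T -> R)).
  by apply: (@integrable_P _ _ _ P _ 1) => // w; rewrite normr1.
have law (g : R -> R) : measurable_fun setT g -> (forall z, `|g z| <= 1) ->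
    \int[P]_w g (Z (s + u) w - Z s w) = \int[P]_w g (Z u w).
  move=> mg g1.
  have M1 (v : T -> R) : \int[P]_w (v w * cst 1 w) = \int[P]_w v w.
    by apply: eq_Rintegral => w _; rewrite mulr1.
  rewrite -M1 -[RHS]M1.
  apply: (@eq_Rintegral_from_indic _ _ _ _ _ _ _ P P (cst 1) (cst 1)
    _ _ mD (mZ u) i1 i1) => // B mB.
  rewrite M1 [RHS]M1.
  have ind (Y : T -> R) : measurable_fun setT Y ->
      \int[P]_w (\1_B (Y w) : R) = fine (P [set w | B (Y w)]).
    move=> mY; rewrite -[in RHS](setIT [set w | _]) -integral_indic//.
    by rewrite -[X in measurable X]setTI; exact: mY.
  by rewrite !ind// stat.
rewrite /cexpect /char_fun; congr Complex.
- apply: (law (fun z => cos (c * z))); last first.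
    by move=> z; rewrite ler_norml cos_geN1 cos_le1.
  by apply: continuous_measurable_fun; exact: continuous_cosM.
- apply: (law (fun z => sin (c * z))); last first.
    by move=> z; rewrite ler_norml sin_geN1 sin_le1.
  by apply: continuous_measurable_fun; exact: continuous_sinM.
Qed.

Lemma cexpect_riemann_rv m h :
  cexpect P (fun w => cis (h * riemann_rv m w)) = riemann_char nu gamma t m h.
Proof.
have [[_ indep _ _ _] _ _] := HZ.
have g0 : 0 <= grid t m 0 by rewrite /grid mul0r.
have gm k : grid t m k <= grid t m k.+1 by rewrite gridS lerDl ltW.
pose X k w := Z (grid t m k.+1) w - Z (grid t m k) w.
pose Y k w := weight gamma t m k * h * X k w.
have mX k : measurable_fun setT (X k) by exact: measurable_funB.
have mY k : measurable_fun setT (Y k) by exact: measurable_funM.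
have FY k B : measurable B ->
    sigma_of [set k] (fun j w => Z (grid t m j.+1) w - Z (grid t m j) w) (Y k @^-1` B).
  move=> mB; apply: sub_sigma_algebra; exists k => //.
  exists ((fun z => weight gamma t m k * h * z) @^-1` B); last by rewrite setTI.
  rewrite -[X in measurable X]setTI.
  have mc : measurable_fun setT (fun z : R => weight gamma t m k * h * z).
    exact: measurable_funM.
  exact: mc.
have := cexpect_cis_sum (indep (grid t m) g0 gm) mY FY m.+1.
under [in LHS]eq_fun do under eq_bigr do rewrite /Y mulrAC mulrC.
under [in LHS]eq_fun do rewrite -big_distrr/=.
move=> ->; apply: eq_bigr => k _.
rewrite /Y /X gridS cexpect_increment// ?(ltW (step_gt0 m))//.
by rewrite /grid mulr_ge0// ltW// step_gt0.
Qed.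

End ornstein_uhlenbeck_coordinate.

Section pairing_cexpect.
Context d (T : measurableType d) (R : realType) (P : probability T R).

Lemma integrable_pairing (K : Type) (V : K -> T -> R[i]) (p : seq (R[i] * K)) :
  (forall h, cmeasurable (V h)) -> (forall h w, norm1 (V h w) <= 2) ->
  P.-integrable setT (EFin \o (fun w => pairing (V ^~ w) p)).
Proof.
move=> mV V2; apply: (@integrable_P _ _ _ P _ (\sum_(t <- p) norm1 t.1 * 2)).
  apply: measurable_sum => t; under eq_fun do rewrite Re_mulc.
  have [mR mI] := mV t.2.
  by apply: measurable_funB; exact: measurable_funM.
move=> w; rewrite (le_trans (ler_norm_sum _ _ _))//; apply: ler_sum => t _.
rewrite (le_trans (Re_le_norm1 _))// (le_trans (norm1M _ _))//.
by rewrite ler_wpM2l ?norm1_ge0.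
Qed.

Lemma pairing_cexpect (K : Type) (V : K -> T -> R[i]) (p : seq (R[i] * K)) :
  (forall h, cmeasurable (V h)) -> (forall h w, norm1 (V h w) <= 2) ->
  pairing (fun h => cexpect P (V h)) p = \int[P]_w pairing (V ^~ w) p.
Proof.
move=> mV V2; elim: p => [|t p ih].
  rewrite /pairing big_nil; under eq_Rintegral do rewrite big_nil.
  by rewrite Rintegral_cst// mul0r.
have -> : \int[P]_w pairing (V ^~ w) (t :: p) =
    \int[P]_w ((complex.Re t.1 * complex.Re (V t.2 w) -
                complex.Im t.1 * complex.Im (V t.2 w)) + pairing (V ^~ w) p).
  by apply: eq_Rintegral => w _; rewrite /pairing big_cons Re_mulc.
have [mR mI] := mV t.2.
have iR : P.-integrable setT (EFin \o (fun w => complex.Re (V t.2 w))).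
  by apply: (@integrable_P _ _ _ P _ 2) => // w; rewrite (le_trans (Re_le_norm1 _)).
have iI : P.-integrable setT (EFin \o (fun w => complex.Im (V t.2 w))).
  by apply: (@integrable_P _ _ _ P _ 2) => // w; rewrite (le_trans (Im_le_norm1 _)).
have iR' : P.-integrable setT (EFin \o (fun w => complex.Re t.1 * complex.Re (V t.2 w))).
  by rewrite /comp; under eq_fun do rewrite EFinM; exact: integrableZl.
have iI' : P.-integrable setT (EFin \o (fun w => complex.Im t.1 * complex.Im (V t.2 w))).
  by rewrite /comp; under eq_fun do rewrite EFinM; exact: integrableZl.
rewrite RintegralD//; last 2 first.
- by rewrite /comp; under eq_fun do rewrite EFinB; exact: integrableB.
- exact: integrable_pairing.
rewrite RintegralB// !RintegralZl// -ih.
by rewrite /pairing big_cons Re_mulc.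
Qed.

End pairing_cexpect.

Lemma chrNE (R : realType) N (x h : nat -> R) :
  chrN N x h = cis (\sum_(n < N) h n * x n).
Proof.
rewrite /chrN /prod_fun; elim: N => [|N ih]; first by rewrite !big_ord0 cis0.
by rewrite !big_ord_recr/= ih cisD.
Qed.

Lemma evN_twist (R : realType) N (b x : nat -> R) p :
  evN N (twist (chrN N b) p) x = evN N p (fun n => b n + x n).
Proof.
rewrite /evN pairing_twist; apply: eq_pairing => h; rewrite !chrNE -cisD.
by rewrite -big_split/=; congr cis; apply: eq_bigr => n _; rewrite mulrDr.
Qed.

Lemma weierstrass_prod (R : realDomainType) N (r : nat -> R) :
  (forall n, 0 <= r n <= 1) -> 1 - \sum_(n < N) (1 - r n) <= \prod_(n < N) r n <= 1.
Proof.
move=> r01; elim: N => [|N /andP[ih1 ih2]]; first by rewrite !big_ord0 subr0 lexx.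
have /andP[r0 r1] := r01 N; rewrite !big_ord_recr/=.
have p0 : 0 <= \prod_(i < N) r i by apply: prodr_ge0 => i _; case/andP: (r01 i).
apply/andP; split; last by rewrite mulr_ile1.
have : 0 <= (1 - \prod_(i < N) r i) * (1 - r N) by rewrite mulr_ge0// subr_ge0.
nra.
Qed.

(** * Joint law of the stochastic integrals *)

Section independent_coordinates.
Context d (T : measurableType d) (R : realType) (P : probability T R).
Variables (Z : nat -> R -> {RV P >-> R}) (J : nat -> {RV P >-> R}).
Variables (nu : nat -> {measure set (measurableTypeR R) -> \bar R}).
Variables (gamma : nat -> R) (f : nat -> R -> R) (t : R).
Hypothesis t0 : 0 < t.
Hypothesis HZ : forall n, pure_jump_levy_process (Z n) (nu n).
Hypothesis HZ_indep : mutually_independent P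
  (fun n : nat => sigma_of [set t : R | 0 <= t] (fun t => Z n t : T -> R)).
Hypothesis HJ : forall n,
  is_stoch_integral (fun s => expR (- (gamma n * (t - s)))) (Z n) 0 t (J n).

Definition coord_char n (h : R) : R[i] := cexpect P (fun w => cis (h * J n w)).

Let S n := riemann_rv (Z n) (gamma n) t.

Let mJ n : measurable_fun setT (J n). Proof. exact: measurable_funPT. Qed.

Let mS n m : measurable_fun setT (S n m). Proof. exact: measurable_riemann_rv. Qed.

Let cS n : cvg_prob P (S n) (J n). Proof. exact: riemann_rv_cvg. Qed.

Let cexpect_coord_cvg n h :
  ccvg (fun m => cexpect P (fun w => cis (h * S n m w))) (coord_char n h).
Proof.
apply: cvg_prob_cis => [m||]; [exact: measurable_funM..|exact: cvg_probZ].
Qed.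

Lemma riemann_char_cvg n h :
  ccvg (fun m => riemann_char (nu n) (gamma n) t m h) (coord_char n h).
Proof.
have := @cexpect_coord_cvg n h.
by under eq_fun do rewrite (cexpect_riemann_rv (gamma n) (HZ n) t0).
Qed.

Let riemann_rv_sigma n m h B : measurable B ->
  sigma_of [set t : R | 0 <= t] (fun t => Z n t : T -> R)
    ((fun w => h * S n m w) @^-1` B).
Proof.
move=> mB.
rewrite /sigma_of; set G := \bigcup_(i in _) _.
have mZ s : 0 <= s -> measurable_fun setT (Z n s : g_sigma_algebraType G -> R).
  move=> s0 _ A mA; apply: sub_sigma_algebra; exists s => //; exists A => //.
have mY : measurable_fun setT ((fun w => h * S n m w) : g_sigma_algebraType G -> R).
  apply: measurable_funM => //; apply: measurable_sum => k.
  have g0 j : 0 <= grid t m j by rewrite /grid mulr_ge0// divr_ge0// ltW.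
  by apply: measurable_funM => //; apply: measurable_funB; exact: mZ.
by have := mY measurableT B mB; rewrite setTI.
Qed.

(** [J n] is only a limit in probability, so it need not be measurable for the sigma-algebra of
    [Z n]. The factorization is proved for the Riemann sums, which are, and passes to the limit. *)
Lemma cexpect_chrN N (h : nat -> R) :
  cexpect P (fun w => chrN N (fun n => J n w) h) = prod_fun N coord_char h.
Proof.
under [in LHS]eq_fun do rewrite chrNE.
have mhS m n : measurable_fun setT (fun w => h n * S n m w) by exact: measurable_funM.
have mhJ n : measurable_fun setT (fun w => h n * J n w) by exact: measurable_funM.
have E m : cexpect P (fun w => cis (\sum_(n < N) h n * S n m w)) =
    \prod_(n < N) cexpect P (fun w => cis (h n * S n m w)).
  exact: (cexpect_cis_sum HZ_indep (mhS m) (fun n B => @riemann_rv_sigma n m (h n) B) N).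
apply: (@ccvg_unique _ (fun m => cexpect P (fun w => cis (\sum_(n < N) h n * S n m w)))).
  apply: cvg_prob_cis => [m||]; [exact: measurable_sum..|].
  apply: cvg_prob_sum => // n; exact: cvg_probZ.
under eq_fun do rewrite E; apply: ccvg_prod => n; exact: cexpect_coord_cvg.
Qed.

Let mchr N a h : cmeasurable (fun w => chrN N (fun n => J n w + a n) h).
Proof.
under eq_fun do rewrite chrNE; apply: cmeasurable_cis.
by apply: measurable_sum => n; apply: measurable_funM => //; exact: measurable_funD.
Qed.

Let mchr0 N h : cmeasurable (fun w => chrN N (fun n => J n w) h).
Proof.
under eq_fun do rewrite chrNE; apply: cmeasurable_cis.
by apply: measurable_sum => n; exact: measurable_funM.
Qed.

Lemma pairing_coord_char N (a : nat -> R) p :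
  pairing (prod_fun N (fun n h => coord_char n h * chr (a n) h)) p =
  \int[P]_w evN N p (fun n => J n w + a n).
Proof.
rewrite -(pairing_cexpect P p (@mchr N a)); last by move=> h w; rewrite chrNE norm1_cis.
apply: eq_pairing => h.
have -> : prod_fun N (fun n h => coord_char n h * chr (a n) h) h =
    prod_fun N coord_char h * chrN N a h by rewrite /prod_fun big_split.
rewrite -cexpect_chrN.
set c := chrN N a h.
have -> : (fun w => chrN N (fun n => J n w + a n) h) =
    (fun w => chrN N (fun n => J n w) h * c).
  apply/funext => w; rewrite /c !chrNE -cisD -big_split/=.
  by congr cis; apply: eq_bigr => n _; rewrite mulrDr.
have [m1 m2] := mchr0 N h.
have b w : norm1 (chrN N (fun n => J n w) h) <= 2 by rewrite chrNE norm1_cis.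
have i1 : P.-integrable setT (EFin \o (fun w => complex.Re (chrN N (fun n => J n w) h))).
  by apply: (@integrable_P _ _ _ P _ 2) => // w; rewrite (le_trans (Re_le_norm1 _)).
have i2 : P.-integrable setT (EFin \o (fun w => complex.Im (chrN N (fun n => J n w) h))).
  by apply: (@integrable_P _ _ _ P _ 2) => // w; rewrite (le_trans (Im_le_norm1 _)).
have iZ (g : T -> R) (k : R) : P.-integrable setT (EFin \o g) ->
    P.-integrable setT (EFin \o (fun w => g w * k)).
  by move=> ig; rewrite /comp; under eq_fun do rewrite EFinM; exact: integrableZr.
apply: eq_ReIm; rewrite ?Re_mulc ?Im_mulc /cexpect/=.
- rewrite -!RintegralZr// -RintegralB//; [|exact: iZ..].
  by apply: eq_Rintegral => w _; rewrite Re_mulc.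
- rewrite -!RintegralZr// -RintegralD//; [|exact: iZ..].
  by apply: eq_Rintegral => w _; rewrite Im_mulc.
Qed.

Lemma pos_type_coord_char n : pos_type (coord_char n).
Proof.
move=> p p0; rewrite (pairing_cexpect P p) => [|h|h w]; last exact: norm1_cis.
  by apply: Rintegral_ge0 => w _; exact: p0.
by apply: cmeasurable_cis; exact: measurable_funM.
Qed.

Lemma coord_char0 n : coord_char n 0 = 1.
Proof.
have PT : fine (P setT) = 1 by rewrite probability_setT.
have C (c : R) : \int[P]_w c = c.
  by have := @Rintegral_cst _ _ _ P setT measurableT c; rewrite PT mulr1.
rewrite /coord_char /cexpect; apply: eq_ReIm => /=.
  by under eq_Rintegral do rewrite mul0r cos0; exact: C.
by under eq_Rintegral do rewrite mul0r sin0; exact: C.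
Qed.

End independent_coordinates.

Section trigonometric_tv.
Context d (T : measurableType d) (R : realType) (P : probability T R).
Variables (Z : nat -> R -> {RV P >-> R}) (J : nat -> {RV P >-> R}).
Variables (nu : nat -> {measure set (measurableTypeR R) -> \bar R}).
Variables (gamma : nat -> R) (f : nat -> R -> R) (t : R).
Hypothesis t0 : 0 < t.
Hypothesis gamma_gt0 : forall n, 0 < gamma n.
Hypothesis HZ : forall n, pure_jump_levy_process (Z n) (nu n).
Hypothesis HZ_indep : mutually_independent P
  (fun n : nat => sigma_of [set t : R | 0 <= t] (fun t => Z n t : T -> R)).
Hypothesis HJ : forall n,
  is_stoch_integral (fun s => expR (- (gamma n * (t - s)))) (Z n) 0 t (J n).
Hypothesis Hf : forall n, bernstein (f n).
Hypothesis Hf0 : forall n, f n 0 = 0.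
Hypothesis Hf_log : forall n, f n r / ln (1 + r) @[r --> +oo] --> +oo.
Hypothesis Hnu : forall n (B : set (measurableTypeR R)), measurable B ->
  (\int[lebesgue_measure]_(z in B) (`|z|^-1 * f n (z ^- 2))%:E <= nu n B)%E.
Variable K : R.
Hypothesis K0 : 0 <= K.
Hypothesis HK : forall k, (mine
  (\int[lebesgue_measure]_(r in `[0%R, +oo[) (expR (- (cos 1 / 2 * t * f k r)))%:E)
  ((expR (- (gamma k * t)))%:E *
   \int[lebesgue_measure]_(r in `[0%R, +oo[)
     (expR (- (cos 1 * (1 - expR (- (2 * gamma k * t))) / (4 * gamma k) * f k r)))%:E)
  <= K%:E)%E.

(** The maximum with 0 is taken because the product bound squares nonnegative affinities; the value
    0 is a bound by positive type alone. Otherwise [K] dominates one of the two terms, which makes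
    its integral finite and selects the estimate. *)
Lemma coord_affinity n zeta : affinity_ge (coord_char J n)
  (expR (- (gamma n * t)) * zeta) (Num.max 0 (1 - zeta ^+ 2 / 4 * K)).
Proof.
have phiP := riemann_char_cvg t0 HZ HJ n.
have z0 : 0 <= zeta ^+ 2 / 4 by rewrite divr_ge0// sqr_ge0.
have [_|_] := leP (1 - zeta ^+ 2 / 4 * K) 0.
  move=> p q p0 q0 _; rewrite mulr0 addr_ge0//; first exact: (pos_type_coord_char J n).
  exact: (pos_typeM (@pos_type_coord_char _ _ _ _ J n) (pos_type_chr _)).
have lnu : levy_measure (nu n) by case: (HZ n).
have := HK n; rewrite ge_min => /orP[IK|IK].
- set I := integral _ _ _ in IK.
  have Ifin : I \is a fin_num.
    by rewrite ge0_fin_numE ?(le_lt_trans IK) ?ltry//; apply: integral_ge0 => r _; rewrite lee_fin expR_ge0.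
  have := affinity_slow lnu (Hf n) (Hf0 n) (@Hf_log n) (@Hnu n) (gamma_gt0 n) t0 phiP zeta
    (esym (fineK Ifin)).
  apply: affinity_ge_le; rewrite lerD2l lerN2 ler_wpM2l//.
  by rewrite -lee_fin fineK.
- set I := integral _ _ _ in IK.
  have I0 : (0 <= I)%E by apply: integral_ge0 => r _; rewrite lee_fin expR_ge0.
  have Ifin : I \is a fin_num.
    rewrite ge0_fin_numE//; rewrite ltey; apply/negP => /eqP Ioo.
    by move: IK; rewrite Ioo gt0_muley ?lte_fin ?expR_gt0// leye_eq.
  have := affinity_fast lnu (Hf n) (Hf0 n) (@Hf_log n) (@Hnu n) (gamma_gt0 n) t0 phiP zeta
    (esym (fineK Ifin)).
  apply: affinity_ge_le; rewrite lerD2l lerN2 ler_wpM2l//.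
  by rewrite -lee_fin EFinM fineK.
Qed.

(** The common offset [b] is absorbed by twisting [p], which preserves its sup bound. The estimate
    does not depend on [N]. *)
Lemma trigonometric_tv N (zeta b : nat -> R) (S : R) p :
  \sum_(n < N) zeta n ^+ 2 <= S -> (forall x, `|evN N p x| <= 1) ->
  `| \int[P]_w evN N p (fun n => b n + (J n w + expR (- (gamma n * t)) * zeta n)) -
     \int[P]_w evN N p (fun n => b n + J n w) | <= Num.sqrt (2 * K * S).
Proof.
move=> zS p1.
have S0 : 0 <= S by apply: le_trans zS; apply: sumr_ge0 => n _; exact: sqr_ge0.
pose a n := expR (- (gamma n * t)) * zeta n.
pose rho n := Num.max 0 (1 - zeta n ^+ 2 / 4 * K).
have z0 n : 0 <= zeta n ^+ 2 / 4 * K by rewrite mulr_ge0// divr_ge0// sqr_ge0.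
have rho0 n : 0 <= rho n by rewrite le_max lexx.
have rho1 n : rho n <= 1 by rewrite /rho ge_max ler01/= gerBl z0.
have rho2 n : 0 <= rho n ^+ 2 <= 1 by rewrite sqr_ge0 exprn_ile1.
(* Since [rho n ^+ 2 >= 1 - zeta n ^+ 2 * K / 2], the product of the squares is at least
   [1 - K * S / 2], and [2 * sqrt (K * S / 2) = sqrt (2 * K * S)]. *)
have d0 : 0 <= K * S / 2 by rewrite divr_ge0// mulr_ge0.
have prodrho : 1 - K * S / 2 <= (\prod_(n < N) rho n) ^+ 2.
  rewrite -prodrXl; have /andP[+ _] := @weierstrass_prod _ N (fun n => rho n ^+ 2) rho2.
  apply: le_trans; rewrite lerD2l lerN2.
  apply: (@le_trans _ _ (\sum_(n < N) (K / 2) * zeta n ^+ 2)).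
    apply: ler_sum => n _; have := z0 n; rewrite /rho.
    have -> : K / 2 * zeta n ^+ 2 = 2 * (zeta n ^+ 2 / 4 * K) by field.
    move: (_ / 4 * K) => u u0; case: (leP (1 - u) 0) => ?; nra.
  have -> : K * S / 2 = K / 2 * S by field.
  by rewrite -big_distrr/= ler_wpM2l ?divr_ge0.
have q1 x : `|evN N (twist (chrN N b) p) x| <= 1 by rewrite evN_twist.
have := prod_fun_tv (fun n _ => @coord_affinity n (zeta n))
  (fun n => @pos_type_coord_char _ _ _ _ J n) (coord_char0 J) rho0 d0 prodrho q1.
have -> : 2 * Num.sqrt (K * S / 2) = Num.sqrt (2 * K * S).
  have -> : 2 * K * S = 2 ^+ 2 * (K * S / 2) by field.
  by rewrite (sqrtrM _ (sqr_ge0 2)) sqrtr_sqr ger0_norm.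
rewrite (pairing_coord_char t0 HZ_indep HJ N a).
have -> : pairing (prod_fun N (coord_char J)) (twist (chrN N b) p) =
    \int[P]_w evN N p (fun n => b n + J n w).
  transitivity (pairing (prod_fun N (fun n h => coord_char J n h * chr 0 h)) (twist (chrN N b) p)).
    apply: eq_pairing => h; apply: eq_bigr => n _.
    by rewrite /chr mulr0 cis0 mulr1.
  rewrite (pairing_coord_char t0 HZ_indep HJ N (fun=> 0)).
  apply: eq_Rintegral => w _; rewrite evN_twist.
  by congr (evN N p); apply/funext => n; rewrite addr0.
rewrite (_ : \int[P]_w evN N (twist _ _) _ =
   \int[P]_w evN N p (fun n => b n + (J n w + a n)))//.
by apply: eq_Rintegral => w _; rewrite evN_twist.
Qed.

End trigonometric_tv.

(** * From trigonometric polynomials to Borel functions *)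


Section trigfun.
Variable R : realType.
Implicit Types (f g : (nat -> R) -> R) (x : nat -> R).

Definition trigfun f := exists N (p : seq (R[i] * (nat -> R))), f =1 evN N p.

Lemma evN_widen M N (p : seq (R[i] * (nat -> R))) : (N <= M)%N ->
  exists q, evN N p =1 evN M q.
Proof.
move=> NM; exists [seq (t.1, fun n => if (n < N)%N then t.2 n else 0) | t <- p] => x.
rewrite /evN /pairing big_map; apply: eq_bigr => t _ /=; rewrite !chrNE.
congr (complex.Re (_ * cis _)).
rewrite (big_ord_widen _ (fun n => t.2 n * x n) NM) big_mkcond/=.
by apply: eq_bigr => n _; case: ifP => _; rewrite ?mul0r.
Qed.

Lemma trigfun_common f g : trigfun f -> trigfun g ->
  exists N p q, f =1 evN N p /\ g =1 evN N q.
Proof.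
move=> [N [p fp]] [M [q gq]].
have [p' pp'] := evN_widen p (leq_maxl N M).
have [q' qq'] := evN_widen q (leq_maxr N M).
by exists (maxn N M), p', q'; split => x; rewrite ?fp ?gq.
Qed.

Lemma eq_trigfun f g : f =1 g -> trigfun f -> trigfun g.
Proof. by move=> fg [N [p fp]]; exists N, p => x; rewrite -fg. Qed.

Lemma trigfun_cst (c : R) : trigfun (fun=> c).
Proof. by exists 0%N, [:: (rc c, fun=> 0)] => x; rewrite evN_const. Qed.

Lemma trigfunD f g : trigfun f -> trigfun g -> trigfun (fun x => f x + g x).
Proof.
move=> ff gg; have [N [p [q [fp gq]]]] := trigfun_common ff gg.
by exists N, (p ++ q) => x; rewrite fp gq /evN pairing_cat.
Qed.

(** [Re a * Re b] is half of [Re (a b) + Re (a conj b)], and conjugating a character negates its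
    frequency. *)
Lemma trigfunM f g : trigfun f -> trigfun g -> trigfun (fun x => f x * g x).
Proof.
move=> ff gg; have [N [p [q [fp gq]]]] := trigfun_common ff gg.
pose conj (z : R[i]) : R[i] := Complex (complex.Re z) (- complex.Im z).
pose r := [seq (s.1 * t.1, fun n => s.2 n + t.2 n) | s <- p, t <- q] ++
          [seq (s.1 * conj t.1, fun n => s.2 n - t.2 n) | s <- p, t <- q].
exists N, (scale (1 / 2) r) => x.
rewrite fp gq /evN pairing_scale pairing_cat /pairing !big_allpairs_dep/=.
rewrite big_distrl/= -big_split/= big_distrr/=; apply: eq_bigr => s _.
rewrite big_distrr/= -big_split/= big_distrr/=; apply: eq_bigr => t _.
have e1 : chrN N x (fun n => s.2 n + t.2 n) = chrN N x s.2 * chrN N x t.2.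
  by rewrite !chrNE -cisD -big_split/=; congr cis; apply: eq_bigr => n _; rewrite mulrDl.
have e2 : chrN N x (fun n => s.2 n - t.2 n) = chrN N x s.2 * conj (chrN N x t.2).
  rewrite !chrNE.
  have -> : conj (cis (\sum_(n < N) t.2 n * x n)) = cis (- \sum_(n < N) t.2 n * x n).
    by rewrite /cis /conj/= cosN sinN.
  rewrite -cisD -sumrB; congr cis; apply: eq_bigr => n _; rewrite mulrBl//.
rewrite {}e1 {}e2; move: (chrN N x s.2) (chrN N x t.2) => z w.
by rewrite !(Re_mulc, Im_mulc)/=; field.
Qed.

Lemma trigfunZ (c : R) f : trigfun f -> trigfun (fun x => c * f x).
Proof. by apply: trigfunM; exact: trigfun_cst. Qed.

Lemma trigfunB f g : trigfun f -> trigfun g -> trigfun (fun x => f x - g x).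
Proof.
move=> ff gg; apply: eq_trigfun (trigfunD ff (trigfunZ (-1) gg)) => x.
by rewrite mulN1r.
Qed.

Lemma trigfunX n f : trigfun f -> trigfun (fun x => f x ^+ n).
Proof.
move=> ff; elim: n => [|n ih]; first exact: trigfun_cst.
by apply: eq_trigfun (trigfunM ff ih) => x; rewrite exprS.
Qed.

Lemma trigfun_sin n (c : R) : trigfun (fun x => sin (c * x n)).
Proof.
exists n.+1, [:: (Complex 0 (-1), fun k => if k == n then c else 0)] => x.
rewrite /evN /pairing big_seq1 chrNE big_ord_recr/= eqxx big1 ?add0r; last first.
  by move=> i _; rewrite (ltn_eqF (ltn_ord i)) mul0r.
by rewrite /=; ring.
Qed.

End trigfun.

Lemma mulrn_geometric_cvg0 (R : realType) (q : R) : 0 <= q < 1 ->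
  n%:R * q ^+ n @[n --> \oo] --> 0.
Proof.
move=> /andP[q0 q1]; pose r := Num.sqrt q.
have r0 : 0 <= r by exact: sqrtr_ge0.
have r1 : r < 1 by rewrite -sqrtr1 ltr_sqrt.
have qr : q = r * r by rewrite -expr2 sqr_sqrtr.
have bern n (u : R) : 0 <= u -> 1 + n%:R * u <= (1 + u) ^+ n.
  move=> u0; elim: n => [|n ih]; first by rewrite mul0r addr0.
  rewrite exprS -natr1; have n0 : 0 <= n%:R :> R by []; have := ler_wpM2l (addr_ge0 ler01 u0) ih.
  by apply: le_trans; nra.
have nr n : n%:R * r ^+ n <= (1 - r)^-1.
  rewrite -[leRHS]mul1r ler_pdivlMr ?subr_gt0//.
  have h1 : 1 + n%:R * (1 - r) <= (1 + (1 - r)) ^+ n by apply: bern; rewrite subr_ge0 ltW.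
  have h2 : r ^+ n * (1 + (1 - r)) ^+ n <= 1.
    by rewrite -exprMn exprn_ile1// ?mulr_ge0//; nra.
  have := ler_wpM2l (exprn_ge0 n r0) h1; have := exprn_ge0 n r0.
  by move: (r ^+ n) h2 => y h2; nra.
apply: (@squeeze_cvgr _ _ _ _ (fun=> 0) (fun n => (1 - r)^-1 * r ^+ n)).
- apply: nearW => n; rewrite mulr_ge0 ?exprn_ge0//=.
  by rewrite qr exprMn mulrA ler_wpM2r// exprn_ge0.
- exact: cvg_cst.
- rewrite -[X in _ --> X](mulr0 (1 - r)^-1); apply: cvgMr.
  by apply: cvg_expr; rewrite ger0_norm.
Qed.

(** Polynomials in [v] that converge to a step. Below 1/2, Bernoulli gives at least [1 - n (2 v)^n].
    From 1/2 on, [(1 - v^n)^(2^n) <= (1 + v^n)^-(2^n) <= 1/2], and the extra exponent [n] sends this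
    to 0, including at [v = 1/2]. *)
Lemma indic_lt_half_cvg (R : realType) (v : R) : 0 <= v <= 1 ->
  (1 - v ^+ n) ^+ (n * 2 ^ n) @[n --> \oo] --> ((v < 1 / 2)%R%:R : R).
Proof.
move=> /andP[v0 v1].
have vn0 n : 0 <= v ^+ n by exact: exprn_ge0.
have vn1 n : 0 <= 1 - v ^+ n <= 1 by rewrite subr_ge0 exprn_ile1//= gerBl.
have bernN n (y : R) : 0 <= y <= 1 -> 1 - n%:R * y <= (1 - y) ^+ n.
  move=> /andP[y0 y1]; have y' (k : nat) : 0 <= 1 - y <= 1 by rewrite subr_ge0 y1 gerBl.
  have /andP[+ _] := weierstrass_prod n y'.
  by rewrite prodr_const card_ord sumr_const card_ord opprB addrCA subrr addr0 mulr_natl.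
have [vh|vh] := ltP v (1 / 2).
  have q01 : 0 <= 2 * v < 1 by lra.
  have h : (1 - n%:R * (2 * v) ^+ n @[n --> \oo] --> (1 : R))%R.
    rewrite -[X in _ --> X]subr0.
    by apply: cvgB; [exact: cvg_cst|exact: mulrn_geometric_cvg0].
  apply: (squeeze_cvgr _ h (@cvg_cst _ (1 : R) _ \oo _)); apply: nearW => n.
  have /andP[a b] := vn1 n; rewrite exprn_ile1// andbT.
  have vv : 0 <= v ^+ n <= 1 by rewrite vn0 exprn_ile1.
  apply: le_trans (bernN _ _ vv).
  by rewrite natrM natrX exprMn mulrA.
have h : (2^-1 : R) ^+ n @[n --> \oo] --> 0.
  by apply: cvg_expr; rewrite ger0_norm ?invr_ge0// invf_lt1 ?ltr1n.
apply: (squeeze_cvgr _ (@cvg_cst _ (0 : R) _ \oo _) h); apply: nearW => n.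
have /andP[a b] := vn1 n; rewrite exprn_ge0//= mulnC exprM.
apply: lerXn2r; rewrite ?nnegrE ?exprn_ge0 ?invr_ge0//.
have h1 : 2 <= (1 + v ^+ n) ^+ (2 ^ n).
  have : 1 <= (2 ^ n)%:R * v ^+ n :> R.
    by rewrite natrX -exprMn exprn_ege1//; lra.
  have bern k (u : R) : 0 <= u -> 1 + k%:R * u <= (1 + u) ^+ k.
    move=> u0; elim: k => [|k ih]; first by rewrite mul0r addr0.
    rewrite exprS -natr1; have k0 : 0 <= k%:R :> R by []; have := ler_wpM2l (addr_ge0 ler01 u0) ih.
    by apply: le_trans; nra.
  by have := bern (2 ^ n)%N _ (vn0 n); lra.
have h2 : (1 - v ^+ n) ^+ (2 ^ n) * (1 + v ^+ n) ^+ (2 ^ n) <= 1.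
  by rewrite -exprMn exprn_ile1//; nra.
have h3 := exprn_ge0 (2 ^ n)%N a.
by move: ((1 - v ^+ n) ^+ (2 ^ n)) ((1 + v ^+ n) ^+ (2 ^ n)) h1 h2 h3 => y z *; nra.
Qed.

(** * L^1 approximation, simultaneous for the two laws indexed by [bool] *)

Section approximation.
Context d (T : measurableType d) (R : realType) (P : probability T R).
Variables (Y : bool -> T -> nat -> R).
Hypothesis mY : forall b n, measurable_fun setT (fun w => Y b w n).
Implicit Types (f g : (nat -> R) -> R) (B : set (nat -> R)).

Lemma Rintegral_bounded_cvg0 (h : nat -> T -> R) :
  (forall k, measurable_fun setT (h k)) -> (forall k w, `|h k w| <= 1) ->
  (forall w, h k w @[k --> \oo] --> 0) -> \int[P]_w h k w @[k --> \oo] --> 0.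
Proof.
move=> mh h1 h0.
have i1 : P.-integrable setT (EFin \o (cst 1 : T -> R)).
  by apply: (@integrable_P _ _ _ P _ 1) => // w; rewrite normr1.
have H : (\int[P]_w (h k w)%:E @[k --> \oo] --> \int[P]_w (cst 0%:E w))%E.
  apply: (dominated_cvg measurableT _ _ _ i1) => //=.
  - by move=> k; exact/measurable_EFinP.
  - by move=> w _; apply: cvg_EFin; [exact: nearW|exact: h0].
  - by move=> k w _; rewrite lee_fin.
by rewrite integral_cst// mul0e in H; exact: (fine_cvg H).
Qed.

Lemma measurable_trigfun f b : trigfun f -> measurable_fun setT (fun w => f (Y b w)).
Proof.
move=> [N [p fp]]; under eq_fun do rewrite fp /evN /pairing.
apply: measurable_sum => t; under eq_fun do rewrite Re_mulc chrNE.
have mS : measurable_fun setT (fun w => \sum_(n < N) t.2 n * Y b w n).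
  by apply: measurable_sum => n; exact: measurable_funM.
have [mR mI] := cmeasurable_cis mS.
by apply: measurable_funB; exact: measurable_funM.
Qed.

(* Keeping the approximants in [0, 1] lets [tv_trig] apply to them; closure
   under products then makes the approximable sets a sigma-algebra without any
   Stone-Weierstrass argument. *)
Definition approximable g :=
  [/\ forall b, measurable_fun setT (fun w => g (Y b w)), forall x, 0 <= g x <= 1 &
      forall eps : R, 0 < eps -> exists f, [/\ trigfun f, forall x, 0 <= f x <= 1 &
        forall b, \int[P]_w `|g (Y b w) - f (Y b w)| <= eps]].

Let dist_le1 (u v : R) : 0 <= u <= 1 -> 0 <= v <= 1 -> `|u - v| <= 1.
Proof. by move=> /andP[? ?] /andP[? ?]; rewrite ler_norml; apply/andP; split; lra. Qed.

Let m_dist f g b : measurable_fun setT (fun w => f (Y b w)) ->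
  measurable_fun setT (fun w => g (Y b w)) ->
  measurable_fun setT (fun w => `|f (Y b w) - g (Y b w)|).
Proof. by move=> mf mg; apply: measurableT_comp => //; exact: measurable_funB. Qed.

Let i_dist f g b : measurable_fun setT (fun w => f (Y b w)) ->
  measurable_fun setT (fun w => g (Y b w)) -> (forall x, 0 <= f x <= 1) ->
  (forall x, 0 <= g x <= 1) ->
  P.-integrable setT (EFin \o (fun w => `|f (Y b w) - g (Y b w)|)).
Proof.
move=> mf mg f01 g01; apply: (@integrable_P _ _ _ P _ 1); first exact: m_dist.
by move=> w; rewrite normr_id dist_le1.
Qed.

Lemma approximable_lim (g_ : nat -> (nat -> R) -> R) g :
  (forall k, approximable (g_ k)) -> (forall x, g_ k x @[k --> \oo] --> g x) ->
  approximable g.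
Proof.
move=> ag gg.
have mg_ k b : measurable_fun setT (fun w => g_ k (Y b w)) by case: (ag k).
have g_01 k x : 0 <= g_ k x <= 1 by case: (ag k).
have mg b : measurable_fun setT (fun w => g (Y b w)).
  by apply: (measurable_fun_cvg (fun k => mg_ k b)) => w _; exact: gg.
have g01 x : 0 <= g x <= 1.
  apply/andP; split.
    by apply: (ler_cvg_to (cvg_cst 0) (gg x)); apply: nearW => k; case/andP: (g_01 k x).
  by apply: (ler_cvg_to (gg x) (@cvg_cst _ (1 : R) _ \oo _)); apply: nearW => k; case/andP: (g_01 k x).
split => // eps e0.
have e2 : 0 < eps / 2 by rewrite divr_gt0.
have L b : \int[P]_w `|g (Y b w) - g_ k (Y b w)| @[k --> \oo] --> 0.
  apply: Rintegral_bounded_cvg0 => [k|k w|w]; first exact: m_dist.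
    by rewrite ger0_norm// dist_le1.
  rewrite -(normr0 R) -(subrr (g (Y b w))); apply: cvg_norm.
  by apply: cvgB; [exact: cvg_cst|exact: gg].
have near_b b : \forall k \near \oo, \int[P]_w `|g (Y b w) - g_ k (Y b w)| <= eps / 2.
  exact: (cvgr_le 0 (L b) _ e2).
have [k [kt kf]] := @filter_ex _ _ _ _ (filterI (near_b true) (near_b false)).
have [_ _ /(_ _ e2)[f [tf f01 fe]]] := ag k.
exists f; split => // b.
have mf := measurable_trigfun b tf.
apply: (@le_trans _ _ (\int[P]_w (`|g (Y b w) - g_ k (Y b w)| +
    `|g_ k (Y b w) - f (Y b w)|))).
  apply: le_Rintegral => //; first exact: i_dist.
    rewrite /comp; under eq_fun do rewrite EFinD.
    by apply: integrableD => //; exact: i_dist.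
  by move=> w _; rewrite (le_trans _ (ler_normD _ _))// addrA subrK.
rewrite RintegralD//; [|exact: i_dist..].
rewrite (splitr eps) lerD//; by case: b {mf}.
Qed.

Lemma approximable_trigfun f : trigfun f -> (forall x, 0 <= f x <= 1) -> approximable f.
Proof.
move=> tf f01; split => // [b|eps e0]; first exact: measurable_trigfun.
exists f; split => // b; under eq_Rintegral do rewrite subrr normr0.
by rewrite Rintegral_cst// mul0r ltW.
Qed.

Lemma approximableM f g : approximable f -> approximable g ->
  approximable (fun x => f x * g x).
Proof.
move=> [mf f01 af] [mg g01 ag]; split => [b|x|eps e0].
- exact: measurable_funM.
- have /andP[? ?] := f01 x; have /andP[? ?] := g01 x.
  by rewrite mulr_ge0//= mulr_ile1.
have e2 : 0 < eps / 2 by rewrite divr_gt0.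
have [f' [tf f'01 fe]] := af _ e2; have [g' [tg g'01 ge]] := ag _ e2.
exists (fun x => f' x * g' x); split => [|x|b].
- exact: trigfunM.
- have /andP[? ?] := f'01 x; have /andP[? ?] := g'01 x.
  by rewrite mulr_ge0//= mulr_ile1.
have mf' := measurable_trigfun b tf; have mg' := measurable_trigfun b tg.
apply: (@le_trans _ _ (\int[P]_w (`|f (Y b w) - f' (Y b w)| +
    `|g (Y b w) - g' (Y b w)|))).
  have p01 (u v : (nat -> R) -> R) : (forall x, 0 <= u x <= 1) ->
      (forall x, 0 <= v x <= 1) -> forall x, 0 <= u x * v x <= 1.
    move=> u01 v01 x; have /andP[? ?] := u01 x; have /andP[? ?] := v01 x.
    by rewrite mulr_ge0//= mulr_ile1.
  apply: le_Rintegral => //.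
  - by apply: (@i_dist (fun x => f x * g x) (fun x => f' x * g' x));
      [exact: measurable_funM..|exact: p01|exact: p01].
  - rewrite /comp; under eq_fun do rewrite EFinD.
    by apply: integrableD => //; exact: i_dist.
  move=> w _; move: (Y b w) => x.
  have -> : f x * g x - f' x * g' x = (f x - f' x) * g x + f' x * (g x - g' x) by ring.
  rewrite (le_trans (ler_normD _ _))// !normrM lerD//.
    by rewrite ler_piMr//; have /andP[? ?] := g01 x; rewrite ger0_norm.
  by rewrite ler_piMl//; have /andP[? ?] := f'01 x; rewrite ger0_norm.
rewrite RintegralD//; [|exact: i_dist..].
by rewrite (splitr eps) lerD.
Qed.

Lemma approximableC f : approximable f -> approximable (fun x => 1 - f x).
Proof.
move=> [mf f01 af]; split => [b|x|eps e0].
- exact: measurable_funB.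
- by have /andP[? ?] := f01 x; rewrite subr_ge0 gerBl; apply/andP.
have [f' [tf f'01 fe]] := af _ e0; exists (fun x => 1 - f' x); split => [|x|b].
- by apply: trigfunB => //; exact: trigfun_cst.
- by have /andP[? ?] := f'01 x; rewrite subr_ge0 gerBl; apply/andP.
rewrite (le_trans _ (fe b))// le_eqVlt; apply/orP; left; apply/eqP.
apply: eq_Rintegral => w _.
have -> : 1 - f (Y b w) - (1 - f' (Y b w)) = f' (Y b w) - f (Y b w) by ring.
by rewrite distrC.
Qed.

Definition approximable_set B := approximable (\1_B : (nat -> R) -> R).

Lemma approximable_sin_lt n (a c : R) : approximable_set [set x | sin (a * x n) < c].
Proof.
(* [M] bounds [|sin - c|], so [v] stays in [[0, 1]], and it is below 1/2 exactly when the sine is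
   below [c]. *)
pose M := `|c| + 1; have M0 : 0 < M by rewrite ltr_wpDl.
pose v (x : nat -> R) := 1 / 2 + (sin (a * x n) - c) / (2 * M).
have v01 x : 0 <= v x <= 1.
  have : `|(sin (a * x n) - c) / (2 * M)| <= 1 / 2.
    rewrite normrM normfV (@gtr0_norm _ (2 * M)) ?mulr_gt0// ler_pdivrMr ?mulr_gt0//.
    rewrite mulrA mul1r mulVf// mul1r (le_trans (ler_normB _ _))// /M addrC lerD2l.
    by rewrite ler_norml sin_geN1 sin_le1.
  by rewrite ler_norml => /andP[? ?]; apply/andP; split; rewrite /v; lra.
have tv : trigfun v.
  apply: trigfunD; first exact: trigfun_cst.
  apply: trigfunM; last exact: trigfun_cst.
  by apply: trigfunB; [exact: trigfun_sin|exact: trigfun_cst].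
have u01 (y : R) k m : 0 <= y <= 1 -> 0 <= (1 - y ^+ k) ^+ m <= 1.
  move=> /andP[y0 y1].
  have y2 : 0 <= 1 - y ^+ k by rewrite subr_ge0 exprn_ile1.
  by rewrite exprn_ge0// exprn_ile1// gerBl exprn_ge0.
apply: (@approximable_lim (fun k x => (1 - v x ^+ k) ^+ (k * 2 ^ k))) => [k|x].
  apply: approximable_trigfun => [|x]; last exact: u01.
  apply: trigfunX; apply: trigfunB; first exact: trigfun_cst.
  exact: trigfunX.
have -> : \1_[set x | sin (a * x n) < c] x = (v x < 1 / 2)%R%:R :> R.
  rewrite indicE /v; congr (_%:R); congr nat_of_bool; apply/idP/idP; rewrite inE/=.
    by rewrite -ltrBrDl subrr pmulr_llt0 ?invr_gt0 ?mulr_gt0// subr_lt0.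
  by rewrite -ltrBrDl subrr pmulr_llt0 ?invr_gt0 ?mulr_gt0// subr_lt0.
exact: indic_lt_half_cvg.
Qed.

Lemma approximable_sigma_algebra : sigma_algebra setT approximable_set.
Proof.
have setC B : approximable_set B -> approximable_set (~` B).
  move=> /approximableC; rewrite /approximable_set; congr approximable.
  by apply/funext => x; rewrite !indicE in_setC; case: (_ \in _); rewrite ?subrr ?subr0.
have setI A B : approximable_set A -> approximable_set B -> approximable_set (A `&` B).
  move=> /approximableM h /h; rewrite /approximable_set; congr approximable.
  by apply/funext => x; rewrite indicI.
have set0 : approximable_set set0.
  rewrite /approximable_set indic0; apply: approximable_trigfun; first exact: trigfun_cst.
  by move=> x /=; rewrite lexx ler01.
split => [//|A|F aF]; first by rewrite setTD; exact: setC.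
have aU n : approximable_set (\bigcup_(i < n) F i).
  elim: n => [|n ih]; first by rewrite bigcup_mkord big_ord0.
  have -> : \bigcup_(i < n.+1) F i = ~` (~` (\bigcup_(i < n) F i) `&` ~` F n).
    by rewrite -setCU setCK !bigcup_mkord big_ord_recr.
  exact: (setC _ (setI _ _ (setC _ ih) (setC _ (aF n)))). 
apply: (approximable_lim aU) => x; apply: cvg_near_cst.
have [[i _ Fi]|nF] := pselect ((\bigcup_k F k) x).
  near=> n.
  have Fn : (\bigcup_(i < n) F i) x.
    by exists i => //=; near: n; exact: nbhs_infty_gt.
  have FU : (\bigcup_k F k) x by exists i.
  by rewrite !indicE (mem_set Fn) (mem_set FU).
apply: nearW => n; rewrite !indicE !memNset// => -[k _ Fk]; apply: nF.
by exists k.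
Unshelve. all: end_near. Qed.

(* Since k sin (x n / k) tends to x n, this generates the product
   sigma-algebra. *)
Definition coord_gen : set_system (nat -> R) :=
  [set B | exists n (k : nat) c, B = [set x | sin (k.+1%:R^-1 * x n) < c]].

Lemma approximable_coord_gen B : <<s coord_gen >> B -> approximable_set B.
Proof.
apply: smallest_sub; first exact: approximable_sigma_algebra.
by move=> _ [n [k [c ->]]]; exact: approximable_sin_lt.
Qed.

Variable c : R.
Hypothesis tv_trig : forall f, trigfun f -> (forall x, `|f x| <= 1) ->
  `|\int[P]_w f (Y true w) - \int[P]_w f (Y false w)| <= c.

(** An approximant [f] with values in [[0, 1]] is tested through [2 f - 1], with values in
    [[-1, 1]]; this halves the constant. *)
Lemma tv_coord_gen B : <<s coord_gen >> B ->
  `|\int[P]_w \1_B (Y true w) - \int[P]_w \1_B (Y false w)| <= c / 2.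
Proof.
move=> /approximable_coord_gen[mB B01 aB].
apply/ler_addgt0Pr => eps e0.
have e2 : 0 < eps / 2 by rewrite divr_gt0.
have [f [tf f01 fe]] := aB _ e2.
have mf b := measurable_trigfun b tf.
have i01 (g : (nat -> R) -> R) b : measurable_fun setT (fun w => g (Y b w)) ->
    (forall x, 0 <= g x <= 1) -> P.-integrable setT (EFin \o (fun w => g (Y b w))).
  move=> mg g01; apply: (@integrable_P _ _ _ P _ 1) => // w.
  by have /andP[? ?] := g01 (Y b w); rewrite ger0_norm.
have D b : `|\int[P]_w \1_B (Y b w) - \int[P]_w f (Y b w)| <= eps / 2.
  rewrite -RintegralB//; [|exact: i01..].
  apply: le_trans (fe b); apply: le_normr_Rintegral => //.
  rewrite /comp; under eq_fun do rewrite EFinB.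
  by apply: integrableB => //; exact: i01.
have F : `|\int[P]_w f (Y true w) - \int[P]_w f (Y false w)| <= c / 2.
  have t2 : trigfun (fun x => 2 * f x - 1).
    by apply: trigfunB; [exact: trigfunZ|exact: trigfun_cst].
  have := tv_trig t2.
  have E b : \int[P]_w (2 * f (Y b w) - 1) = 2 * \int[P]_w f (Y b w) - \int[P]_w (cst 1 w : R).
    rewrite -RintegralZl//; last exact: i01.
    apply: RintegralB => //; last by apply: (@integrable_P _ _ _ P _ 1) => // w; rewrite normr1.
    by rewrite /comp; under eq_fun do rewrite EFinM; apply: integrableZl => //; exact: i01.
  rewrite !E opprB addrA subrK -mulrBr normrM (@ger0_norm _ 2)// ler_pdivlMr// mulrC; apply.
  by move=> x; have /andP[? ?] := f01 x; rewrite ler_norml; apply/andP; split; lra.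
have := D true; have := D false; move: F; rewrite !ler_norml.
move=> /andP[? ?] /andP[? ?] /andP[? ?]; apply/andP; split; lra.
Qed.

End approximation.

(** * Coordinates in H and the theorem *)


Section orthonormal.
Variables (R : realType) (H : completeNormedModType R) (dot : H -> H -> R) (e : nat -> H).
Hypothesis Hdot : inner_product dot.
Hypothesis He : orthonormal_basis dot e.

Let dotC u v : dot u v = dot v u. Proof. by case: Hdot. Qed.

Let dotZDl a u v w : dot (a *: u + v) w = a * dot u w + dot v w.
Proof. by case: Hdot. Qed.

Let norm_dot u : `|u| ^+ 2 = dot u u. Proof. by case: Hdot. Qed.

Lemma dot0l w : dot 0 w = 0.
Proof.
by have := dotZDl 1 0 0 w; rewrite scale1r addr0 mul1r => /eqP; rewrite addrC -subr_eq subrr => /eqP.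
Qed.

Lemma dotZl a u w : dot (a *: u) w = a * dot u w.
Proof. by have := dotZDl a u 0 w; rewrite !addr0 dot0l addr0. Qed.

Lemma dotDl u v w : dot (u + v) w = dot u w + dot v w.
Proof. by have := dotZDl 1 u v w; rewrite scale1r mul1r. Qed.

Lemma norm_sqrD u v : `|u + v| ^+ 2 = `|u| ^+ 2 + 2 * dot u v + `|v| ^+ 2.
Proof.
rewrite !norm_dot dotDl (dotC u (u + v)) (dotC v (u + v)) !dotDl (dotC v u); ring.
Qed.

Lemma dot_sum_lt N M (p : pred nat) (x : nat -> R) : (N <= M)%N ->
  dot (\sum_(k < N | p k) x k *: e k) (e M) = 0.
Proof.
elim: N => [|N ih] NM; first by rewrite big_ord0 dot0l.
rewrite big_mkcond big_ord_recr/= -big_mkcond dotDl ih ?(ltnW NM)// add0r.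
case: (p N); last by rewrite dot0l.
by rewrite dotZl; case: He => -> _; rewrite (ltn_eqF NM) mulr0.
Qed.

(** One expansion serves three times: Bessel's inequality, the Cauchy tails of a square-summable
    sequence ([p] cuts below [m], [h = 0]), and distances as functions of the coordinates. *)
Lemma norm_sqr_sum N (p : pred nat) (x : nat -> R) (h : H) :
  `|\sum_(k < N | p k) x k *: e k - h| ^+ 2 =
  \sum_(k < N | p k) (x k ^+ 2 - 2 * x k * dot h (e k)) + `|h| ^+ 2.
Proof.
elim: N => [|N ih]; first by rewrite !big_ord0 sub0r add0r normrN.
rewrite big_mkcond big_ord_recr/= -big_mkcond.
rewrite [in RHS]big_mkcond [in RHS]big_ord_recr/= -[in RHS]big_mkcond.
have [pN|pN] := boolP (p N); last by rewrite !addr0.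
rewrite addrAC norm_sqrD ih (dotC _ (x N *: e N)) dotZl (dotC (e N)) dotDl.
rewrite dot_sum_lt// add0r (norm_dot (x N *: e N)) dotZl (dotC (e N)) dotZl.
case: He => -> _.
have -> : dot (- h) (e N) = - dot h (e N) by rewrite -scaleN1r dotZl mulN1r.
by rewrite eqxx mulr1; ring.
Qed.

Lemma bessel N z : \sum_(k < N) dot z (e k) ^+ 2 <= `|z| ^+ 2.
Proof.
have := norm_sqr_sum N xpredT (fun k => dot z (e k)) z.
have -> : \sum_(k < N) (dot z (e k) ^+ 2 - 2 * dot z (e k) * dot z (e k)) =
    - \sum_(k < N) dot z (e k) ^+ 2 by rewrite -sumrN; apply: eq_bigr => k _; ring.
by move=> E; rewrite -subr_ge0 addrC -E sqr_ge0.
Qed.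

Lemma cvg_coords (x : nat -> R) : cvgn (series (fun n => x n ^+ 2)) ->
  cvgn (series (fun n => x n *: e n)).
Proof.
move=> /cvg_cauchy/cauchy_seriesP cx; apply/cauchy_cvgP/cauchy_seriesP => eps e0.
have e2 : 0 < eps ^+ 2 by rewrite exprn_gt0.
apply: filterS (cx _ e2) => -[m n]/=.
rewrite !big_geq_mkord/= => h; rewrite -(@ltr_pXn2r _ 2)// ?nnegrE ?(ltW e0)//.
have := norm_sqr_sum n (fun k => m <= k)%N x 0; rewrite subr0 normr0 expr0n/= addr0 => ->.
apply: le_lt_trans h; rewrite le_eqVlt; apply/orP; left; apply/eqP.
rewrite ger0_norm; last by apply: sumr_ge0 => k _; exact: sqr_ge0.
by apply: eq_bigr => k _; rewrite dot0l mulr0 subr0.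
Qed.

Let rat_comb (s : seq rat) : H := \sum_(k < size s) ratr (nth 0 s k) *: e k.

Lemma rat_comb_dense (h : H) (eps : R) : 0 < eps ->
  exists s, `|rat_comb s - h| < eps.
Proof.
move=> e0; have e2 : 0 < eps / 2 by rewrite divr_gt0.
have [_ /(_ h) /cvgrPdist_lt /(_ _ e2) [N _ /(_ N (leqnn N))]] := He.
rewrite /series/= big_mkord => hN.
have d0 : 0 < eps / (2 * N.+1%:R) by rewrite divr_gt0// mulr_gt0.
have ratP k : exists q : rat, `|ratr q - dot h (e k)| < eps / (2 * N.+1%:R).
  have : dot h (e k) - eps / (2 * N.+1%:R) < dot h (e k) + eps / (2 * N.+1%:R).
    by rewrite ltrD2l gtrN.
  move=> /rat_in_itvoo[q]; rewrite in_itv/= => /andP[q1 q2]; exists q.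
  by rewrite ltr_distl q1.
have [r rP] := choice ratP.
exists (mkseq r N); rewrite /rat_comb size_mkseq.
set S := \sum_(k < N) _ in hN.
set S' := \sum_(k < N) _.
have -> : S' - h = (S' - S) + (S - h) by rewrite addrA subrK.
rewrite (le_lt_trans (ler_normD _ _))// (splitr eps) ler_ltD//; last by rewrite distrC.
rewrite /S' /S -sumrB (le_trans (ler_norm_sum _ _ _))//.
have e1 k : `|e k| = 1.
  have := norm_dot (e k); case: He => -> _; rewrite eqxx => /eqP.
  by rewrite sqrf_eq1 => /orP[/eqP//|/eqP E]; have := normr_ge0 (e k); rewrite E; lra.
apply: (@le_trans _ _ (\sum_(k < N) eps / (2 * N.+1%:R))).
  apply: ler_sum => k _; rewrite nth_mkseq// -scalerBl normrZ e1 mulr1.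
  exact: ltW.
rewrite sumr_const card_ord -[leLHS]mulr_natr.
have -> : eps / (2 * N.+1%:R) * N%:R = eps / 2 * (N%:R / N.+1%:R) by rewrite invfM; ring.
by rewrite ler_piMr ?(ltW e2)// ler_pdivrMr// mul1r ler_nat.
Qed.

Lemma open_bigcup_rat_ball (U : set H) : open U ->
  U = \bigcup_(i in [set i : seq rat * nat |
        [set h | `|h - rat_comb i.1| < i.2.+1%:R^-1] `<=` U])
      [set h | `|h - rat_comb i.1| < i.2.+1%:R^-1].
Proof.
move=> oU; apply/seteqP; split => [h Uh|h [i iU hi]]; last exact: iU.
have /nbhs_normP[r/= r0 rU] : nbhs h U by exact: open_nbhs_nbhs.
have r2 : 0 < r / 2 by rewrite divr_gt0.
have [n _ /(_ n (leqnn n)) nr] := near_infty_natSinv_lt (PosNum r2).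
have [s hs] := @rat_comb_dense h n.+1%:R^-1 ltac:(by rewrite invr_gt0).
exists (s, n) => /=; last by rewrite distrC.
move=> g/= gs; apply: rU => /=.
have -> : h - g = (h - rat_comb s) + (rat_comb s - g) by rewrite addrA subrK.
rewrite (le_lt_trans (ler_normD _ _))// (splitr r) ltrD// distrC.
  exact: lt_trans nr.
exact: lt_trans nr.
Qed.

(** Finite rational combinations of the basis are countable and dense, so every open set is a
    countable union of balls around them. *)
Lemma measurable_borelP d (S : measurableType d) (F : S -> H) :
  (forall h, measurable_fun setT (fun s => `|F s - h|)) ->
  measurable_fun setT (F : S -> borel H).
Proof.
move=> mF; apply: (@measurability _ _ S (borel H) setT F (@open H) erefl) => _ [U oU <-].
rewrite (open_bigcup_rat_ball oU) setTI preimage_bigcup.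
rewrite bigcup_mkcond; apply: countable_bigcupT_measurable; first exact: countableP.
move=> i; case: ifP => // _.
have -> : F @^-1` [set h | `|h - rat_comb i.1| < i.2.+1%:R^-1] =
    setT `&` (fun s => `|F s - rat_comb i.1|) @^-1` `]-oo, i.2.+1%:R^-1[.
  by rewrite setTI; apply/seteqP; split => s /=; rewrite in_itv.
exact: mF.
Qed.

Let S := g_sigma_algebraType (@coord_gen R).

Let m_sin n k : measurable_fun setT (fun x : S => sin (k.+1%:R^-1 * x n)).
Proof.
apply: (measurability _ (RGenInftyO.measurableE R)) => // _ [_ [c ->] <-].
apply: sub_sigma_algebra; exists n, k, c.
by rewrite setTI; apply/seteqP; split => x /=; rewrite in_itv.
Qed.

(** The cubic remainder of the sine at [y / k.+1], multiplied by [k.+1], is at most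
    [|y|^3 / (2 * k.+1)]. Coordinates thereby become limits of the functions defining
    [coord_gen]. *)
Lemma sin_div_cvg (y : R) : k.+1%:R * sin (k.+1%:R^-1 * y) @[k --> \oo] --> y.
Proof.
have h : (k.+1%:R^-1 : R) * (`|y| ^+ 3 / 2) @[k --> \oo] --> 0.
  by rewrite -[X in _ --> X](mul0r (`|y| ^+ 3 / 2)); apply: cvgMl; exact: cvg_harmonic.
apply/cvgrPdist_le => eps e0.
move/cvgrPdist_le : h => /(_ _ e0); apply: filterS => k; apply: le_trans.
have k0 : 0 < k.+1%:R :> R by [].
have i0 : 0 < k.+1%:R^-1 :> R by rewrite invr_gt0.
have i1 : k.+1%:R^-1 <= 1 :> R by rewrite invf_le1// ler1n.
set i := k.+1%:R^-1 in i0 i1 *.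
have {1}-> : y = k.+1%:R * (i * y) by rewrite mulrA divff ?mul1r// gt_eqF.
rewrite -mulrBr normrM (gtr0_norm k0) sub0r normrN.
have y0 : 0 <= `|y| ^+ 3 / 2 by rewrite divr_ge0// exprn_ge0.
rewrite (@ger0_norm _ (_ * _)) ?mulr_ge0 ?(ltW i0)//.
have := ler_wpM2l (ltW k0) (normr_sub_sin_le (i * y)).
move=> /le_trans; apply.
rewrite normrM (gtr0_norm i0).
have ki : k.+1%:R * i = 1 by rewrite divff// gt_eqF.
have -> : k.+1%:R * ((i * `|y|) ^+ 3 / 2) = k.+1%:R * i * (i * i) * (`|y| ^+ 3 / 2) by ring.
rewrite ki mul1r; apply: ler_wpM2r => //.
by rewrite ler_piMr ?(ltW i0).
Qed.

Lemma measurable_coord n : measurable_fun setT (fun x : S => x n).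
Proof.
apply: (@measurable_fun_cvg _ _ _ _ (fun k (x : S) => k.+1%:R * sin (k.+1%:R^-1 * x n))).
  by move=> k; exact: measurable_funM.
by move=> x _; exact: sin_div_cvg.
Qed.

Let A : set S := [set x : nat -> R | cvgn (series (fun n => x n ^+ 2))].

Let mA : measurable A.
Proof.
(* Square-summability means that the partial sums are bounded by some integer, a countable
   condition. *)
have -> : A = \bigcup_(M : nat) \bigcap_(N : nat)
    [set x : S | \sum_(k < N) x k ^+ 2 <= M%:R].
  apply/seteqP; split => x.
    rewrite /A /= => cx.
    have nd : nondecreasing_seq (series (fun n => x n ^+ 2)).
      by apply: nondecreasing_series => n _ _; exact: sqr_ge0.
    have := nondecreasing_cvgn_le nd cx; set l := limn _ => hl.
    exists (Num.bound l) => // N _ /=; have := hl N; rewrite /series/= big_mkord.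
    have l0 : 0 <= l by have := hl 0%N; rewrite /series/= big_geq.
    by move=> /le_trans; apply; exact/ltW/archi_boundP.
  move=> [M _ hM]; apply: nondecreasing_is_cvgn.
    by apply: nondecreasing_series => n _ _; exact: sqr_ge0.
  by exists M%:R => _ [N _ <-]; rewrite /series/= big_mkord; exact: hM.
apply: bigcupT_measurable => M; apply: bigcapT_measurable => N.
have mS : measurable_fun setT (fun x : S => \sum_(k < N) x k ^+ 2).
  by apply: measurable_sum => k; apply: measurable_funX; exact: measurable_coord.
rewrite (_ : [set x | _] = setT `&` (fun x : S => \sum_(k < N) x k ^+ 2) @^-1` `]-oo, M%:R]).
  exact: mS.
by rewrite setTI; apply/seteqP; split => s /=; rewrite in_itv.
Qed.

Lemma measurable_of_coords : measurable_fun setT (of_coords e : S -> borel H).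
Proof.
apply: measurable_borelP => h.
(* On [A] the root is the distance from [h] to the N-th partial sum; off [A] only [|h|] is left, the
   distance to the default value 0. *)
apply: (@measurable_fun_cvg _ _ _ _ (fun N (x : S) => \1_A x *
    (Num.sqrt (\sum_(k < N) (x k ^+ 2 - 2 * x k * dot h (e k)) + `|h| ^+ 2) - `|h|) + `|h|)).
  move=> N; apply: measurable_funD => //; apply: measurable_funM.
    exact: measurable_indic.
  apply: measurable_funB => //; apply: measurableT_comp.
    by apply: continuous_measurable_fun; exact: sqrt_continuous.
  apply: measurable_funD => //; apply: measurable_sum => k.
  apply: measurable_funB; first by apply: measurable_funX; exact: measurable_coord.
  by apply: measurable_funM => //; apply: measurable_funM => //; exact: measurable_coord.
move=> x _; rewrite /of_coords; case: asboolP => cx.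
  have Ax : x \in A by rewrite inE.
  rewrite indicE Ax.
  have hc : (series (fun n => x n *: e n) N - h) @[N --> \oo] -->
      limn (series (fun n => x n *: e n)) - h.
    by apply: cvgB; [exact: cvg_coords cx|exact: cvg_cst].
  have E N : 1 * (Num.sqrt (\sum_(k < N) (x k ^+ 2 - 2 * x k * dot h (e k)) + `|h| ^+ 2) -
      `|h|) + `|h| = `|series (fun n => x n *: e n) N - h|.
    rewrite mul1r subrK -(norm_sqr_sum N xpredT) sqrtr_sqr normr_id.
    by rewrite /series/= big_mkord.
  by under eq_cvg do rewrite E; exact: cvg_norm hc.
have Ax : (x \in A) = false by apply/negbTE; rewrite notin_setE.
by rewrite indicE Ax sub0r normrN; under eq_cvg do rewrite mul0r add0r; exact: cvg_cst.
Qed.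

Lemma measurable_sequence d (T : measurableType d) (Y : T -> nat -> R) :
  (forall n, measurable_fun setT (fun w => Y w n)) ->
  measurable_fun setT (Y : T -> S).
Proof.
move=> mY; apply: (@measurability _ _ T S setT Y (@coord_gen R) erefl) => _ [_ [n [k [c ->]]] <-].
have ms : measurable_fun setT (fun w => sin (k.+1%:R^-1 * Y w n)).
  apply: measurableT_comp; last exact: measurable_funM.
  by apply: continuous_measurable_fun; exact: continuous_sin.
rewrite (_ : _ @^-1` _ = (fun w => sin (k.+1%:R^-1 * Y w n)) @^-1` `]-oo, c[).
  exact: ms.
by apply/seteqP; split => s /=; rewrite in_itv.
Qed.

End orthonormal.

Section tv_of_coords.
Context d (T : measurableType d) (R : realType) (P : probability T R).
Variables (Y : bool -> T -> nat -> R).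
Hypothesis mY : forall b n, measurable_fun setT (fun w => Y b w n).
Variable c : R.
Hypothesis tv_trig : forall f, trigfun f -> (forall x, `|f x| <= 1) ->
  `|\int[P]_w f (Y true w) - \int[P]_w f (Y false w)| <= c.
Variables (H : completeNormedModType R) (dot : H -> H -> R) (e : nat -> H).
Hypothesis Hdot : inner_product dot.
Hypothesis He : orthonormal_basis dot e.

Let X b w : borel H := of_coords e (Y b w).

Let mX b : measurable_fun setT (X b).
Proof.
have mS := measurable_sequence (mY b).
exact: (measurableT_comp (measurable_of_coords Hdot He) mS).
Qed.

Lemma tv_of_coords (g : H -> R) : measurable_fun setT (g : borel H -> R) ->
  (forall h, `|g h| <= 1) ->
  `|\int[P]_w g (of_coords e (Y true w)) - \int[P]_w g (of_coords e (Y false w))| <= c.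
Proof.
move=> mg g1.
pose u (h : borel H) : R := (g h + 1) / 2.
have mu : measurable_fun setT u.
  by apply: measurable_funM => //; exact: measurable_funD.
have u01 h : 0 <= u h <= 1.
  by have := g1 h; rewrite ler_norml /u => /andP[? ?]; apply/andP; split; lra.
have i1 : P.-integrable setT (EFin \o (cst 1 : T -> R)).
  by apply: (@integrable_P _ _ _ P _ 1) => // w; rewrite normr1.
have M1 (v : T -> R) : \int[P]_w (v w * cst 1 w) = \int[P]_w v w.
  by apply: eq_Rintegral => w _; rewrite mulr1.
have ig b : P.-integrable setT (EFin \o (fun w => g (X b w))).
  by apply: (@integrable_P _ _ _ P _ 1) => //; exact: measurableT_comp.
have U b : \int[P]_w u (X b w) = 2^-1 * (\int[P]_w g (X b w) + 1).
  have C1 : \int[P]_w (cst 1 w : R) = 1.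
    have PT : fine (P setT) = 1 by rewrite probability_setT.
    by have := @Rintegral_cst _ _ _ P setT measurableT 1; rewrite PT mulr1.
  rewrite -[X in _ * (_ + X)]C1 -RintegralD// -RintegralZl//.
    by apply: eq_Rintegral => w _; rewrite /u mulrC.
  by rewrite /comp; under eq_fun do rewrite EFinD; apply: (integrableD measurableT (ig b) i1).
have I B : measurable B ->
    `|\int[P]_w \1_B (X true w) - \int[P]_w \1_B (X false w)| <= c / 2.
  move=> mB; apply: (tv_coord_gen mY tv_trig (B := of_coords e @^-1` B)).
  by have := measurable_of_coords Hdot He measurableT mB; rewrite setTI.
have L b b' : (forall B, measurable B ->
      \int[P]_w \1_B (X b w) <= \int[P]_w \1_B (X b' w) + c / 2) ->
    \int[P]_w u (X b w) <= \int[P]_w u (X b' w) + c / 2.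
  move=> h; rewrite -M1 -[in leRHS]M1.
  apply: (@le_Rintegral_from_indic _ _ _ _ _ _ _ P P setT setT (cst 1) (cst 1)
    (X b) (X b') (c / 2)) => // B mB.
  by rewrite M1 [in leRHS]M1; exact: h.
have := L true false; have := L false true; rewrite !U.
move=> h1 h2; rewrite ler_norml; apply/andP; split.
  suff : 2^-1 * (\int[P]_w g (X false w) + 1) <= 2^-1 * (\int[P]_w g (X true w) + 1) + c / 2.
    by rewrite /X; lra.
  by apply: h1 => B mB; have := I B mB; rewrite ler_norml => /andP[? ?]; lra.
suff : 2^-1 * (\int[P]_w g (X true w) + 1) <= 2^-1 * (\int[P]_w g (X false w) + 1) + c / 2.
  by rewrite /X; lra.
by apply: h2 => B mB; have := I B mB; rewrite ler_norml => /andP[? ?]; lra.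
Qed.

End tv_of_coords.

(** * Lipschitz estimate for the semigroup and conclusion *)

Section lipschitz.
Context d (T : measurableType d) (R : realType) (P : probability T R).
Variables (H : completeNormedModType R) (dot : H -> H -> R) (e : nat -> H).
Variables (gamma : nat -> R) (Z : nat -> R -> {RV P >-> R}).
Variables (nu : nat -> {measure set (measurableTypeR R) -> \bar R}).
Variables (J : nat -> R -> {RV P >-> R}) (f : nat -> R -> R).
Hypothesis Hdot : inner_product dot.
Hypothesis He : orthonormal_basis dot e.
Hypothesis gamma_gt0 : forall n, 0 < gamma n.
Hypothesis HZ : forall n, pure_jump_levy_process (Z n) (nu n).
Hypothesis HZ_indep : mutually_independent P
  (fun n : nat => sigma_of [set t : R | 0 <= t] (fun t => Z n t : T -> R)).
Hypothesis HJ : forall n t, 0 <= t ->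
  is_stoch_integral (fun s => expR (- (gamma n * (t - s)))) (Z n) 0 t (J n t).
Hypothesis Hf : forall n, bernstein (f n).
Hypothesis Hf0 : forall n, f n 0 = 0.
Hypothesis Hf_log : forall n, f n r / ln (1 + r) @[r --> +oo] --> +oo.
Hypothesis Hnu : forall n (B : set (measurableTypeR R)), measurable B ->
  (\int[lebesgue_measure]_(z in B) (`|z|^-1 * f n (z ^- 2))%:E <= nu n B)%E.
Variable t : R.
Hypothesis t0 : 0 < t.

Let X := ou_process dot e gamma (fun n t => J n t : T -> R).

Lemma measurable_ou_process x : measurable_fun setT (X t x : T -> borel H).
Proof.
have mY n : measurable_fun setT
    (fun w => ou_coord dot e gamma (fun n t => J n t : T -> R) t x w n).
  by apply: measurable_funD => //; exact: measurable_funPT.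
exact: (measurableT_comp (measurable_of_coords Hdot He) (measurable_sequence mY)).
Qed.

(** Take [y] as base point, so that its damped coordinates form the offset and those of [x - y] the
    translation; Bessel bounds their squares by [|x - y|^2], uniformly in the number of
    coordinates. *)
Lemma semigroup_lipschitz (K : R) (g : H -> R) x y : 0 <= K ->
  (forall k, (mine
    (\int[lebesgue_measure]_(r in `[0%R, +oo[) (expR (- (cos 1 / 2 * t * f k r)))%:E)
    ((expR (- (gamma k * t)))%:E *
     \int[lebesgue_measure]_(r in `[0%R, +oo[)
       (expR (- (cos 1 * (1 - expR (- (2 * gamma k * t))) / (4 * gamma k) * f k r)))%:E)
    <= K%:E)%E) ->
  measurable_fun setT (g : borel H -> R) -> (forall h, `|g h| <= 1) ->
  `|semigroup P X t g x - semigroup P X t g y| <= Num.sqrt (2 * K) * `|x - y|.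
Proof.
move=> K0 HK mg g1.
pose Y (b : bool) w n := ou_coord dot e gamma (fun n t => J n t : T -> R) t
  (if b then x else y) w n.
have mY b n : measurable_fun setT (fun w => Y b w n).
  by apply: measurable_funD => //; exact: measurable_funPT.
apply: (tv_of_coords mY _ Hdot He mg g1) => F [N [p Fp]] F1.
have p1 z : `|evN N p z| <= 1 by rewrite -Fp.
have HJt n := HJ n (ltW t0).
have := @trigonometric_tv _ _ _ _ Z (fun n => J n t) nu gamma f t t0 gamma_gt0 HZ
  HZ_indep HJt Hf Hf0 Hf_log Hnu K K0 HK N (fun n => dot (x - y) (e n))
  (fun n => expR (- (gamma n * t)) * dot y (e n)) _ p (bessel Hdot He N (x - y)) p1.
rewrite sqrtrM ?mulr_ge0// sqrtr_sqr normr_id.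
have -> : \int[P]_w F (Y true w) = \int[P]_w evN N p (fun n =>
    expR (- (gamma n * t)) * dot y (e n) +
    (J n t w + expR (- (gamma n * t)) * dot (x - y) (e n))).
  apply: eq_Rintegral => w _; rewrite Fp; congr (evN N p); apply/funext => n.
  rewrite /Y /ou_coord (dotDl Hdot) -(scaleN1r y) (dotZl Hdot); ring.
have -> // : \int[P]_w F (Y false w) = \int[P]_w evN N p (fun n =>
    expR (- (gamma n * t)) * dot y (e n) + J n t w).
by apply: eq_Rintegral => w _; rewrite Fp.
Qed.

End lipschitz.

Lemma sup_norm_le1 (R : realType) (H : normedModType R) (g : H -> R) :
  (sup_norm g <= 1)%E -> forall h, `|g h| <= 1.
Proof.
move=> g1 h; rewrite -lee_fin (le_trans _ g1)//.
by apply: ereal_sup_ubound; exists h.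
Qed.

Lemma gradient_le (R : realType) (H : normedModType R) (F : H -> R) (C : R) z x :
  0 <= C -> `|z| <= 1 -> (forall u v, `|F u - F v| <= C * `|u - v|) ->
  (gradient F z x <= C%:E)%E.
Proof.
move=> C0 z1 FC.
pose V := [set eps : R | eps != 0].
apply: (@le_trans _ _ (ereal_sup ((fun eps : R =>
    (eps^-1 * `|F (x + eps *: z) - F x|)%:E) @` V))).
  (* The upper limit is an infimum over punctured neighbourhoods of 0; the whole punctured line is
     enough because the Lipschitz bound is global. *)
  by apply: ereal_inf_lbound; exists V => //; rewrite /dnbhs /within/=; apply: nearW.
apply: ge_ereal_sup => _ [eps e0 <-]; rewrite lee_fin.
(* The factor [eps^-1] keeps its sign, so negative [eps] gives nonpositive values. *)
have [eps_lt0|eps_ge0] := ltP eps 0.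
  by rewrite (le_trans _ C0)// mulr_le0_ge0// invr_le0 ltW.
have eps_gt0 : 0 < eps by rewrite lt_neqAle eq_sym e0.
rewrite mulrC ler_pdivrMr// (le_trans (FC _ _))// addrAC subrr add0r normrZ.
by rewrite gtr0_norm// mulrCA mulrC ler_wpM2r// ler_piMr.
Qed.

Theorem theorem1p1 (R : realType) (d : measure_display) (T : measurableType d)
    (P : probability T R)
    (H : completeNormedModType R) (dot : H -> H -> R) (e : nat -> H)
    (D : set H) (A : H -> H) (gamma : nat -> R)
    (Z : nat -> R -> {RV P >-> R})
    (nu : nat -> {measure set (measurableTypeR R) -> \bar R})
    (J : nat -> R -> {RV P >-> R})
    (f : nat -> R -> R)
    (Hdot : inner_product dot)
    (He : orthonormal_basis dot e)
    (HA : self_adjoint dot D A)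
    (HAe : forall n, D (e n) /\ A (e n) = - gamma n *: e n)
    (Hgamma_gt0 : forall n, 0 < gamma n)
    (Hgamma_lim : gamma n @[n --> \oo] --> +oo)
    (HZ : forall n, pure_jump_levy_process (Z n) (nu n))
    (HZ_indep : mutually_independent P
       (fun n : nat => sigma_of [set t : R | 0 <= t] (fun t => Z n t : T -> R)))
    (HJ : forall n t, 0 <= t ->
       is_stoch_integral (fun s => expR (- (gamma n * (t - s)))) (Z n) 0 t (J n t))
    (HX : summability_condition gamma nu)
    (Hf : forall n, bernstein (f n))
    (Hf0 : forall n, f n 0 = 0)
    (Hf_log : forall n, f n r / ln (1 + r) @[r --> +oo] --> +oo)
    (Hnu : forall n (B : set (measurableTypeR R)), measurable B ->
       (\int[lebesgue_measure]_(z in B) (`|z|^-1 * f n (z ^- 2))%:E <= nu n B)%E) :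
  let X := ou_process dot e gamma (fun n t => J n t : T -> R) in
  forall t : R, 0 < t -> forall x y : H,
    (gradient_norm (semigroup P X t) <= C_const gamma f t)%E /\
    (tv_norm (transition_law P X t x) (transition_law P X t y)
       <= 2%:E * C_const gamma f t * `|x - y|%:E)%E.
Proof.
move=> X t t0 x y.
pose I k := mine
  (\int[lebesgue_measure]_(r in `[0%R, +oo[) (expR (- (cos 1 / 2 * t * f k r)))%:E)%E
  ((expR (- (gamma k * t)))%:E *
   \int[lebesgue_measure]_(r in `[0%R, +oo[)
     (expR (- (cos 1 * (1 - expR (- (2 * gamma k * t))) / (4 * gamma k) * f k r)))%:E)%E.
have I0 k : (0 <= I k)%E.
  have E0 (u : R -> R) : (0 <= \int[lebesgue_measure]_(r in `[0%R, +oo[) (expR (u r))%:E)%E.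
    by apply: integral_ge0 => r _; rewrite lee_fin expR_ge0.
  by rewrite le_min !E0/= mule_ge0// lee_fin expR_ge0.
have CE : C_const gamma f t = sqrte (2%:E * ereal_sup [set I k | k in setT])%E by [].
set S := ereal_sup _ in CE.
have IS k : (I k <= S)%E by apply: ereal_sup_ubound; exists k.
have S0 : (0 <= S)%E by rewrite (le_trans (I0 0%N)).
have mX u : measurable_fun setT (X t u : T -> borel H) := measurable_ou_process gamma J Hdot He t u.
have integral_law (g : H -> R) u : bounded_borel g -> (forall h, `|g h| <= 1) ->
    (\int[transition_law P X t u]_v (g v)%:E)%E = (semigroup P X t g u)%:E.
  move=> [mg _] g1.
  have ig : P.-integrable setT (EFin \o (fun w => g (X t u w))).
    by apply: (@integrable_P _ _ _ P _ 1) => //; exact: (measurableT_comp mg (mX u)).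
  have mEg : measurable_fun setT (EFin \o g : borel H -> \bar R) by exact/measurable_EFinP.
  have := @integral_pushforward _ _ _ _ R _ (mX u) P setT (EFin \o g : borel H -> \bar R) mEg ig measurableT.
  rewrite /transition_law => ->.
  rewrite /semigroup /Rintegral fineK//; exact: integrable_fin_num ig.
have tv_diff (M : \bar R) : (forall g : H -> R, bounded_borel g -> (forall h, `|g h| <= 1) ->
    (`|semigroup P X t g x - semigroup P X t g y|%:E <= M)%E) ->
    (tv_norm (transition_law P X t x) (transition_law P X t y) <= M)%E.
  move=> HM; apply: ge_ereal_sup => _ [g [bg g1 ->]].
  have {}g1 := sup_norm_le1 g1.
  by rewrite !integral_law//; exact: HM.
have [Soo|Sfin] := eqVneq S +oo%E.
  have Coo : C_const gamma f t = +oo%E by rewrite CE Soo gt0_muley ?lte_fin.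
  rewrite Coo leey; split => //.
  (* When C_t is infinite and [x = y], the right side is 0 by the convention [+oo * 0 = 0], so the
     left side must be shown to vanish. *)
  have [->|xy] := eqVneq x y.
    rewrite subrr normr0 mule0; apply: (@le_trans _ _ 0%E) => //.
    by apply: ge_ereal_sup => _ [g [bg /sup_norm_le1 g1 ->]]; rewrite !integral_law// subee// abse0.
  by rewrite gt0_muley ?lte_fin// gt0_mulye ?leey// lte_fin normr_gt0 subr_eq0.
have SK : S = (fine S)%:E by rewrite fineK// ge0_fin_numE// ltey.
set K := fine S in SK.
have K0 : 0 <= K by rewrite -lee_fin -SK.
have CK : C_const gamma f t = (Num.sqrt (2 * K))%:E by rewrite CE SK.
have HK k : (I k <= K%:E)%E by rewrite -SK.
have L (g : H -> R) u v : bounded_borel g -> (forall h, `|g h| <= 1) ->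
    `|semigroup P X t g u - semigroup P X t g v| <= Num.sqrt (2 * K) * `|u - v|.
  move=> [mg _] g1.
  exact: (semigroup_lipschitz Hdot He Hgamma_gt0 HZ HZ_indep HJ Hf Hf0 Hf_log Hnu t0
    u v K0 HK mg g1).
rewrite CK; split.
  apply: ge_ereal_sup => _ [z [u [g [z1 bg g1 ->]]]].
  by apply: gradient_le => // a b; exact: L bg (sup_norm_le1 g1).
(* The Lipschitz bound has constant C_t; the factor 2 of the claim is slack. *)
apply: tv_diff => g bg g1; rewrite -!EFinM lee_fin (le_trans (L _ _ _ bg g1))//.
by rewrite ler_wpM2r// ler_peMl ?sqrtr_ge0// ler1n.
Qed.
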